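(* There exists an absolute constant $C>0$ such that the following holds. Let $a>0$, $\gamma>0$, $b>0$, let $J\subset\mathbb{R}$ be an interval with $|J|=b$, and let $p\in[1,+\infty]$. Let $E\subset\mathbb{R}$ be a measurable set such that $|E\cap I|\ge \gamma\, a$ for every interval $I\subset\mathbb{R}$ of length $a$. If $f\in L^p(\mathbb{R})$ and $\operatorname{supp}\hat f\subset J$, then $$\|f\|_{L^p(E)}\ \ge\ \left(\frac{\gamma}{C}\right)^{C\cdot(ab+1)}\cdot\|f\|_{p}.$$
   Context: $|\cdot|$ denotes Lebesgue measure. Functions are complex valued. $\hat f$ is the Fourier transform of $f$, taken in the sense of tempered distributions, with kernel $e^{-ix\xi}$. $\|f\|_p$ is the norm in $L^p(\mathbb{R})$ and $\|f\|_{L^p(E)}$ is the $L^p$ norm of the restriction of $f$ to $E$. The constant $C$ does not depend on $a,b,\gamma,p,J,E,f$. *)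

(* Defs.v *)
From HB Require Import structures.
From mathcomp Require Import all_boot all_order all_algebra.
From mathcomp Require Import all_classical all_reals all_analysis.
From mathcomp Require Import complex.

Set Implicit Arguments.
Unset Strict Implicit.
Unset Printing Implicit Defensive.
Import Order.TTheory GRing.Theory Num.Theory.
Import numFieldNormedType.Exports.
Local Open Scope classical_set_scope.
Local Open Scope ring_scope.

(* Carrier of the completed Lebesgue measure: it is convertible to [R], but its
   canonical sigma-algebra is that of all Lebesgue measurable sets, whereas
   [R] itself only carries the Borel sets. *)
Definition lebesgueType (R : realType) :=
  caratheodory_type ((@wlength R idfun)^*)%mu.

Notation leb R := (@completed_lebesgue_measure R).

Definition lebesgue_measurable (R : realType) (E : set R) : Prop :=
  measurable (E : set (lebesgueType R)).

Section ComplexFunctions.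
Context {R : realType}.
Implicit Types (f phi : R -> R[i]) (D E U : set R).

(* The library puts neither a sigma-algebra nor the structure of a normed space
   over [R] on [R[i]], so measurability, integration and differentiation of
   complex-valued functions go through real and imaginary parts.  Since [`|z|]
   lives in [R[i]], the [R]-valued modulus [Normc.normc] is used for norms. *)
Definition cmeasurable f : Prop :=
  measurable_fun [set: lebesgueType R] ((fun x => complex.Re (f x)) : lebesgueType R -> R) /\
  measurable_fun [set: lebesgueType R] ((fun x => complex.Im (f x)) : lebesgueType R -> R).

Definition cintegral f : R[i] :=
  Complex (\int[leb R]_x complex.Re (f x)) (\int[leb R]_x complex.Im (f x)).

(* [g \_ E] is [g] on [E] and [0] outside. *)
Definition Lp_norm (p : \bar R) (E : set R) f : \bar R :=
  ('N[leb R]_p[EFin \o ((fun x => Normc.normc (f x)) \_ E)])%E.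

Definition in_Lp (p : \bar R) f : Prop :=
  cmeasurable f /\ (Lp_norm p setT f < +oo)%E.

Definition smooth phi : Prop := forall (n : nat) (x : R),
  derivable (derive1n n (fun y => complex.Re (phi y))) x 1 /\
  derivable (derive1n n (fun y => complex.Im (phi y))) x 1.

Definition function_support phi : set R := closure [set x | phi x != 0].

Definition test_function U phi : Prop :=
  [/\ smooth phi, compact (function_support phi) & function_support phi `<=` U].

(* phi^(xi) is the integral of phi(x) exp(-i x xi). *)
Definition fourier phi (xi : R) : R[i] :=
  cintegral (fun x => phi x * Complex (cos (x * xi)) (- sin (x * xi))).

(* A tempered distribution is represented by its pairing [phi |-> T phi], as a
   total function; only its values on Schwartz functions are meaningful. *)
Definition distribution := (R -> R[i]) -> R[i].

Definition distribution_of f : distribution :=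
  fun phi => cintegral (fun x => f x * phi x).

(* <T^, phi> = <T, phi^> *)
Definition fourier_distribution (T : distribution) : distribution :=
  fun phi => T (fourier phi).

Definition vanishes_on (T : distribution) U : Prop :=
  forall phi, test_function U phi -> T phi = 0.

(* Complement of the largest open set on which [T] vanishes. *)
Definition distribution_support (T : distribution) : set R :=
  ~` (\bigcup_(U in [set U | open U /\ vanishes_on T U]) U).

End ComplexFunctions.

Arguments distribution : clear implicits.

(* Main.v *)
(* After demodulation to the origin of the spectrum, let [w] be the real or the
   imaginary part of [f].  For [be >= 4 b] the dilated kernels [kern be 0] have
   Fourier transforms that coincide near [J], so the spectral hypothesis makes
   the convolution of [w] with [kern be 0] independent of [be]; letting [be]
   tend to infinity shows that [w] is reproduced, up to a constant, by
   [kern (4 b) 0].  Hence [w] agrees almost everywhere with a function whose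
   [n]-th derivative is at most [A (n + 1)^2 (4 b)^n] times a Poisson average
   of [|w|].

   By Chebyshev's inequality, [|w|] is bounded on half of [E] in [[x, x + a]]
   by its local mean on [E].  Interpolating at [m + 1] well separated nodes of
   that half, [m] comparable to [a b + 1], bounds [|w x|] by
   [(8 e / gamma)^(m + 1)] times this mean, plus a Poisson average of [|w|]
   with a constant that can be made small.  Raising to the power [p]
   (Jensen for the Poisson kernel) and integrating in [x] (Tonelli), the
   Poisson term is absorbed. *)
Require Import Defs.
From HB Require Import structures.
From mathcomp Require Import all_boot all_order all_algebra.
From mathcomp Require Import all_classical all_reals all_analysis.
From mathcomp Require Import measurable_realfun ess_sup_inf complex ring lra.
Set Implicit Arguments.
Unset Strict Implicit.
Unset Printing Implicit Defensive.
Import Order.TTheory GRing.Theory Num.Theory.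
Import numFieldNormedType.Exports.
Local Open Scope classical_set_scope.
Local Open Scope ring_scope.

(** * Smooth functions and cutoffs *)

(** Demodulation makes every constant depend on the length of [J] and not on its position, so the
    number of nodes only sees the product a b. The spectral hypothesis speaks about test functions
    supported away from [J]. A single kernel is not the transform of such a function, but the
    difference of two dilates is: [cutoff] equals 1 on [-1/2, 1/2], so the scale 4 b leaves a margin
    b between the spectrum and the support of that difference.

    Real functions are used throughout because the mean value form of divided differences rests on
    Rolle's theorem. It is applied to the kernel, and the factorial in the divided difference beats
    the growth of the kernel's derivatives once m exceeds a fixed multiple of a b + 1.

    The pointwise bound holds at almost every x, so the line is not split into good and bad
    intervals: the Poisson term carries the factor 1 / (32 pi), and after the power p it is at most
    1/8 of the left-hand side, which is finite. The 8 in 8 e / gamma is a product of three losses of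
    2: the Chebyshev half, the greedy choice of nodes and a sum of binomial coefficients. *)

Section Derivation.
Context {R : realType}.
Implicit Types (f g : R -> R) (x a b c : R).

Lemma is_derive_add f g x a b : is_derive x 1 f a -> is_derive x 1 g b ->
  is_derive x 1 (fun t => f t + g t) (a + b).
Proof. exact: is_deriveD. Qed.

Lemma is_derive_opp f x a : is_derive x 1 f a -> is_derive x 1 (fun t => - f t) (- a).
Proof. exact: is_deriveN. Qed.

Lemma is_derive_mul f g x a b : is_derive x 1 f a -> is_derive x 1 g b ->
  is_derive x 1 (fun t => f t * g t) (a * g x + f x * b).
Proof.
move=> fa gb; have /is_derive_eq := is_deriveM fa gb; apply.
by rewrite /GRing.scale/= addrC mulrC.
Qed.

Lemma is_derive_scale f x a c : is_derive x 1 f a ->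
  is_derive x 1 (fun t => c * f t) (c * a).
Proof.
move=> fa; have /is_derive_eq := is_derive_mul (is_derive_cst c x 1) fa; apply.
by rewrite mul0r add0r.
Qed.

Lemma is_derive_comp f g x a b : is_derive (g x) 1 f a -> is_derive x 1 g b ->
  is_derive x 1 (fun t => f (g t)) (a * b).
Proof. exact: is_derive1_comp. Qed.

Lemma is_derive_inv f x a : f x != 0 -> is_derive x 1 f a ->
  is_derive x 1 (fun t => (f t)^-1) (- a * ((f x)^-1 * (f x)^-1)).
Proof.
move=> fx0 fa; have /is_derive_eq := is_deriveV fx0 fa; apply.
by rewrite /GRing.scale/= -exprVn expr2; ring.
Qed.

Lemma is_derive_exp f n x a : is_derive x 1 f a ->
  is_derive x 1 (fun t => f t ^+ n) (n%:R * f x ^+ n.-1 * a).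
Proof.
move=> fa; elim: n => [|n IH]; first by rewrite !mul0r; exact: (is_derive_cst (1 : R) x 1).
have /is_derive_eq := is_derive_mul fa IH.
rewrite (_ : (fun t => f t * f t ^+ n) = (fun t => f t ^+ n.+1)); last first.
  by apply/funext => t; rewrite exprS.
apply; case: n {IH} => [|n]; first by rewrite /= !expr0; ring.
by rewrite -[n.+2%:R]natr1 /= !exprS; ring.
Qed.

Lemma is_derive_affine a b x : is_derive x 1 (fun t => a * t + b) a.
Proof.
have /is_derive_eq := is_derive_add (is_derive_scale a (is_derive_id x 1)) (is_derive_cst b x 1).
apply.
by rewrite mulr1 addr0.
Qed.

Lemma is_derive_derive1 f x : derivable f x 1 -> is_derive x 1 f ((derive1 f) x).
Proof. by move=> df; rewrite derive1E; exact: derivableP. Qed.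

Lemma is_derive_funE f g : (forall x, is_derive x 1 f (g x)) -> (derive1 f) = g.
Proof. by move=> fg; apply/funext => x; rewrite derive1E; apply: derive_val. Qed.

(** The difference quotient is squeezed by [C * |h|]. This serves at the gluing point 0 of [expinv],
    where no single formula can be differentiated. *)
Lemma is_derive_quadratic f x C : (forall t, `|f t - f x| <= C * (t - x) ^+ 2) ->
  is_derive x 1 f 0.
Proof.
move=> fC.
have C0 : C * `|h| @[h --> (0 : R)^'] --> (0 : R).
  have : C * `|h| @[h --> (0 : R)] --> C * `|0 : R|.
    by apply: cvgM; [exact: cvg_cst|exact: (@norm_continuous _ R^o)].
  by rewrite normr0 mulr0 => H; exact: cvg_trans (cvg_fmap2 (@nbhs_dnbhs _ _)) H.
have H : h^-1 *: (f (h *: (1 : R) + x) - f x) @[h --> 0^'] --> (0 : R).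
  apply: (@squeeze_cvgr _ _ _ _ (fun h : R => - (C * `|h|)) (fun h => C * `|h|)).
  - near=> h.
    have h0 : h != 0 by near: h; exact: nbhs_dnbhs_neq.
    rewrite -ler_norml normrM normfV ler_pdivrMl ?normr_gt0//.
    apply: le_trans (fC _) _.
    rewrite /GRing.scale/= mulr1 addrK -(real_normK (num_real h)).
    by rewrite expr2 mulrCA.
  - by rewrite -[X in _ `=>` nbhs X](oppr0 R); exact: (cvgN C0).
  - exact: C0.
split; first by apply/cvg_ex; exists 0.
exact/cvg_lim.
Unshelve. all: by end_near. Qed.

End Derivation.

Section Smooth.
Context {R : realType}.
Implicit Types (f g : R -> R) (x : R).

(** A finite order is tracked so that closure under products and inverses goes by induction: the
    derivative of an inverse contains the inverse again, with one order less to prove. *)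
Definition diff_upto (n : nat) f :=
  forall k, (k <= n)%N -> forall x, derivable (derive1n k f) x 1.

Definition smoothR f := forall n x, derivable (derive1n n f) x 1.

Lemma smoothRP f : smoothR f <-> forall n, diff_upto n f.
Proof. by split=> [sf n k _ x|sf n x]; [exact: sf|apply: (sf n)]. Qed.

Lemma derive1nSr n f : derive1n n.+1 f = derive1n n (derive1 f).
Proof. exact: iterSr. Qed.

Lemma diff_upto0 f : (forall x, derivable f x 1) -> diff_upto 0 f.
Proof. by move=> df k; rewrite leqn0 => /eqP ->. Qed.

Lemma diff_uptoS n f :
  diff_upto n.+1 f <-> (forall x, derivable f x 1) /\ diff_upto n (derive1 f).
Proof.
split=> [df|[df df'] [|k] kn]; last 2 first.
- exact: df.
- by rewrite derive1nSr; exact: df'.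
by split=> [|k kn]; [exact: (df 0%N)|rewrite -derive1nSr; exact: df].
Qed.

Lemma diff_upto_le m n f : (m <= n)%N -> diff_upto n f -> diff_upto m f.
Proof. by move=> mn df k km; apply: df; apply: leq_trans mn. Qed.

Lemma diff_upto_derivable n f : diff_upto n f -> forall x, derivable f x 1.
Proof. by move=> /(_ 0%N); apply. Qed.

Lemma diff_upto_is_derive n f : diff_upto n f -> forall x, is_derive x 1 f ((derive1 f) x).
Proof. by move=> df x; apply: is_derive_derive1; exact: diff_upto_derivable df x. Qed.

Lemma diff_upto_ind n f g : (forall x, is_derive x 1 f (g x)) -> diff_upto n g ->
  diff_upto n.+1 f.
Proof.
move=> fg dg; apply/diff_uptoS; split=> [x|]; last by rewrite (is_derive_funE fg).
by have [] := fg x.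
Qed.

Lemma diff_uptoD n f g : diff_upto n f -> diff_upto n g ->
  diff_upto n (fun x => f x + g x).
Proof.
elim: n f g => [|n IH] f g df dg.
  by apply: diff_upto0 => x; apply: derivableD; [exact: diff_upto_derivable df x|exact: diff_upto_derivable dg x].
apply: diff_upto_ind (IH _ _ ((diff_uptoS _ _).1 df).2 ((diff_uptoS _ _).1 dg).2) => x.
by apply: is_derive_add; [exact: diff_upto_is_derive df x|exact: diff_upto_is_derive dg x].
Qed.

Lemma diff_uptoM n f g : diff_upto n f -> diff_upto n g ->
  diff_upto n (fun x => f x * g x).
Proof.
elim: n f g => [|n IH] f g df dg.
  by apply: diff_upto0 => x; apply: derivableM; [exact: diff_upto_derivable df x|exact: diff_upto_derivable dg x].
apply: (@diff_upto_ind n (fun x => f x * g x) (fun x => derive1 f x * g x + f x * derive1 g x)) => [x|].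
  by apply: is_derive_mul; [exact: diff_upto_is_derive df x|exact: diff_upto_is_derive dg x].
apply: diff_uptoD; apply: IH.
- exact: ((diff_uptoS _ _).1 df).2.
- exact: diff_upto_le dg.
- exact: diff_upto_le df.
- exact: ((diff_uptoS _ _).1 dg).2.
Qed.

Lemma diff_upto_cst n (c : R) : diff_upto n (fun=> c).
Proof.
elim: n c => [|n IH] c; first by apply: diff_upto0 => x; exact: derivable_cst.
by apply: diff_upto_ind (IH 0) => x; exact: is_derive_cst.
Qed.

Lemma diff_uptoZ n (c : R) f : diff_upto n f -> diff_upto n (fun x => c * f x).
Proof. by move=> df; exact: (@diff_uptoM n (fun=> c) f (@diff_upto_cst n c) df). Qed.

Lemma diff_uptoV n f : (forall x, f x != 0) -> diff_upto n f ->
  diff_upto n (fun x => (f x)^-1).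
Proof.
move=> f0; elim: n => [|n IH] df.
  apply: diff_upto0 => x.
  by have [] := is_derive_inv (f0 x) (diff_upto_is_derive df x).
apply: (@diff_upto_ind n (fun x => (f x)^-1) (fun x => - derive1 f x * ((f x)^-1 * (f x)^-1))) => [x|].
  exact: is_derive_inv (f0 x) (diff_upto_is_derive df x).
have fV := IH (diff_upto_le (leqnSn n) df).
apply: diff_uptoM; last exact: diff_uptoM.
rewrite (_ : (fun x => - (derive1 f) x) = (fun x => -1 * (derive1 f) x)); last first.
  by apply/funext => x; rewrite mulN1r.
by apply: diff_uptoZ; exact: ((diff_uptoS _ _).1 df).2.
Qed.

Lemma diff_upto_affine n (a b : R) f : diff_upto n f ->
  diff_upto n (fun x => f (a * x + b)).
Proof.
elim: n f => [|n IH] f df.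
  apply: diff_upto0 => x.
  by have [] := is_derive_comp (diff_upto_is_derive df _) (is_derive_affine a b x).
apply: (@diff_upto_ind n (fun x => f (a * x + b)) (fun x => a * derive1 f (a * x + b))) => [x|].
  rewrite mulrC.
  by apply: is_derive_comp (is_derive_affine a b x); exact: diff_upto_is_derive df _.
by apply: diff_uptoZ; apply: IH; exact: ((diff_uptoS _ _).1 df).2.
Qed.

Lemma smoothR_cst (c : R) : smoothR (fun=> c).
Proof. by apply/smoothRP => n; exact: diff_upto_cst. Qed.

Lemma smoothRD f g : smoothR f -> smoothR g -> smoothR (fun x => f x + g x).
Proof. by move=> /smoothRP df /smoothRP dg; apply/smoothRP => n; exact: diff_uptoD. Qed.

Lemma smoothRM f g : smoothR f -> smoothR g -> smoothR (fun x => f x * g x).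
Proof. by move=> /smoothRP df /smoothRP dg; apply/smoothRP => n; exact: diff_uptoM. Qed.

Lemma smoothRV f : (forall x, f x != 0) -> smoothR f -> smoothR (fun x => (f x)^-1).
Proof. by move=> f0 /smoothRP df; apply/smoothRP => n; exact: diff_uptoV. Qed.

Lemma smoothR_affine (a b : R) f : smoothR f -> smoothR (fun x => f (a * x + b)).
Proof. by move=> /smoothRP df; apply/smoothRP => n; exact: diff_upto_affine. Qed.

Lemma smoothR_derive f : smoothR f -> smoothR (derive1 f).
Proof. by move=> sf n x; rewrite -derive1nSr; exact: sf. Qed.

Lemma smoothR_is_derive f x : smoothR f -> is_derive x 1 f ((derive1 f) x).
Proof. by move=> /(_ 0%N x) df; exact: is_derive_derive1. Qed.

Lemma smoothR_continuous f : smoothR f -> continuous f.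
Proof. by move=> sf x; apply/differentiable_continuous/derivable1_diffP; exact: (sf 0%N). Qed.

Lemma diff_upto_sin_cos n : diff_upto n (@sin R) /\ diff_upto n (@cos R).
Proof.
elim: n => [|n [IHs IHc]].
  by split; apply: diff_upto0 => x; [exact: derivable_sin|exact: derivable_cos].
split; first exact: (diff_upto_ind (@is_derive_sin R) IHc).
apply: (diff_upto_ind (@is_derive_cos R)).
rewrite (_ : (fun x => - sin x) = (fun x => -1 * sin x)); last first.
  by apply/funext => x; rewrite mulN1r.
exact: diff_uptoZ.
Qed.

Lemma smoothR_sin : smoothR (@sin R).
Proof. by apply/smoothRP => n; have [] := diff_upto_sin_cos n. Qed.

Lemma smoothR_cos : smoothR (@cos R).
Proof. by apply/smoothRP => n; have [] := diff_upto_sin_cos n. Qed.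

End Smooth.

(** * A smooth step and a smooth cutoff built from exp (- 1 / x) *)

Section SmoothStep.
Context {R : realType}.
Implicit Types (x t : R) (k n : nat).

(** The power [k] makes the family stable under differentiation up to linear combinations, so that
    one induction over all [k] gives smoothness. *)
Definition expinv k x : R := if 0 < x then x^-1 ^+ k * expR (- x^-1) else 0.

Lemma expinv_ge0 k x : 0 <= expinv k x.
Proof.
rewrite /expinv; case: ltP => // x0.
by rewrite mulr_ge0 ?expR_ge0// exprn_ge0// invr_ge0 ltW.
Qed.

Lemma expinv0_gt0 x : 0 < x -> 0 < expinv 0 x.
Proof. by move=> x0; rewrite /expinv x0 expr0 mul1r expR_gt0. Qed.

Lemma expinv_le0 k x : x <= 0 -> expinv k x = 0.
Proof. by rewrite /expinv ltNge => ->. Qed.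

(** The term of degree k + 2 of the exponential series at 1 / x cancels the pole of order k and
    leaves a factor x^2, enough for a zero derivative at the origin. *)
Lemma expinv_quadratic k x : expinv k x <= (k.+2)`!%:R * x ^+ 2.
Proof.
rewrite /expinv; case: ltP => [x0|_]; last by rewrite mulr_ge0// sqr_ge0.
have y0 : 0 < x^-1 by rewrite invr_gt0.
have := expR_ge1Dxn k.+1 (ltW y0).
rewrite expRN ler_pdivrMr ?expR_gt0// => H.
have fact0 : 0 < (k.+2)`!%:R :> R by rewrite ltr0n fact_gt0.
move: fact0 H; set F : R := (k.+2)`!%:R => fact0 H.
have -> : x^-1 ^+ k = (x^-1 ^+ k.+2 / F) * (F * x ^+ 2).
  rewrite !exprS expr0 mulr1; field.
  by rewrite !gt_eqF.
rewrite mulrC; apply: ler_wpM2l; first by rewrite mulr_ge0 ?sqr_ge0// ltW.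
by apply: le_trans H; rewrite lerDr.
Qed.

Lemma is_derive_expinv k x :
  is_derive x 1 (expinv k) (expinv k.+2 x + (- k%:R) * expinv k.+1 x).
Proof.
have [x0|x0|->] := ltgtP x 0.
- rewrite !expinv_le0 ?(ltW x0)// mulr0 addr0.
  apply: (@near_eq_is_derive _ _ _ (fun=> 0 : R)).
  near=> t; rewrite expinv_le0//; apply/ltW.
  by near: t; exact: lt_nbhsl.
- apply: (@near_eq_is_derive _ _ _ (fun t => t^-1 ^+ k * expR (- t^-1))).
    near=> t; rewrite /expinv ifT//.
    by near: t; exact: lt_nbhsr.
  have dV : is_derive x 1 (fun t : R => t^-1) (- 1 * (x^-1 * x^-1)).
    by apply: is_derive_inv (is_derive_id x 1); rewrite gt_eqF.
  have dX : is_derive x 1 (fun t : R => t^-1 ^+ k) (- (k%:R * x^-1 ^+ k.+1)).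
    have /is_derive_eq := is_derive_exp k dV; apply.
    case: k => [|k]; first by rewrite !mul0r oppr0.
    by rewrite /= !exprS; ring.
  have /is_derive_eq := is_derive_mul dX (is_derive_comp (is_derive_expR _) (is_derive_opp dV)).
  by apply; rewrite /expinv x0 !exprS; ring.
- rewrite !(expinv_le0 _ (lexx 0)) mulr0 addr0.
  apply: (@is_derive_quadratic _ _ _ (k.+2)`!%:R) => t.
  by rewrite (expinv_le0 _ (lexx 0)) !subr0 ger0_norm ?expinv_ge0// expinv_quadratic.
Unshelve. all: by end_near. Qed.

Lemma smoothR_expinv : smoothR (expinv 0).
Proof.
apply/smoothRP => n; elim: n 0%N => [|n IH] k.
  by apply: diff_upto0 => x; have [] := is_derive_expinv k x.
apply: diff_upto_ind (is_derive_expinv k) _.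
exact: diff_uptoD (IH _) (@diff_uptoZ R n _ _ (IH _)).
Qed.

Definition smooth_step x : R := expinv 0 x * (expinv 0 x + expinv 0 (1 - x))^-1.

Let den_gt0 x : 0 < expinv 0 x + expinv 0 (1 - x).
Proof.
have [x0|x0] := leP x 0.
  by rewrite expinv_le0// add0r expinv0_gt0// subr_gt0 (le_lt_trans x0).
by rewrite ltr_wpDr ?expinv_ge0// expinv0_gt0.
Qed.

Lemma smooth_step_smooth : smoothR smooth_step.
Proof.
have e1 : smoothR (fun x : R => expinv 0 (1 - x)).
  have := @smoothR_affine R (-1) 1 _ smoothR_expinv.
  by congr smoothR; apply/funext => x; rewrite mulN1r addrC.
apply: smoothRM smoothR_expinv _; apply: smoothRV; last exact: smoothRD smoothR_expinv e1.
by move=> x; rewrite gt_eqF.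
Qed.

Lemma smooth_step_ge0 x : 0 <= smooth_step x.
Proof. by rewrite mulr_ge0 ?expinv_ge0// invr_ge0 ltW. Qed.

Lemma smooth_step_le0 x : x <= 0 -> smooth_step x = 0.
Proof. by move=> x0; rewrite /smooth_step expinv_le0// mul0r. Qed.

Lemma smooth_step_ge1 x : 1 <= x -> smooth_step x = 1.
Proof.
move=> x1; rewrite /smooth_step (@expinv_le0 _ (1 - x)) ?subr_le0// addr0 mulfV//.
by rewrite gt_eqF// expinv0_gt0// (lt_le_trans ltr01).
Qed.

Definition cutoff x : R := smooth_step (2 + 2 * x) * smooth_step (2 - 2 * x).

Lemma cutoff_smooth : smoothR cutoff.
Proof.
apply: smoothRM.
  have := @smoothR_affine R 2 2 _ smooth_step_smooth.
  by congr smoothR; apply/funext => x; rewrite addrC.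
have := @smoothR_affine R (- 2) 2 _ smooth_step_smooth.
by congr smoothR; apply/funext => x; rewrite mulNr addrC.
Qed.

Lemma cutoff_ge0 x : 0 <= cutoff x.
Proof. by rewrite mulr_ge0 ?smooth_step_ge0. Qed.

Lemma cutoffN x : cutoff (- x) = cutoff x.
Proof. by rewrite /cutoff mulrN opprK mulrC. Qed.

Lemma cutoff1 x : `|x| <= 2^-1 -> cutoff x = 1.
Proof.
rewrite ler_norml => /andP[x1 x2].
by rewrite /cutoff !smooth_step_ge1 ?mulr1//; lra.
Qed.

Lemma cutoff0 x : 1 <= `|x| -> cutoff x = 0.
Proof.
rewrite ler_normr => /orP[x1|x1].
  by rewrite /cutoff (@smooth_step_le0 (2 - 2 * x)) ?mulr0//; lra.
by rewrite /cutoff smooth_step_le0 ?mul0r//; lra.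
Qed.

End SmoothStep.

(** * Interpolation on separated nodes *)

Section DividedDifference.
Context {R : realType}.
Implicit Types (s : seq R) (x y z lo hi : R) (n k : nat).

(** [g] lists the successive derivatives of one function. Rolle between neighbouring zeros yields
    one zero fewer for the next derivative, again in increasing order. *)
Lemma iterated_rolle (g : nat -> R -> R) n k (y : nat -> R) :
  (forall k x, is_derive x 1 (g k) (g k.+1 x)) ->
  (forall i, (i < n)%N -> y i < y i.+1) ->
  (forall i, (i <= n)%N -> g k (y i) = 0) ->
  exists2 z, y 0%N <= z <= y n & g (k + n)%N z = 0.
Proof.
move=> dg; elim: n k y => [|n IH] k y ylt g0.
  by exists (y 0%N); rewrite ?lexx// addn0 g0.
(* The bound on [i] sits under the existential, so that [choice] returns a total sequence. *)
have H i : exists z, (i < n.+1)%N -> y i < z < y i.+1 /\ g k.+1 z = 0.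
  have [iN|_] := ltnP i n.+1; last by exists 0.
  have [||||c cin dc] := @Rolle R (g k) (y i) (y i.+1).
  - exact: ylt.
  - by move=> x _; have [] := dg k x.
  - apply: continuous_subspaceT => x.
    by apply/differentiable_continuous/derivable1_diffP; have [] := dg k x.
  - by rewrite !g0// ltnW.
  exists c => _; split; first by move: cin; rewrite in_itv.
  by have := @derive_val _ _ _ _ _ _ _ dc; rewrite (@derive_val _ _ _ _ _ _ _ (dg k c)).
have [z zP] := choice H.
have [i iN|i iN|c /andP[c0 cn] gc] := IH k.+1 z.
- have [/andP[_ h1] _] := zP i (ltnW iN).
  by have [/andP[h2 _] _] := zP i.+1 iN; exact: lt_trans h1 h2.
- by have [] := zP i iN.
exists c; last by rewrite addnS -addSn.
have [/andP[h1 _] _] := zP 0%N (ltn0Sn n).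
have [/andP[_ h2] _] := zP n (ltnSn n).
by rewrite (le_trans (ltW h1) c0) (le_trans cn (ltW h2)).
Qed.

Definition node_prod s y : R := \prod_(z <- s | z != y) (y - z).

(** For distinct nodes this is the top coefficient of the Lagrange interpolation polynomial, see
    [coef_lagrange]. *)
Definition divided_difference s (g : R -> R) : R :=
  \sum_(y <- s) g y / node_prod s y.

Lemma node_prod_neq0 s y : node_prod s y != 0.
Proof.
rewrite /node_prod; elim: s => [|z s IH]; first by rewrite big_nil oner_neq0.
by rewrite big_cons; case: (eqVneq z y) => [|zy] //=; rewrite mulf_neq0// subr_eq0 eq_sym.
Qed.

Let node_poly s y : {poly R} := \prod_(z <- s | z != y) ('X - z%:P).

Let lagrange s (g : R -> R) : {poly R} :=
  \sum_(y <- s) (g y / node_prod s y) *: node_poly s y.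

Let node_poly_root s y x : x \in s -> x != y -> (node_poly s y).[x] = 0.
Proof.
move=> xs xy; rewrite /node_poly horner_prod.
apply/eqP; rewrite prodf_seq_eq0; apply/hasP; exists x => //=.
by rewrite xy hornerXsubC subrr eqxx.
Qed.

Let node_poly_self s y : (node_poly s y).[y] = node_prod s y.
Proof. by rewrite /node_poly horner_prod; apply: eq_bigr => z _; rewrite hornerXsubC. Qed.

Let lagrangeE s g x : uniq s -> x \in s -> (lagrange s g).[x] = g x.
Proof.
move=> us xs; rewrite /lagrange horner_sum (bigD1_seq x)//= hornerZ node_poly_self.
rewrite mulfVK ?node_prod_neq0// big1 ?addr0// => y yx.
by rewrite hornerZ node_poly_root ?mulr0// eq_sym.
Qed.

Let size_node_poly s y n : uniq s -> size s = n.+1 -> y \in s ->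
  size (node_poly s y) = n.+1 /\ node_poly s y \is monic.
Proof.
move=> us ss ys; rewrite /node_poly -big_filter; split; last exact: monic_prod_XsubC.
rewrite size_prod_XsubC size_filter; congr S.
have := count_predC (pred1 y) s; rewrite ss count_uniq_mem// ys add1n => -[<-].
by apply: eq_count.
Qed.

Let coef_lagrange s g n : uniq s -> size s = n.+1 ->
  (lagrange s g)`_n = divided_difference s g /\ (size (lagrange s g) <= n.+1)%N.
Proof.
move=> us ss; split.
  rewrite /lagrange coef_sum; apply: eq_big_seq => y ys.
  have [sz /monicP] := size_node_poly us ss ys.
  by rewrite /lead_coef sz /= coefZ => ->; rewrite mulr1.
apply: leq_trans (size_sum _ _ _) _; apply/bigmax_leqP_seq => y ys _.
by apply: leq_trans (size_scale_leq _ _) _; have [-> _] := size_node_poly us ss ys.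
Qed.

(** [g 0] minus its Lagrange polynomial vanishes at n + 1 nodes, so its n-th derivative has a zero.
    There [g n] equals the n-th derivative of the polynomial, which is the constant n! times the
    divided difference. *)
Lemma divided_difference_mean (g : nat -> R -> R) n s lo hi :
  (forall k x, is_derive x 1 (g k) (g k.+1 x)) ->
  uniq s -> size s = n.+1 -> {in s, forall y, lo <= y <= hi} ->
  exists2 z, lo <= z <= hi & divided_difference s (g 0%N) = g n z / n`!%:R.
Proof.
move=> dg us ss sb.
(* Rolle's theorem is fed with increasing nodes, while the divided difference ignores their
   order. *)
pose t := sort <=%O s; pose P := lagrange s (g 0%N).
have pst : perm_eq t s by rewrite /t perm_sort.
have tlt : sorted <%O t by rewrite lt_sorted_uniq_le sort_uniq us sort_le_sorted.
have st : size t = n.+1 by rewrite size_sort.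
have mt i : (i <= n)%N -> nth 0 t i \in s.
  by move=> ni; rewrite -(perm_mem pst) mem_nth// st.
have dw k x : is_derive x 1 (fun x => g k x - (P^`(k)).[x]) (g k.+1 x - (P^`(k.+1)).[x]).
  rewrite derivnS; exact: is_derive_add (dg k x) (is_derive_opp (is_derive_poly _ x)).
have [||z /andP[z0 zn] wz] := @iterated_rolle
    (fun k x => g k x - (P^`(k)).[x]) n 0%N (nth 0 t) dw.
- by move=> i ni; apply: (sorted_ltn_nth lt_trans) => //; rewrite inE st// ltnW.
- by move=> i ni; rewrite derivn0 lagrangeE ?subrr// mt.
exists z.
  have /andP[h1 _] := sb _ (mt 0%N isT); have /andP[_ h2] := sb _ (mt n (leqnn n)).
  by rewrite (le_trans h1 z0) (le_trans zn h2).
have [cP sP] := coef_lagrange (g 0%N) us ss.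
move/eqP: wz; rewrite subr_eq0 add0n => /eqP ->.
have /size1_polyC -> : (size P^`(n) <= 1)%N.
  by apply/leq_sizeP => j j0; rewrite coef_derivn nth_default ?mul0rn// (leq_trans sP)//
    -[n.+1]addn1 leq_add2l.
rewrite hornerC coef_derivn addn0 cP ffactnn -[X in X / _]mulr_natr mulfK//.
Qed.

End DividedDifference.

(** * Separated nodes in a set of positive measure, and the resulting pointwise bound *)

Section Interpolation.
Context {R : realType}.
Notation mu := (@lebesgue_measure R).

(** Greedy choice from the left: a point x within [d] of the infimum is kept and everything below x
    + d is dropped. This removes at most 2 d of measure, hence the factor 2. *)
Lemma separated_points (A : set R) n (d lo : R) : measurable A -> 0 < d ->
  (forall x, A x -> lo <= x) -> ((2 * d * n%:R)%:E <= mu A)%E ->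
  exists y : nat -> R, (forall i, (i < n)%N -> A (y i)) /\
    (forall i j, (i <= j)%N -> (j < n)%N -> (j - i)%:R * d <= y j - y i).
Proof.
elim: n A => [|n IH] A mA d0 lA muA; first by exists (fun=> 0).
have A0 : A !=set0.
  apply/set0P/eqP => A0; move: muA; rewrite A0 measure0 lee_fin leNgt.
  by rewrite !mulr_gt0.
have hA : has_inf A by split => //; exists lo => x /lA.
have [x Ax xd] := inf_adherent d0 hA.
pose B := A `&` `[x + d, +oo[.
have mB : measurable B by apply: measurableI.
have [||y [By gap]] := IH B mB d0.
- by move=> z [/lA].
- have AB : A `<=` `[inf A, inf A + 2 * d] `|` B.
    move=> z Az; have [zx|zx] := leP (x + d) z.
      by right; split => //=; rewrite in_itv/= zx.
    left => /=; rewrite in_itv/= (ge_inf hA.2 Az)/= ltW//.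
    by apply: lt_trans zx _; rewrite mulr2n mulrDl mul1r addrA ltrD2r.
  have : (mu A <= (2 * d)%:E + mu B)%E.
    have mI : measurable `[inf A, inf A + 2 * d] by [].
    apply: le_trans (le_measure mu (mem_set mA) (mem_set (measurableU _ _ mI mB)) AB) _.
    apply: le_trans (measureU2 mu mI mB) _ => //.
    rewrite leeD2r//; suff : (mu `[inf A, (inf A + 2 * d)%R] <= (2 * d)%:E)%E by [].
    rewrite lebesgue_measure_itv/= lte_fin ltrDl mulr_gt0//=.
    by rewrite -EFinB lee_fin addrAC subrr add0r.
  move=> /(le_trans muA); rewrite -[n.+1%:R]natr1 mulrDr mulr1 EFinD addeC.
  by rewrite leeD2lE.
exists (fun i => if i is i.+1 then y i else x); split.
  by case=> [_ //|i iN]; have [] := By i iN.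
move=> [|i] [|j] // ij jn; first by rewrite subn0 mul0r subrr.
  rewrite subn0 -[j.+1%:R]natr1 mulrDl mul1r; have [_] := By j jn; rewrite /= in_itv/= andbT => xy.
  have [_] := By 0%N (leq_ltn_trans (leq0n j) (jn : (j < n)%N)); rewrite /= in_itv/= andbT => xy0.
  have := gap 0%N j (leq0n _) jn; rewrite subn0 => h.
  by move: xy0 h => /=; lra.
by rewrite subSS; exact: gap.
Qed.

Let prod_dist m j : (j <= m)%N ->
  (\prod_(k < m.+1 | k != j :> nat) `|j%:R - k%:R| = (j`! * (m - j)`!)%:R :> R).
Proof.
move=> jm.
rewrite -(big_mkord (fun k => k != j) (fun k => `|j%:R - k%:R|)).
rewrite (big_cat_nat (n := j))//=; last exact: leqW.
rewrite [X in _ * X]big_ltn_cond// eqxx/= natrM; congr *%R.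
  rewrite big_nat_cond (eq_bigl (fun k => (0 <= k < j)%N && true)); last first.
    by move=> k /=; case: ltngtP; rewrite ?andbF ?andbT.
  rewrite -big_nat_cond.
  rewrite big_nat_rev /= fact_prod natr_prod big_add1 /= !big_mkord.
  apply: eq_bigr => k _; rewrite add0n.
  rewrite -natrB ?leq_subr// subKn// normr_nat//.
rewrite big_nat_cond (eq_bigl (fun k => (j.+1 <= k < m.+1)%N && true)); last first.
  by move=> k /=; case: ltngtP; rewrite ?andbF ?andbT.
rewrite -big_nat_cond -{1}(add0n j.+1) big_addn subSS fact_prod natr_prod.
rewrite [RHS]big_add1 /= !big_mkord; apply: eq_bigr => k _.
rewrite distrC -natrB; last by rewrite addnS leqW ?leq_addl.
by rewrite addnS -addSn addnK normr_nat.
Qed.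

(** The divided difference is solved for [G x]. The j-th node is at distance at least |j - k| d from
    the k-th, so its coefficient is at most (a / d)^m / (j! (m - j)!). Summed over j these are
    binomial coefficients over m!, which gives 2^m / m!. *)
Lemma interpolation_bound (G : R -> R) m x (y : nat -> R) (a d lam : R) :
  0 < d -> 0 <= a ->
  (forall i, (i <= m)%N -> [/\ `|x - y i| <= a, y i != x & `|G (y i)| <= lam]) ->
  (forall i j, (i <= j)%N -> (j <= m)%N -> (j - i)%:R * d <= y j - y i) ->
  `|G x| <= lam * ((2 * a / d) ^+ m / m`!%:R)
            + a ^+ m.+1 * `|divided_difference (x :: map y (iota 0 m.+1)) G|.
Proof.
move=> d0 a0 yP gap.
have yne i j : (i < j)%N -> (j <= m)%N -> y i < y j.
  move=> ij jm; rewrite -subr_gt0; apply: lt_le_trans (gap i j (ltnW ij) jm).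
  by rewrite mulr_gt0// ltr0n subn_gt0.
have yinj i j : (i <= m)%N -> (j <= m)%N -> (y i == y j) = (i == j).
  move=> im jm; case: (ltngtP i j) => [ij|ij|->]; last by rewrite eqxx.
  - by rewrite lt_eqF// yne.
  - by rewrite gt_eqF// yne.
set s := map y _.
have node0 : node_prod (x :: s) x = \prod_(k < m.+1) (x - y k).
  rewrite /node_prod big_cons eqxx /= /s big_map -[iota _ _]/(index_iota 0 m.+1).
  rewrite big_mkord; apply: eq_bigl => k.
  by have [] := yP k (ltn_ord k).
have nodej (j : 'I_m.+1) : node_prod (x :: s) (y j) =
    (y j - x) * \prod_(k < m.+1 | k != j) (y j - y k).
  rewrite /node_prod big_cons eq_sym; have [_ -> _] := yP j (ltn_ord j).
  congr *%R; rewrite /s big_map -[iota _ _]/(index_iota 0 m.+1) big_mkord.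
  by apply: eq_bigl => k; rewrite (yinj k j (ltn_ord k) (ltn_ord j)).
set Q := \prod_(k < m.+1) (x - y k).
have Q0 : Q != 0 by have := node_prod_neq0 (x :: s) x; rewrite node0.
have DE : divided_difference (x :: s) G = G x / Q +
    \sum_(j < m.+1) G (y j) / ((y j - x) * \prod_(k < m.+1 | k != j) (y j - y k)).
  rewrite /divided_difference big_cons node0; congr +%R.
  rewrite {1}/s big_map -[iota _ _]/(index_iota 0 m.+1) big_mkord.
  by apply: eq_bigr => j _; rewrite nodej.
have GE : G x = Q * divided_difference (x :: s) G -
    \sum_(j < m.+1) Q * (G (y j) / ((y j - x) * \prod_(k < m.+1 | k != j) (y j - y k))).
  by rewrite DE -mulr_sumr mulrDr addrK mulrC divfK.
have prod_a (P : pred 'I_m.+1) : \prod_(k < m.+1 | P k) `|x - y k| <= a ^+ #|P|.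
  rewrite -prodr_const; apply: ler_prod => k _; rewrite normr_ge0/=.
  by have [] := yP k (ltn_ord k).
rewrite GE addrC; apply: le_trans (ler_normD _ _) _; rewrite normrN; apply: lerD; last first.
  rewrite normrM ler_wpM2r// /Q normr_prod; apply: le_trans (prod_a predT) _.
  by rewrite card_ord.
apply: le_trans (ler_norm_sum _ _ _) _.
have lam0 : 0 <= lam by apply: le_trans (normr_ge0 (G (y 0%N))) _; have [] := yP 0%N isT.
have -> : lam * ((2 * a / d) ^+ m / m`!%:R) =
    \sum_(j < m.+1) lam * ((a / d) ^+ m * 'C(m, j)%:R / m`!%:R).
  rewrite -mulr_sumr; congr *%R; rewrite -mulr_suml; congr *%R.
  rewrite -mulr_sumr -mulrA exprMn mulrC; congr *%R.
  rewrite -[2]/(1 + 1) exprDn; apply: eq_bigr => i _.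
  by rewrite !expr1n mulr1.
apply: ler_sum => j _.
have jm : (j <= m)%N by rewrite -ltnS.
have [yjx yjn yjl] := yP j jm.
(* The factor [x - y j] of [Q] cancels up to sign, leaving m factors above and m below. *)
have -> : Q * (G (y j) / ((y j - x) * \prod_(k < m.+1 | k != j) (y j - y k))) =
    G (y j) * - (\prod_(k < m.+1 | k != j) (x - y k) / \prod_(k < m.+1 | k != j) (y j - y k)).
  rewrite /Q (bigD1 j)//= -(opprB x (y j)); field.
  rewrite [x - _ == _]subr_eq0 [x == _]eq_sym yjn andbT.
  by apply/prodf_neq0 => k kj; rewrite subr_eq0 (yinj j k jm (ltn_ord k)) eq_sym.
rewrite normrM normrN; apply: ler_pM => //.
rewrite normrM normfV !normr_prod.
have cardj : #|[pred k : 'I_m.+1 | k != j]| = m.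
  by rewrite (cardC1 j) card_ord.
have step1 : d ^+ m * (j`! * (m - j)`!)%:R <= \prod_(k < m.+1 | k != j) `|y j - y k|.
  rewrite -(prod_dist jm).
  have -> : d ^+ m = \prod_(k < m.+1 | k != j) d.
    by rewrite prodr_const; congr (_ ^+ _); exact/esym/cardj.
  rewrite -big_split /=; apply: ler_prod => k kj.
  apply/andP; split; first by rewrite mulr_ge0// ltW.
  have [jk|kj'] := leqP j k.
    rewrite (distrC j%:R) (distrC (y j)) -natrB// normr_nat mulrC.
    exact: le_trans (gap j k jk (ltn_ord k)) (ler_norm _).
  rewrite -natrB ?(ltnW kj')// normr_nat mulrC.
  by apply: le_trans (gap k j (ltnW kj') jm) (ler_norm _).
have fact_gt : 0 < d ^+ m * (j`! * (m - j)`!)%:R :> R.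
  by rewrite mulr_gt0 ?exprn_gt0// ltr0n muln_gt0 !fact_gt0.
have := prod_a [pred k : 'I_m.+1 | k != j]; rewrite cardj /= => step2.
have P0 : 0 < \prod_(k < m.+1 | k != j) `|y j - y k| by exact: lt_le_trans step1.
apply: (@le_trans _ _ (a ^+ m / (d ^+ m * (j`! * (m - j)`!)%:R))).
  apply: ler_pM => //; first exact: prodr_ge0.
    by rewrite invr_ge0 ltW.
  by rewrite lef_pV2.
rewrite -(bin_fact jm) expr_div_n !natrM le_eqVlt; apply/orP; left; apply/eqP.
field.
by rewrite !gt_eqF ?exprn_gt0// ?ltr0n ?fact_gt0 ?bin_gt0.
Qed.

End Interpolation.

(** * Lebesgue measure and its completion *)

Section AffineSubstitution.
Context {R : realType}.
Notation mu := (@lebesgue_measure R).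
Implicit Types (r s : R).

Lemma measurable_affine r s : measurable_fun [set: R] (fun x : R => r * x + s).
Proof. by apply: measurable_funD => //; exact: measurable_funM. Qed.

(** The scaled pushforward agrees with Lebesgue measure on half-open intervals, which determine the
    measure. *)
Lemma lebesgue_measure_affine r s (A : set R) : 0 < r -> measurable A ->
  (r%:E * mu ((fun x => r * x + s)%R @^-1` A) = mu A)%E.
Proof.
move=> r0 mA.
have mphi : @measurable_fun _ _ (measurableTypeR R) (measurableTypeR R) setT
    (fun x => r * x + s) by exact: measurable_affine.
pose nu := mscale (NngNum (ltW r0))
  (measure_function_pushforward__canonical__measure_function_Measure mu mphi).
suff -> : mu A = nu A by [].
apply: lebesgue_measure_unique => //= _ [[a b]] _ <-.
rewrite /nu /mscale /= /pushforward /=.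
have -> : (fun x => r * x + s) @^-1` `]a, b] = `](a - s) / r, (b - s) / r]%classic.
  apply/seteqP; split=> x /=; rewrite !in_itv/= ltr_pdivrMr// ler_pdivlMr//;
  by rewrite ltrBlDr lerBrDr (mulrC x).
rewrite !lebesgue_measure_itv/= !lte_fin ltr_pM2r ?invr_gt0// ltrD2r.
case: ltP => _; last by rewrite mule0.
by rewrite -!EFinB -EFinM; congr EFin; field; rewrite gt_eqF.
Qed.

Lemma ge0_integral_affine r s (f : R -> \bar R) : 0 < r ->
  measurable_fun [set: R] f -> (forall x, 0 <= f x)%E ->
  (\int[mu]_x f x = r%:E * \int[mu]_x f (r * x + s)%R)%E.
Proof.
move=> r0 mf f0.
have mphi : @measurable_fun _ _ (measurableTypeR R) (measurableTypeR R) setT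
    (fun x => r * x + s) by exact: measurable_affine.
pose nu := measure_function_pushforward__canonical__measure_function_Measure mu mphi.
have <- : (\int[nu]_x f x = \int[mu]_x f (r * x + s)%R)%E.
  exact: (@ge0_integral_pushforward _ _ _ _ R _ mphi mu setT f measurableT mf (fun x _ => f0 x)).
have -> : r%:E = (NngNum (ltW r0))%:num%:E by [].
rewrite -(@ge0_integral_mscale _ _ _ nu)//; apply: eq_measure_integral => A mA _.
exact/esym/lebesgue_measure_affine.
Qed.

Lemma ge0_integral_reflect (f : R -> \bar R) :
  measurable_fun [set: R] f -> (forall x, 0 <= f x)%E ->
  (\int[mu]_x f x = \int[mu]_x f (- x)%R)%E.
Proof.
move=> mf f0.
have mphi : @measurable_fun _ _ (measurableTypeR R) (measurableTypeR R) setT -%R.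
  exact: oppr_measurable.
have := @ge0_integral_pushforward _ _ _ _ R _ mphi mu setT f measurableT mf (fun x _ => f0 x).
rewrite preimage_setT => <-; apply: eq_measure_integral => A mA _.
exact/esym/lebesgue_measureN.
Qed.

Lemma integral_affine r s (f : R -> \bar R) : 0 < r -> mu.-integrable [set: R] f ->
  mu.-integrable [set: R] (fun x => f (r * x + s)%R) /\
  (\int[mu]_x f x = r%:E * \int[mu]_x f (r * x + s)%R)%E.
Proof.
move=> r0 intf; have /integrableP[mf foo] := intf.
have mphi := measurable_affine r s.
have intfa : mu.-integrable [set: R] (fun x => f (r * x + s)%R).
  apply/integrableP; split; first exact: (measurableT_comp mf).
  rewrite (ge0_integral_affine s r0) in foo; last 2 first.
    exact: measurableT_comp.
    by [].
  rewrite ltNge leye_eq; apply/negP => /eqP H; move: foo; rewrite H.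
  by rewrite gt0_muley ?ltxx// lte_fin.
split => //; rewrite integralE [in RHS]integralE.
rewrite muleBr//; last first.
  apply: fin_num_adde_defl; rewrite fin_numN.
  by apply: integrable_neg_fin_num => //.
rewrite (ge0_integral_affine s r0)//; last exact: measurable_funepos.
have fn : forall x, (0 <= f^\- x)%E by [].
rewrite [X in (_ - X)%E](ge0_integral_affine s r0 (measurable_funeneg mf) fn).
by congr (_ * _ - _ * _)%E; apply: eq_integral => x _; rewrite (funeposE, funenegE) (funeposE, funenegE).
Qed.

Lemma integral_reflect (f : R -> \bar R) : measurable_fun [set: R] f ->
  (\int[mu]_x f x = \int[mu]_x f (- x)%R)%E.
Proof.
move=> mf; rewrite integralE [in RHS]integralE.
rewrite ge0_integral_reflect//; last exact: measurable_funepos.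
have fn : forall x, (0 <= f^\- x)%E by [].
rewrite [X in (_ - X)%E](ge0_integral_reflect (measurable_funeneg mf) fn).
by congr (_ - _)%E; apply: eq_integral => x _; rewrite (funeposE, funenegE) (funeposE, funenegE).
Qed.

End AffineSubstitution.

(** * Passage from the completed measure of the definitions to Borel sets and functions *)

Section CompletedLebesgue.
Context {R : realType}.
Notation mu := (@lebesgue_measure R).
Notation lam := (@completed_lebesgue_measure R).

Lemma borel_lebesgue_measurable (A : set R) : measurable A -> lebesgue_measurable A.
Proof. by move=> mA; exact: sub_caratheodory. Qed.

Lemma lebesgue_measurableP (A : set R) : lebesgue_measurable A ->
  exists B N : set R, [/\ measurable B, B `<=` A, measurable N, mu N = 0%E &
    A `\` B `<=` N].
Proof.
move=> mA; have : ((completed_algebra_gen mu).-sigma.-measurable) A.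
  by rewrite completed_caratheodory_measurable; exact: mA.
rewrite g_sigma_completed_algebra_genE => -[B mB] [N0 negN <-].
have [N [mN N0' NN]] := negN.
exists B, N; split; [exact: mB|exact: subsetUl|exact: mN|exact: N0'|].
by move=> x [[//|Nx] _]; exact: NN.
Qed.

Lemma measurable_fun_borel_lebesgue d (T : measurableType d) (g : R -> T) :
  measurable_fun [set: R] g -> measurable_fun [set: lebesgueType R] (g : lebesgueType R -> T).
Proof.
move=> mg _ Y mY; rewrite setTI; apply: borel_lebesgue_measurable.
by rewrite -[X in measurable X]setTI; exact: mg.
Qed.

(** Sublevel sets at rational heights are Borel up to subsets of Borel null sets. Resetting [f] to 0
    on the countable union [N] of these null sets makes every rational sublevel set Borel. *)
Lemma borel_representative (f : R -> R) :
  measurable_fun [set: lebesgueType R] (f : lebesgueType R -> R) ->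
  exists g N : _, [/\ measurable_fun [set: R] (g : R -> R), measurable (N : set R),
    mu N = 0%E & forall x, ~ N x -> f x = g x].
Proof.
move=> mf.
have H (q : rat) : exists BM : set R * set R, [/\ measurable BM.1,
    BM.1 `<=` [set x | f x < ratr q], measurable BM.2, mu BM.2 = 0%E &
    [set x | f x < ratr q] `\` BM.1 `<=` BM.2].
  have [|B [N]] := @lebesgue_measurableP [set x | f x < ratr q]; last by exists (B, N).
  have := mf measurableT `]-oo, (ratr q)[%classic (measurable_itv _).
  by rewrite setTI set_itvE.
have [BM BMP] := choice H.
(* [unpickle] enumerates the rationals; numbers that code no rational fall back on 0. *)
pose N := \bigcup_n (BM (odflt 0 (unpickle n))).2.
have mN : measurable N.
  by apply: bigcupT_measurable => n; have [] := BMP (odflt 0 (unpickle n)).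
have N0 : mu N = 0%E.
  apply: measure_negligible => //; apply: negligible_bigcup => n.
  by apply: (proj2 (negligibleP mu _)); have [] := BMP (odflt 0 (unpickle n)).
pose g := fun x => if x \in N then 0 else f x.
exists g, N; split => //; last by move=> x Nx; rewrite /g memNset.
have mgq (q : rat) : measurable [set x | g x < ratr q].
  have -> : [set x | g x < ratr q] =
     ((BM q).1 `&` ~` N) `|` (if 0 < (ratr q : R) then N else set0).
    apply/seteqP; split=> x /=; rewrite /g.
      case: ifPn => [/set_mem Nx q0|/negP xN fq]; first by right; rewrite q0.
      have nx : ~ N x by move=> Nx; apply: xN; exact/mem_set.
      left; split => //; apply: contrapT => Bx; apply: nx.
      have qE : odflt 0 (unpickle (pickle q)) = q by rewrite pickleK.
      exists (pickle q); first exact: I.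
      by rewrite qE; have [_ _ _ _] := BMP q; apply.
    case=> [[Bx nx]|].
      by rewrite memNset//; have [_ + _ _ _] := BMP q; apply.
    by case: ifPn => // q0 Nx; rewrite mem_set.
  have [mB _ _ _ _] := BMP q.
  by apply: measurableU; [apply: measurableI => //; exact: measurableC|case: ifP].
apply: (measurability _ (RGenInftyO.measurableE R)) => // _ [_ [c ->] <-].
rewrite setTI.
have -> : g @^-1` `]-oo, c[ = \bigcup_(q in [set q : rat | ratr q < c]) [set x | g x < ratr q].
  apply/seteqP; split=> x /=; rewrite in_itv/=.
    by move=> /rat_in_itvoo [q]; rewrite in_itv/= => /andP[q1 q2]; exists q.
  by move=> [q /= qc gq]; exact: lt_trans qc.
rewrite bigcup_mkcond; apply: bigcupT_measurable_rat => q.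
by case: ifP.
Qed.

(** The identity is measurable from the completed space to the Borel one and pushes the completed
    measure to the Borel one. *)
Lemma completed_ge0_integral (g : R -> \bar R) : measurable_fun [set: R] g ->
  (forall x, 0 <= g x)%E -> (\int[lam]_x g x = \int[mu]_x g x)%E.
Proof.
move=> mg g0.
have mi : measurable_fun [set: lebesgueType R] (id : lebesgueType R -> measurableTypeR R).
  by apply: measurable_fun_borel_lebesgue; exact: measurable_id.
pose nu := measure_function_pushforward__canonical__measure_function_Measure lam mi.
transitivity (\int[nu]_x g x)%E; last exact: eq_measure_integral.
apply/esym.
exact: (@ge0_integral_pushforward _ _ _ _ R _ mi lam setT g measurableT mg (fun x _ => g0 x)).
Qed.

Lemma completed_integral (g : R -> \bar R) : measurable_fun [set: R] g ->
  (\int[lam]_x g x = \int[mu]_x g x)%E.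
Proof.
move=> mg; rewrite integralE [in RHS]integralE.
rewrite completed_ge0_integral//; last exact: measurable_funepos.
by rewrite completed_ge0_integral//; exact: measurable_funeneg.
Qed.

Lemma completed_negligible (N : set R) : lam.-negligible N <-> mu.-negligible N.
Proof.
split=> -[A [mA A0 NA]].
  have [B [M [mB BA mM M0 ABM]]] := lebesgue_measurableP mA.
  exists (B `|` M); split; first exact: measurableU.
    apply/eqP; rewrite -measure_le0; apply: le_trans (measureU2 mu mB mM) _.
    have : (mu B <= lam A)%E by apply: le_outer_measure.
    have M0' : (mu M <= 0)%E by rewrite M0.
    by rewrite A0 => B0; have := leeD B0 M0'; rewrite adde0.
  by move=> x /NA Ax; have [Bx|Bx] := pselect (B x); [left|right; exact: ABM].
by exists A; split => //; exact: borel_lebesgue_measurable.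
Qed.

End CompletedLebesgue.

(** * Cosine transforms and the reproducing kernel *)

Section CosineTransform.
Context {R : realType}.
Notation mu := (@lebesgue_measure R).
Notation intble f := (mu.-integrable [set: R] (EFin \o f)).
Implicit Types (f g phi : R -> R) (t x al L M : R).

Definition supp_in L f := forall x, L < `|x| -> f x = 0.

Lemma supp_inMr L f g : supp_in L f -> supp_in L (fun x => f x * g x).
Proof. by move=> f0 x /f0 ->; rewrite mul0r. Qed.

Lemma supp_in_derive L f g : supp_in L f -> (forall x, is_derive x 1 f (g x)) ->
  supp_in L g.
Proof.
move=> f0 fg x Lx.
have d0 : is_derive x 1 f 0.
  apply: (@near_eq_is_derive _ _ _ (fun=> 0 : R)).
  have : \forall y \near x, L < `|y|.
    exact: (@norm_continuous _ R^o x) _ (lt_nbhsr Lx).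
  by apply: filterS => y /f0 ->.
by rewrite -(@derive_val _ _ _ _ _ _ _ (fg x)) (@derive_val _ _ _ _ _ _ _ d0).
Qed.

Lemma is_derive_continuous f g : (forall x, is_derive x 1 f (g x)) -> continuous f.
Proof.
by move=> fg x; apply/differentiable_continuous/derivable1_diffP; have [] := fg x.
Qed.

Lemma Rintegral_supp L f : supp_in L f ->
  \int[mu]_x f x = \int[mu]_(x in `[- L, L]) f x.
Proof.
move=> f0; rewrite [RHS]Rintegral_mkcond; apply: eq_Rintegral => x _.
rewrite patchE; case: ifPn => // /negP xL; apply: f0; rewrite ltNge; apply/negP => xL'.
by apply: xL; rewrite inE/= in_itv/= -ler_norml.
Qed.

Lemma continuous_supp_integrable L f : continuous f -> supp_in L f -> intble f.
Proof.
move=> cf f0.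
have -> : EFin \o f = (EFin \o f) \_ `[- L, L].
  apply/funext => x; rewrite patchE; case: ifPn => // /negP xL /=.
  rewrite f0// ltNge; apply/negP => xL'.
  by apply: xL; rewrite inE/= in_itv/= -ler_norml.
apply/(integrable_mkcond _ _).1 => //.
apply: continuous_compact_integrable; first exact: segment_compact.
exact: continuous_subspaceT.
Qed.

Lemma FTC2 (F f : R -> R) (a b : R) : a < b -> (forall x, is_derive x 1 F (f x)) ->
  continuous f -> \int[mu]_(x in `[a, b]) f x = F b - F a.
Proof.
move=> ab Ff cf; rewrite /Rintegral (@continuous_FTC2 _ f F)//.
- exact: continuous_subspaceT.
- split=> [x _||]; first by have [] := Ff x.
  + by apply: cvg_at_right_filter; exact: is_derive_continuous Ff _.
  + by apply: cvg_at_left_filter; exact: is_derive_continuous Ff _.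
- by move=> x _; rewrite derive1E; exact: derive_val.
Qed.

(** The phase [al] lets one real integral stand for cosine and sine transforms: differentiation in
    [t] and integration by parts both shift it by pi / 2. *)
Definition cosint phi al t : R := \int[mu]_x (phi x * cos (t * x + al)).

Lemma continuous_cos_affine t al : continuous (fun x : R => cos (t * x + al)).
Proof.
have d x : is_derive x 1 (fun x => cos (t * x + al)) (- sin (t * x + al) * t).
  exact: is_derive_comp (is_derive_cos _) (is_derive_affine t al x).
exact: is_derive_continuous d.
Qed.

Lemma cosint_integrable L phi al t : continuous phi -> supp_in L phi ->
  intble (fun x => phi x * cos (t * x + al)).
Proof.
move=> cphi s; apply: (@continuous_supp_integrable L); last exact: supp_inMr.
by move=> x; apply: continuousM; [exact: cphi|exact: continuous_cos_affine].
Qed.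

Lemma is_derive_cosint L phi al t : continuous phi -> supp_in L phi ->
  is_derive t 1 (cosint phi al) (cosint (fun x => phi x * x) (al + pi / 2) t).
Proof.
move=> cphi s.
pose f (t x : R) := phi x * cos (t * x + al).
pose G (x : R) := `|phi x * x|.
have cphix : continuous (fun x => phi x * x).
  by move=> x; apply: continuousM; [exact: cphi|exact: cvg_id].
have df (y x : R) : is_derive y 1 (fun s => f s x) (phi x * x * cos (y * x + (al + pi / 2))).
  have dl : is_derive y 1 (fun s => s * x + al) x.
    by rewrite (_ : (fun s => _) = (fun s => x * s + al));
      [exact: is_derive_affine|apply/funext => u; rewrite mulrC].
  have /is_derive_eq := is_derive_scale (phi x) (@is_derive_comp R cos (fun s => s * x + al) y _ _ (is_derive_cos _) dl).
  by apply; rewrite addrA cosDpihalf; ring.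
have It : `]t - 1, t + 1[%classic t by rewrite /= in_itv/= ltrBlDr !ltrDl ltr01.
have intf (y : R) : `]t - 1, t + 1[%classic y -> intble (f y).
  by move=> _; exact: (cosint_integrable al y cphi s).
have derf (y x : R) : `]t - 1, t + 1[%classic y -> [set: R] x -> derivable (f ^~ x) y 1.
  by move=> _ _; have [] := df y x.
have G0 x : 0 <= G x by exact: normr_ge0.
have intG : intble G.
  apply: (@continuous_supp_integrable L).
    by move=> x; exact: (cvg_norm (cphix x)).
  by move=> x Lx; rewrite /G s ?mul0r ?normr0.
have dfE (y x : R) : partial1of2 f y x = phi x * x * cos (y * x + (al + pi / 2)).
  by rewrite partial1of2E; exact: (@derive_val _ _ _ _ _ _ _ (df y x)).
have Gub (y x : R) : `]t - 1, t + 1[%classic y -> [set: R] x -> `|partial1of2 f y x| <= G x.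
  by move=> _ _; rewrite dfE normrM ler_piMr// cos_max.
split; first exact: (derivable_under_integral measurableT It intf derf G0 intG Gub).
rewrite -derive1E (differentiation_under_integral measurableT It intf derf G0 intG Gub).
by apply: eq_Rintegral => x _; rewrite dfE.
Qed.

Lemma continuous_cosint L phi al : continuous phi -> supp_in L phi ->
  continuous (cosint phi al).
Proof. by move=> cphi s; exact: is_derive_continuous (fun t => is_derive_cosint al t cphi s). Qed.

(** The derivative of phi x * sin (t x + al) has integral 0; the shift of the phase absorbs the sine
    together with its sign. *)
Lemma cosint_by_parts L phi phi' al t : 0 <= L -> (forall x, is_derive x 1 phi (phi' x)) ->
  continuous phi' -> supp_in L phi ->
  t * cosint phi al t = cosint phi' (al + pi / 2) t.
Proof.
move=> L0 dphi cphi' s.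
have cphi := is_derive_continuous dphi.
have s' := supp_in_derive s dphi.
pose F x := phi x * sin (t * x + al).
pose f x := phi' x * sin (t * x + al) + phi x * (cos (t * x + al) * t).
have dF x : is_derive x 1 F (f x).
  apply: is_derive_mul => //.
  exact: is_derive_comp (is_derive_sin _) (is_derive_affine t al x).
have cs : continuous (fun x : R => sin (t * x + al)).
  have d x : is_derive x 1 (fun x => sin (t * x + al)) (cos (t * x + al) * t).
    exact: is_derive_comp (is_derive_sin _) (is_derive_affine t al x).
  exact: is_derive_continuous d.
have cf : continuous f.
  move=> x; rewrite /f.
  have h1 : {for x, continuous (fun y => phi' y * sin (t * y + al))}.
    by apply: continuousM; [exact: cphi'|exact: cs].
  have h2 : {for x, continuous (fun y => phi y * (cos (t * y + al) * t))}.
    apply: continuousM; first exact: cphi.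
    by apply: continuousM; [exact: continuous_cos_affine|exact: cvg_cst].
  exact: (continuousD h1 h2).
(* The radius grows to [L + 1]: [supp_in L] says nothing at |x| = L, where the boundary terms would
   be taken, and for L = 0 the interval would be degenerate. *)
have sf : supp_in (L + 1) f.
  move=> x Lx; have Lx' : L < `|x| by apply: lt_trans Lx; rewrite ltrDl.
  by rewrite /f s// s'// !mul0r addr0.
have f0 : \int[mu]_x f x = 0.
  rewrite (Rintegral_supp sf) (@FTC2 F)//; last by lra.
  rewrite /F !s ?mul0r ?subrr// ?normrN ger0_norm ?ltrDl//; lra.
have i1 : intble (fun x => phi' x * sin (t * x + al)).
  apply: (@continuous_supp_integrable L); last exact: supp_inMr.
  by move=> x; apply: continuousM; [exact: cphi'|exact: cs].
have i2 : intble (fun x => phi x * cos (t * x + al)) by exact: cosint_integrable s.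
have -> : cosint phi' (al + pi / 2) t = - \int[mu]_x (phi' x * sin (t * x + al)).
  rewrite -mulN1r -RintegralZl//; apply: eq_Rintegral => x _.
  by rewrite addrA cosDpihalf mulN1r mulrN.
apply/eqP; rewrite -addr_eq0 addrC /cosint -RintegralZl// -RintegralD//; last first.
  exact: (integrableZl measurableT t i2).
rewrite -f0; apply/eqP; apply: eq_Rintegral => x _; rewrite /f; ring.
Qed.

Lemma norm_cosint_le L phi al t M : 0 <= L -> continuous phi -> supp_in L phi ->
  (forall x, `|phi x| <= M) -> `|cosint phi al t| <= 2 * L * M.
Proof.
move=> L0 cphi s phiM.
rewrite /cosint (@Rintegral_supp L); last exact: supp_inMr.
have mI : @measurable _ (measurableTypeR R) `[- L, L] by exact: measurable_itv.
have i1 : mu.-integrable `[- L, L] (EFin \o (fun x => phi x * cos (t * x + al))).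
  by apply: integrableS (cosint_integrable al t cphi s).
have := le_normr_Rintegral mI i1; move=> /le_trans; apply.
have muI : mu `[- L, L] = (2 * L)%:E.
  rewrite lebesgue_measure_itv/= lte_fin -EFinD opprK.
  by case: ltP => h; congr EFin; lra.
have -> : 2 * L * M = \int[mu]_(x in `[- L, L]) M.
  by rewrite Rintegral_cst// -[X in fine X]/(mu `[- L, L]) muI/= mulrC.
apply: le_Rintegral => //.
- exact: integrable_norm i1.
- apply: continuous_compact_integrable; first exact: segment_compact.
  by apply: continuous_subspaceT => x; exact: cvg_cst.
- move=> x _; rewrite normrM -[leRHS]mulr1; apply: ler_pM => //; exact: cos_max.
Qed.

End CosineTransform.

(** * Integrability, dominated convergence and Fubini for real-valued integrals *)

Section IntegrationTools.
Context {R : realType}.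
Notation mu := (@lebesgue_measure R).
Notation intble f := (mu.-integrable [set: R] (EFin \o f)).
Implicit Types (f g : R -> R) (t x L M : R).

Lemma continuous_supp_bounded L f : 0 <= L -> continuous f -> supp_in L f ->
  exists2 M, 0 <= M & forall x, `|f x| <= M.
Proof.
move=> L0 cf sf; have LL : - L <= L by lra.
have [c _ cM] := @EVT_max R (fun x => `|f x|) (- L) L LL
   (continuous_subspaceT (fun x => cvg_norm (cf x))).
exists `|f c| => // x; have [xL|xL] := leP `|x| L; last by rewrite sf// normr0.
by apply: cM; rewrite in_itv/= -ler_norml.
Qed.

Lemma intble_measurable f : intble f -> measurable_fun [set: R] f.
Proof. by move=> /(measurable_int mu) /measurable_EFinP. Qed.

Lemma intble_le f g : measurable_fun [set: R] f -> (forall x, `|f x| <= g x) ->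
  intble g -> intble f.
Proof.
move=> mf fg ig; apply: le_integrable ig => //; first exact/measurable_EFinP.
move=> x _; rewrite /= lee_fin; apply: le_trans (fg x) _; exact: ler_norm.
Qed.

Lemma intbleZ f (k : R) : intble f -> intble (fun x => k * f x).
Proof. by move=> fi; exact: (integrableZl measurableT k fi). Qed.

Lemma intbleD f g : intble f -> intble g -> intble (fun x => f x + g x).
Proof. by move=> fi gi; exact: (integrableD measurableT fi gi). Qed.

Lemma intble_fin f : intble f -> (\int[mu]_x (f x)%:E = (\int[mu]_x f x)%:E)%E.
Proof. by move=> fi; rewrite /Rintegral fineK//; exact: (integrable_fin_num measurableT fi). Qed.

Lemma measurable_oneDsqrV : measurable_fun [set: R] (fun x => (oneDsqr x)^-1).
Proof. by apply: continuous_measurable_fun; exact: (@continuous_oneDsqrV R). Qed.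

Lemma integrable_oneDsqrV : intble (fun x => (oneDsqr x)^-1).
Proof.
apply/integrableP; split; first by apply/measurable_EFinP; exact: measurable_oneDsqrV.
under eq_integral do rewrite gee0_abs ?lee_fin ?invr_ge0 ?(le_trans ler01 (oneDsqr_ge1 _))//.
rewrite ge0_symfun_integralT.
- by rewrite -set_itvcy integral0y_oneDsqr -EFinM ltry.
- by move=> x; rewrite invr_ge0 (le_trans ler01)// oneDsqr_ge1.
- exact: (@continuous_oneDsqrV R).
- by move=> x; rewrite /oneDsqr/= sqrrN.
Qed.

Lemma Rintegral_oneDsqrV : \int[mu]_x (oneDsqr x)^-1 = pi.
Proof.
rewrite /Rintegral ge0_symfun_integralT.
- by rewrite -set_itvcy integral0y_oneDsqr -EFinM/= mulrC divfK.
- by move=> x; rewrite invr_ge0 (le_trans ler01)// oneDsqr_ge1.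
- exact: (@continuous_oneDsqrV R).
- by move=> x; rewrite /oneDsqr/= sqrrN.
Qed.

Lemma Rintegral_dct (f_ : nat -> R -> R) f g :
  (forall n, measurable_fun [set: R] (f_ n)) -> measurable_fun [set: R] f ->
  {ae mu, forall x, f_ n x @[n --> \oo] --> f x} -> intble g ->
  (forall n x, `|f_ n x| <= g x) ->
  (\int[mu]_x f_ n x) @[n --> \oo] --> \int[mu]_x f x.
Proof.
move=> mf_ mf f_f ig f_g.
have h1 n : measurable_fun [set: R] (EFin \o f_ n) by exact/measurable_EFinP.
have h2 : measurable_fun [set: R] (EFin \o f) by exact/measurable_EFinP.
have h3 : {ae mu, forall x, [set: R] x -> (EFin \o f_ n) x @[n --> \oo] --> (EFin \o f) x}.
  move: f_f; apply: filterS; first exact: (ae_filter_ringOfSetsType mu).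
  move=> x f_x _; exact: (cvg_EFin (nearW _ _) f_x).
have h4 : {ae mu, forall x n, [set: R] x -> (`|(EFin \o f_ n) x| <= (EFin \o g) x)%E}.
  by apply: aeW => x n _; rewrite /= lee_fin.
have [fi _ H] := @dominated_convergence _ _ R mu setT measurableT
  (fun n => EFin \o f_ n) (EFin \o f) (EFin \o g) h1 h2 h3 ig h4.
rewrite /Rintegral; apply: fine_cvg.
rewrite fineK//; exact: (integrable_fin_num measurableT fi).
Qed.

(** The bounded kernel leaves room for a weight: a function integrable only against 1 / (1 + y^2)
    enters as that product, and the factor 1 + y^2 goes into [K]. *)
Lemma Fubini_kernel (a b : R -> R) (K : R * R -> R) M :
  intble a -> intble b -> measurable_fun [set: R * R] K -> (forall z, `|K z| <= M) ->
  intble (fun y => b y * \int[mu]_x (a x * K (x, y))) /\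
  \int[mu]_x (a x * \int[mu]_y (b y * K (x, y))) =
  \int[mu]_y (b y * \int[mu]_x (a x * K (x, y))).
Proof.
move=> ia ib mK KM.
have ma := intble_measurable ia; have mb := intble_measurable ib.
have M0 : 0 <= M by exact: le_trans (KM (0, 0)).
pose f (z : R * R) : R := a z.1 * (b z.2 * K z).
have mf : measurable_fun [set: R * R] f.
  by apply: measurable_funM; [exact: measurableT_comp|
    apply: measurable_funM => //; exact: measurableT_comp].
have mKx x : measurable_fun [set: R] (fun y => K (x, y)).
  by apply: measurableT_comp => //; exact: measurable_pair1.
have mKy y : measurable_fun [set: R] (fun x => K (x, y)).
  by apply: measurableT_comp => //; exact: measurable_pair2.
have ibK x : intble (fun y => b y * K (x, y)).
  apply: (@intble_le _ (fun y => M * `|b y|)); first exact: measurable_funM.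
    by move=> y; rewrite normrM mulrC ler_wpM2r.
  by apply: intbleZ; exact: (integrable_norm ib).
have iaK y : intble (fun x => a x * K (x, y)).
  apply: (@intble_le _ (fun x => M * `|a x|)); first exact: measurable_funM.
    by move=> x; rewrite normrM mulrC ler_wpM2r.
  by apply: intbleZ; exact: (integrable_norm ia).
have iff : (mu \x mu)%E.-integrable [set: R * R] (EFin \o f).
  apply/(integrable12ltyP _ _ _).2; first exact/measurable_EFinP.
  apply: (@le_lt_trans _ _ (\int[mu]_x (`|a x| * (M * \int[mu]_y `|b y|))%:E)%E).
    apply: ge0_le_integral => //.
    - by move=> x _; exact: integral_ge0.
    - apply: (measurable_fun_fubini_tonelli_F (m2 := mu) (abse \o (EFin \o f))) => //=.
      by apply: measurableT_comp => //; exact/measurable_EFinP.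
    - apply/measurable_EFinP; apply: measurable_funM => //.
      exact: measurableT_comp.
    - move=> x _.
      have iMb : intble (fun y => M * `|b y|) by apply: intbleZ; exact: (integrable_norm ib).
      have -> : ((`|a x| * (M * \int[mu]_y `|b y|))%:E =
          \int[mu]_y (`|a x| * (M * `|b y|))%:E)%E.
        rewrite (intble_fin (intbleZ `|a x| iMb)) RintegralZl//.
        by rewrite RintegralZl//; exact: (integrable_norm ib).
      apply: ge0_le_integral => //.
      + apply: measurableT_comp => //; apply/measurable_EFinP.
        exact: (measurable_funM (measurable_cst (a x)) (measurable_funM mb (mKx x))).
      + apply/measurable_EFinP; apply: measurable_funM => //.
        by apply: measurable_funM => //; exact: measurableT_comp.
      + move=> y _; rewrite /= lee_fin /f/= !normrM ler_wpM2l// mulrC ler_wpM2r//.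
  have := integrable_norm ia.
  move=> /(intbleZ (M * \int[mu]_y `|b y|)) i2.
  under eq_integral do rewrite mulrC.
  by rewrite (intble_fin i2) ltry.
have FubF : (\int[mu]_x \int[mu]_y (f (x, y))%:E =
   \int[mu]_y \int[mu]_x (f (x, y))%:E)%E by exact: Fubini iff.
have E1 x : (\int[mu]_y (f (x, y))%:E = (a x * \int[mu]_y (b y * K (x, y)))%:E)%E.
  by rewrite -(RintegralZl (a x) measurableT (ibK x)) -(intble_fin (intbleZ (a x) (ibK x))).
have E2 y : (\int[mu]_x (f (x, y))%:E = (b y * \int[mu]_x (a x * K (x, y)))%:E)%E.
  rewrite -(RintegralZl (b y) measurableT (iaK y)) -(intble_fin (intbleZ (b y) (iaK y))).
  by apply: eq_integral => x _; rewrite /f/= mulrCA.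
split.
  apply: (@intble_le _ (fun y => (\int[mu]_x (M * `|a x|)) * `|b y|)).
  - apply/measurable_EFinP.
    have := measurable_fubini_G iff.
    by congr measurable_fun; apply/funext => y; exact: E2.
  - move=> y; rewrite normrM mulrC ler_wpM2r//.
    apply: le_trans (le_normr_Rintegral measurableT (iaK y)) _.
    apply: le_Rintegral => //; first exact: integrable_norm (iaK y).
      by apply: intbleZ; exact: (integrable_norm ia).
    by move=> x _; rewrite normrM mulrC ler_wpM2r.
  - by apply: intbleZ; exact: (integrable_norm ib).
have -> : \int[mu]_x (a x * \int[mu]_y (b y * K (x, y))) =
    fine (\int[mu]_x \int[mu]_y (f (x, y))%:E)%E.
  by congr fine; apply: eq_integral => x _; rewrite E1.
rewrite FubF; congr fine; apply: eq_integral => y _; exact: E2.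
Qed.

End IntegrationTools.

(** * Decay and positive mass of the transform of the cutoff *)

Section CutoffTransform.
Context {R : realType}.
Notation mu := (@lebesgue_measure R).
Notation intble f := (mu.-integrable [set: R] (EFin \o f)).
Implicit Types (t x M : R) (n : nat).

Let continuous_mul (f g : R -> R) : continuous f -> continuous g ->
  continuous (fun x => f x * g x).
Proof. by move=> cf cg x; exact: (continuousM (cf x) (cg x)). Qed.

Let continuous_add (f g : R -> R) : continuous f -> continuous g ->
  continuous (fun x => f x + g x).
Proof. by move=> cf cg x; exact: (continuousD (cf x) (cg x)). Qed.

Let continuous_cst (c : R) : continuous (fun _ : R => c).
Proof. by move=> x; exact: cvg_cst. Qed.

(* The [n]-th derivative of the Fourier transform of [cutoff]. *)
Definition kap n : R -> R := cosint (fun x => cutoff x * x ^+ n) (n%:R * (pi / 2)).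

Let cutoff_pow_continuous n : continuous (fun x : R => cutoff x * x ^+ n).
Proof.
move=> x; apply: continuousM; first exact: smoothR_continuous cutoff_smooth _.
exact: exprn_continuous.
Qed.

Let cutoff_supp : supp_in 1 (@cutoff R).
Proof. by move=> x x1; apply: cutoff0; exact: ltW. Qed.

Lemma is_derive_kap n t : is_derive t 1 (kap n) (kap n.+1 t).
Proof.
have := is_derive_cosint (n%:R * (pi / 2)) t (@cutoff_pow_continuous n)
  (supp_inMr (fun x => x ^+ n) cutoff_supp).
have -> : kap n.+1 t = cosint (fun x => cutoff x * x ^+ n * x) (n%:R * (pi / 2) + pi / 2) t.
  rewrite /kap -natr1 mulrDl mul1r; congr cosint.
  by apply/funext => x; rewrite exprSr mulrA.
by [].
Qed.

Lemma continuous_kap n : continuous (kap n).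
Proof. exact: is_derive_continuous (is_derive_kap n). Qed.

Lemma measurable_kap n : measurable_fun [set: R] (kap n).
Proof. by apply: continuous_measurable_fun; exact: continuous_kap. Qed.

Lemma kap0N t : kap 0 (- t) = kap 0 t.
Proof.
rewrite /kap /cosint; apply: eq_Rintegral => x _.
by rewrite !mul0r !addr0 mulNr cosN.
Qed.

(** One bound is trivial, the other comes from two integrations by parts. On the support [-1, 1] two
    derivatives of x^n cost only n^2, a growth that the factorial of the interpolation remainder can
    beat. *)
Lemma kap_decay : exists2 A : R, 0 < A &
  forall n t, `|kap n t| <= A * n.+1%:R ^+ 2 * (oneDsqr t)^-1.
Proof.
pose c0 : R -> R := cutoff; pose c1 := derive1 c0; pose c2 := derive1 c1.
have s0 : smoothR c0 := cutoff_smooth.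
have s1 : smoothR c1 := smoothR_derive s0.
have d0 x : is_derive x 1 c0 (c1 x) := smoothR_is_derive x s0.
have d1 x : is_derive x 1 c1 (c2 x) := smoothR_is_derive x s1.
have k0 : continuous c0 := smoothR_continuous s0.
have k1 : continuous c1 := smoothR_continuous s1.
have k2 : continuous c2 := smoothR_continuous (smoothR_derive s1).
have z0 : supp_in 1 c0 := cutoff_supp.
have z1 : supp_in 1 c1 := supp_in_derive z0 d0.
have z2 : supp_in 1 c2 := supp_in_derive z1 d1.
have [M0 M00 B0] := continuous_supp_bounded ler01 k0 z0.
have [M1 M10 B1] := continuous_supp_bounded ler01 k1 z1.
have [M2 M20 B2] := continuous_supp_bounded ler01 k2 z2.
exists (4 * (M0 + M1 + M2) + 1) => [|n t].
  by rewrite ltr_wpDl// mulr_ge0// !addr_ge0.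
pose p0 x := c0 x * x ^+ n.
(* The predecessors are truncated at 0; in those cases the factors [n%:R] and [n.-1%:R] vanish. *)
pose p1 x := c1 x * x ^+ n + c0 x * (n%:R * x ^+ n.-1 * 1).
pose p2 x := (c2 x * x ^+ n + c1 x * (n%:R * x ^+ n.-1 * 1)) +
  (c1 x * (n%:R * x ^+ n.-1 * 1) + c0 x * (n%:R * (n.-1%:R * x ^+ n.-2 * 1))).
have e0 x : is_derive x 1 p0 (p1 x).
  exact: is_derive_mul (d0 x) (is_derive_exp n (is_derive_id x 1)).
have e1 x : is_derive x 1 p1 (p2 x).
  apply: is_derive_add.
    exact: is_derive_mul (d1 x) (is_derive_exp n (is_derive_id x 1)).
  apply: is_derive_mul (d0 x) _.
  rewrite (_ : (fun t => _) = (fun t => n%:R * t ^+ n.-1)); last first.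
    by apply/funext => u; rewrite mulr1.
  exact: is_derive_scale (is_derive_exp n.-1 (is_derive_id x 1)).
have q0 : supp_in 1 p0 by exact: supp_inMr.
have q1 : supp_in 1 p1 := supp_in_derive q0 e0.
have q2 : supp_in 1 p2 := supp_in_derive q1 e1.
have cX m : continuous (fun x : R => x ^+ m) by exact: exprn_continuous.
have cX1 m : continuous (fun x : R => m%:R * x ^+ m.-1 * 1).
  exact: (continuous_mul (continuous_mul (@continuous_cst m%:R) (cX m.-1)) (@continuous_cst 1)).
have r1 : continuous p1 := is_derive_continuous e1.
have r2 : continuous p2.
  have u := continuous_mul k1 (cX1 n).
  have v := continuous_mul k0 (continuous_mul (@continuous_cst n%:R) (cX1 n.-1)).
  exact: (continuous_add (continuous_add (continuous_mul k2 (cX n)) u) (continuous_add u v)).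
set al := n%:R * (pi / 2) : R.
have parts : t ^+ 2 * kap n t = cosint p2 (al + pi / 2 + pi / 2) t.
  rewrite expr2 -mulrA [kap n]/(cosint p0 al).
  by rewrite (cosint_by_parts al t ler01 e0 r1 q0) (cosint_by_parts _ t ler01 e1 r2 q1).
have xm x m : `|x| <= 1 -> `|x ^+ m| <= 1 by move=> x1; rewrite normrX exprn_ile1.
have b0 : `|kap n t| <= 2 * 1 * M0.
  apply: (norm_cosint_le al t ler01 (is_derive_continuous e0) q0).
  move=> x; have [x1|x1] := leP `|x| 1; last by rewrite (q0 x x1) normr0.
  by rewrite /p0 normrM -[leRHS]mulr1; apply: ler_pM => //; exact: xm.
have nn : 1 <= n.+1%:R ^+ 2 :> R by rewrite -natrX ler1n expn_gt0.
have b2 : `|t ^+ 2 * kap n t| <= 2 * 1 * ((M0 + M1 + M2) * n.+1%:R ^+ 2).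
  rewrite parts; apply: (norm_cosint_le _ t ler01 r2 q2) => x.
  have [x1|x1] := leP `|x| 1; last by rewrite (q2 x x1) normr0 !mulr_ge0// ?addr_ge0.
  have nx m k : `|m%:R * x ^+ k * 1| <= m%:R.
    by rewrite mulr1 normrM normr_nat ler_piMr// xm.
  have t1 : `|c2 x * x ^+ n| <= M2.
    by rewrite normrM -[leRHS]mulr1; apply: ler_pM => //; exact: xm.
  have t2 : `|c1 x * (n%:R * x ^+ n.-1 * 1)| <= M1 * n%:R.
    by rewrite normrM; apply: ler_pM.
  have t3 : `|c0 x * (n%:R * (n.-1%:R * x ^+ n.-2 * 1))| <= M0 * (n%:R * n%:R).
    rewrite normrM; apply: ler_pM => //.
    rewrite normrM normr_nat ler_wpM2l//; apply: le_trans (nx _ _) _.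
    by rewrite ler_nat leq_pred.
  apply: (@le_trans _ _ (M2 + M1 * n%:R + (M1 * n%:R + M0 * (n%:R * n%:R)))).
    rewrite /p2; apply: le_trans (ler_normD _ _) _; apply: lerD.
      by apply: le_trans (ler_normD _ _) _; exact: lerD.
    by apply: le_trans (ler_normD _ _) _; exact: lerD.
  have n0 : 0 <= n%:R :> R by [].
  rewrite -[n.+1%:R]natr1; move: n0 M00 M10 M20; set m := n%:R : R => m0 h0 h1 h2.
  have p00 : 0 <= M0 * m by rewrite mulr_ge0.
  have p22 : 0 <= M2 * m by rewrite mulr_ge0.
  have p222 : 0 <= M2 * m * m by rewrite !mulr_ge0.
  have p11 : 0 <= M1 * m * m by rewrite !mulr_ge0.
  by lra.
have o0 : 0 < oneDsqr t by rewrite (lt_le_trans ltr01) ?oneDsqr_ge1.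
rewrite ler_pdivlMr// /oneDsqr mulrDr mulr1.
have -> : `|kap n t| * t ^+ 2 = `|t ^+ 2 * kap n t|.
  by rewrite normrM mulrC (ger0_norm (sqr_ge0 t)).
apply: le_trans (lerD b0 b2) _.
set N := n.+1%:R ^+ 2 in nn *.
have h0 : M0 <= M0 * N by rewrite ler_peMr.
have h1 : 0 <= M1 * N by rewrite mulr_ge0// (le_trans ler01).
have h2 : 0 <= M2 * N by rewrite mulr_ge0// (le_trans ler01).
by move: h0 h1 h2 nn; lra.
Qed.

Lemma integrable_kap0 : intble (kap 0).
Proof.
have [A A0 H] := kap_decay.
apply: (@intble_le _ _ (fun t => A * (oneDsqr t)^-1)); first exact: measurable_kap.
  by move=> t; apply: le_trans (H 0%N t) _; rewrite expr1n mulr1.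
by apply: intbleZ; exact: integrable_oneDsqrV.
Qed.

(* Half of a Fejer weight: its cosine transform is nonnegative. *)
Let hat M t : R := if 0 <= t <= M then 1 - t / M else 0.

Let is_derive_lin M t : is_derive t 1 (fun t : R => 1 - t / M) (- M^-1).
Proof.
rewrite (_ : (fun t => _) = (fun t => - M^-1 * t + 1)); first exact: is_derive_affine.
by apply/funext => u; rewrite addrC mulNr mulrC.
Qed.

Let continuous_lin M : continuous (fun t : R => 1 - t / M).
Proof. exact: is_derive_continuous (is_derive_lin M). Qed.

Let measurable_hat M : measurable_fun [set: R] (hat M).
Proof.
have -> : hat M = (fun t => 1 - t / M) \_ `[0, M].
  by apply/funext => t; rewrite patchE /hat mem_setE in_itv.
apply/(measurable_restrictT _ _).1 => //.
by apply: measurable_funTS; apply: continuous_measurable_fun; exact: (@continuous_lin M).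
Qed.

Let hat_bound M t : 0 < M -> 0 <= hat M t <= 1.
Proof.
move=> M0; rewrite /hat; case: ifPn => [/andP[t0 tM]|_]; last by rewrite lexx ler01.
by rewrite subr_ge0 ler_pdivrMr// mul1r tM/= gerBl divr_ge0// ltW.
Qed.

Let hat_integral M g : continuous g ->
  \int[mu]_t (hat M t * g t) = \int[mu]_(t in `[0, M]) ((1 - t / M) * g t).
Proof.
move=> cg; rewrite [RHS]Rintegral_mkcond; apply: eq_Rintegral => t _.
by rewrite patchE /hat mem_setE in_itv/=; case: ifP; rewrite ?mul0r.
Qed.

Let integrable_hat M : 0 < M -> intble (hat M).
Proof.
move=> M0.
have -> : EFin \o hat M = (EFin \o (fun t => 1 - t / M)) \_ `[0, M].
  by apply/funext => t; rewrite patchE /hat /= mem_setE in_itv/=; case: ifP.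
apply/(integrable_mkcond _ _).1 => //.
apply: continuous_compact_integrable; first exact: segment_compact.
by apply: continuous_subspaceT; exact: (@continuous_lin M).
Qed.

(** For nonzero xi the integral is (1 - cos (M xi)) / (M xi^2), read off the primitive [F]. *)
Let hat_cos_ge0 M xi : 0 < M -> 0 <= \int[mu]_t (hat M t * cos (t * xi)).
Proof.
move=> M0; have [->|xi0] := eqVneq xi 0.
  apply: Rintegral_ge0 => t _; rewrite mulr0 cos0 mulr1.
  by have /andP[] := hat_bound t M0.
have dl t : is_derive t 1 (fun t : R => t * xi) xi.
  rewrite (_ : (fun t => _) = (fun t => xi * t + 0)); first exact: is_derive_affine.
  by apply/funext => u; rewrite addr0 mulrC.
have ds t : is_derive t 1 (fun t : R => sin (t * xi)) (cos (t * xi) * xi).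
  exact: is_derive_comp (is_derive_sin _) (dl t).
have dc t : is_derive t 1 (fun t : R => cos (t * xi)) (- sin (t * xi) * xi).
  exact: is_derive_comp (is_derive_cos _) (dl t).
have cc := is_derive_continuous dc.
rewrite hat_integral//.
pose F t := (1 - t / M) * (xi^-1 * sin (t * xi)) + (- (M * xi ^+ 2)^-1) * cos (t * xi).
have dF t : is_derive t 1 F ((1 - t / M) * cos (t * xi)).
  have /is_derive_eq := is_derive_add (is_derive_mul (is_derive_lin M t) (is_derive_scale xi^-1 (ds t)))
    (is_derive_scale (- (M * xi ^+ 2)^-1) (dc t)).
  by apply; field; rewrite xi0 gt_eqF.
have cf : continuous (fun t : R => (1 - t / M) * cos (t * xi)).
  exact: continuous_mul (@continuous_lin M) cc.
rewrite (FTC2 M0 dF cf).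
have -> : F M - F 0 = (M * xi ^+ 2)^-1 * (1 - cos (M * xi)).
  by rewrite /F !mul0r sin0 cos0; field; rewrite xi0 gt_eqF.
by rewrite mulr_ge0 ?subr_ge0 ?cos_le1// invr_ge0 mulr_ge0 ?sqr_ge0// ltW.
Qed.

Let cos2_gt0 : 0 < cos (2^-1 : R).
Proof.
by apply: cos_gt0_pihalf; have := @pihalf_ge1 R; lra.
Qed.

(** On [0, M] the phase t xi is at most 1/2 in modulus, so the cosine is at least cos (1/2), and the
    weight has mass M / 2. *)
Let hat_cos_lower M xi : 0 < M -> `|xi| <= M^-1 / 2 ->
  cos 2^-1 * (M / 2) <= \int[mu]_t (hat M t * cos (t * xi)).
Proof.
move=> M0 xiM.
pose F t := cos 2^-1 * (t - t ^+ 2 / (2 * M)).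
have dF t : is_derive t 1 F ((1 - t / M) * cos 2^-1).
  have /is_derive_eq := is_derive_scale (cos 2^-1) (is_derive_add (is_derive_id t 1)
    (is_derive_scale (- (2 * M)^-1) (is_derive_exp 2 (is_derive_id t 1)))).
  rewrite (_ : (fun _ => _) = F); last first.
    by apply/funext => u; rewrite /F mulNr (mulrC (_^-1)).
  by apply; rewrite /= expr1; field; rewrite gt_eqF.
have cc : continuous (fun t : R => (1 - t / M) * cos 2^-1).
  exact: continuous_mul (@continuous_lin M) (@continuous_cst _).
have -> : cos 2^-1 * (M / 2) = \int[mu]_t (hat M t * cos 2^-1).
  rewrite hat_integral; last exact: continuous_cst.
  by rewrite (FTC2 M0 dF cc) /F; field; rewrite gt_eqF.
have mcos : measurable_fun [set: R] (fun t : R => cos (t * xi)).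
  apply: measurableT_comp; first exact: continuous_measurable_fun (@continuous_cos R).
  exact: measurable_funM.
apply: le_Rintegral => //.
- have := intbleZ (cos 2^-1) (integrable_hat M0).
  by under eq_fun do rewrite mulrC.
- apply: (@intble_le _ _ (hat M)); last exact: integrable_hat.
    exact: measurable_funM.
  move=> t; rewrite normrM; have /andP[h0 _] := hat_bound t M0.
  by rewrite (ger0_norm h0) ler_piMr// cos_max.
- move=> t _; rewrite /hat; case: ifPn => [/andP[t0 tM]|_]; last by rewrite !mul0r.
  apply: ler_wpM2l; first by rewrite subr_ge0 ler_pdivrMr// mul1r.
  have tx : `|t * xi| <= 2^-1.
    have -> : 2^-1 = M * (M^-1 / 2) by field; rewrite gt_eqF.
    by rewrite normrM (ger0_norm t0); apply: ler_pM.
  have cosnorm : cos (t * xi) = cos `|t * xi|.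
    by case: (ger0P (t * xi)) => _; rewrite ?cosN.
  have p1 := @pihalf_ge1 R.
  rewrite cosnorm leNgt; apply/negP; rewrite ltr_cos ?in_itv/= ?normr_ge0//=.
  - by rewrite ltNge tx.
  - by lra.
  - by lra.
Qed.

Let hat_dist M t : 0 < M -> t != 0 -> `|hat M t + hat M (- t) - 1| <= `|t| / M.
Proof.
move=> M0 t0; wlog tgt : t t0 / 0 < t.
  move=> H; have [tP|] := ltP 0 t; first exact: (H t t0 tP).
  rewrite le_eqVlt (negbTE t0)/= -oppr_gt0 => tN.
  rewrite -oppr_eq0 in t0; have := H (- t) t0 tN.
  by rewrite opprK normrN (addrC (hat M (- t))).
rewrite (gtr0_norm tgt) /hat [0 <= - t]leNgt oppr_lt0 tgt/= addr0 (ltW tgt)/=.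
have [tM|tM] := leP t M.
  by rewrite addrAC subrr add0r normrN ger0_norm// divr_ge0// ltW.
by rewrite sub0r normrN1 ler_pdivlMr// mul1r ltW.
Qed.

(** Fubini turns the integral into that of the cutoff against the nonnegative transform of the
    weight. The part |x| <= 1 / (2 M), where the cutoff is 1, has length 1 / M and height at least
    cos (1/2) M / 2, so the bound does not depend on [M]. *)
Let fejer_lower M : 1 <= M -> cos 2^-1 / 2 <= \int[mu]_t (hat M t * kap 0 t).
Proof.
move=> M1; have M0 : 0 < M := lt_le_trans ltr01 M1.
have cutc : continuous (@cutoff R) := smoothR_continuous cutoff_smooth.
have ib : intble (@cutoff R) := continuous_supp_integrable cutc cutoff_supp.
pose K (z : R * R) := cos (z.1 * z.2).
have mK : measurable_fun [set: R * R] K.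
  apply: measurableT_comp; first exact: continuous_measurable_fun (@continuous_cos R).
  exact: measurable_funM.
have K1 z : `|K z| <= 1 by exact: cos_max.
have [intG FubE] := Fubini_kernel (integrable_hat M0) ib mK K1.
have -> : \int[mu]_t (hat M t * kap 0 t) =
    \int[mu]_t (hat M t * \int[mu]_x (cutoff x * K (t, x))).
  apply: eq_Rintegral => t _; congr *%R; apply: eq_Rintegral => x _.
  by rewrite /K mul0r addr0 expr0 mulr1.
rewrite {}FubE {mK K1 ib cutc}.
set D : set R := `[- (M^-1 / 2), M^-1 / 2]%classic.
set k := cos 2^-1 * (M / 2).
have V0 : 0 < M^-1 by rewrite invr_gt0.
have muD : mu D = (M^-1)%:E.
  rewrite lebesgue_measure_itv/= lte_fin -EFinD opprK -splitr ifT//.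
  by rewrite gtrN// divr_gt0.
have mD : @measurable _ (measurableTypeR R) D by exact: measurable_itv.
have -> : cos 2^-1 / 2 = \int[mu]_x ((fun=> k) \_ D) x.
  rewrite -Rintegral_mkcond Rintegral_cst// -[X in fine X]/(mu D) muD /k/=.
  by field; rewrite gt_eqF.
apply: le_Rintegral => //.
- have -> : EFin \o ((fun=> k) \_ D) = (EFin \o (fun=> k)) \_ D.
    by apply/funext => x; rewrite /= !patchE; case: ifP.
  apply/(integrable_mkcond _ _).1 => //.
  apply: continuous_compact_integrable; first exact: segment_compact.
  by apply: continuous_subspaceT; exact: (@continuous_cst k).
- move=> x _; rewrite patchE; case: ifPn => [|_]; last first.
    by rewrite mulr_ge0 ?cutoff_ge0//; exact: hat_cos_ge0.
  rewrite mem_setE in_itv/= -ler_norml => xM.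
  rewrite cutoff1 ?mul1r; first exact: hat_cos_lower.
  apply: le_trans xM _; rewrite ler_pdivrMr// mulVf// invf_le1//.
Qed.

(** Fourier inversion would give the value 2 pi. Positivity is obtained directly: the integral is a
    limit of Fejer means, each at least cos (1/2). *)
Lemma Rintegral_kap_gt0 : 0 < \int[mu]_t kap 0 t.
Proof.
pose h n t := (hat n.+1%:R t + hat n.+1%:R (- t)) * kap 0 t.
have mh n : measurable_fun [set: R] (h n).
  apply: measurable_funM; last exact: measurable_kap.
  apply: measurable_funD => //; apply: measurableT_comp => //.
have n0 n : 0 < n.+1%:R :> R by [].
have ik : intble (fun t => 2 * `|kap 0 t|).
  by apply: intbleZ; exact: (integrable_norm integrable_kap0).
have ih n : intble (fun t => hat n.+1%:R t * kap 0 t).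
  apply: (@intble_le _ _ (fun t => `|kap 0 t|)).
  - by apply: measurable_funM => //; exact: measurable_kap.
  - move=> t; have /andP[h0 h1] := hat_bound t (n0 n).
    by rewrite normrM (ger0_norm h0) ler_piMl.
  - exact: (integrable_norm integrable_kap0).
have hh n : \int[mu]_t h n t = 2 * \int[mu]_t (hat n.+1%:R t * kap 0 t).
  have mf : measurable_fun [set: R] (fun t => hat n.+1%:R t * kap 0 t).
    exact: intble_measurable (ih n).
  have refl : \int[mu]_t (hat n.+1%:R (- t) * kap 0 t) =
      \int[mu]_t (hat n.+1%:R t * kap 0 t).
    transitivity (\int[mu]_t (hat n.+1%:R (- t) * kap 0 (- t))).
      by apply: eq_Rintegral => t _; rewrite kap0N.
    have /(congr1 fine) := integral_reflect (proj2 (measurable_EFinP _ _) mf).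
    by move=> H; exact: esym H.
  rewrite mulr2n mulrDl mul1r -{2}refl -RintegralD//.
    by apply: eq_Rintegral => t _; rewrite /h mulrDl.
  apply: (@intble_le _ _ (fun t => `|kap 0 t|)).
  - apply: measurable_funM; last exact: measurable_kap.
    by apply: measurableT_comp.
  - move=> t; have /andP[h0 h1] := hat_bound (- t) (n0 n).
    by rewrite normrM (ger0_norm h0) ler_piMl.
  - exact: (integrable_norm integrable_kap0).
have hb n t : `|h n t| <= 2 * `|kap 0 t|.
  rewrite /h normrM ler_wpM2r//.
  have /andP[h0 h1] := hat_bound t (n0 n); have /andP[h2 h3] := hat_bound (- t) (n0 n).
  by rewrite ger0_norm ?addr_ge0//; lra.
have hcvg : {ae mu, forall t, h n t @[n --> \oo] --> kap 0 t}.
  (* At t = 0 both halves of the weight equal 1 and their sum is 2, hence the exceptional point. *)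
  exists [set 0]; split; [exact: measurable_set1|exact: lebesgue_measure_set1|].
  move=> t /= H; apply: contrapT => /eqP t0; apply: H.
  have H1 : (hat n.+1%:R t + hat n.+1%:R (- t)) @[n --> \oo] --> (1 : R).
    apply/cvgrPdist_le => e e0.
    have : (`|t| * harmonic n) @[n --> \oo] --> `|t| * 0.
      by apply: cvgM; [exact: cvg_cst|exact: cvg_harmonic].
    rewrite mulr0 => /cvgrPdist_le/(_ e e0); apply: filterS => n.
    rewrite sub0r normrN distrC => le_e.
    apply: le_trans (hat_dist (n0 n) t0) _; apply: le_trans le_e; exact: ler_norm.
  rewrite -[X in _ --> X]mul1r; apply: cvgM => //; exact: cvg_cst.
have := Rintegral_dct mh (measurable_kap 0) hcvg ik hb.
move=> H; apply: lt_le_trans cos2_gt0 _.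
rewrite -(cvg_lim _ H)//; apply: limr_ge; first by apply/cvg_ex; eexists; exact: H.
apply: nearW => n; rewrite hh; have : cos 2^-1 / 2 <= _ := @fejer_lower n.+1%:R _.
rewrite ler1n => /(_ isT); lra.
Qed.

End CutoffTransform.

(** * Reproduction formula *)

Section Reproduction.
Context {R : realType}.
Notation mu := (@lebesgue_measure R).
Notation intble f := (mu.-integrable [set: R] (EFin \o f)).
Implicit Types (s t x y z be : R) (n : nat) (u : R -> R).

(** [kern be 0] is the Fourier transform of the cutoff stretched to [-be, be], see [cosint_cutoff],
    and [n] counts derivatives; hence the power n + 1. *)
Definition kern be n t : R := be ^+ n.+1 * kap n (be * t).

Lemma is_derive_kern be n t : is_derive t 1 (kern be n) (kern be n.+1 t).
Proof.
have dl : is_derive t 1 (fun t : R => be * t) be.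
  rewrite (_ : (fun t => _) = (fun t => be * t + 0)); first exact: is_derive_affine.
  by apply/funext => x; rewrite addr0.
have /is_derive_eq := is_derive_scale (be ^+ n.+1)
  (@is_derive_comp R (kap n) _ t _ _ (is_derive_kap n _) dl).
by apply; rewrite /kern [be ^+ n.+2]exprSr; ring.
Qed.

Lemma continuous_kern be n : continuous (kern be n).
Proof. exact: is_derive_continuous (is_derive_kern be n). Qed.

Lemma measurable_kern be n : measurable_fun [set: R] (kern be n).
Proof. by apply: continuous_measurable_fun; exact: continuous_kern. Qed.

Lemma oneDsqr_gt0 (x : R) : 0 < oneDsqr x.
Proof. by rewrite (lt_le_trans ltr01) ?oneDsqr_ge1. Qed.

(** Compares the weights centred at 0 and at [z]. It follows from y^2 <= 2 z^2 + 2 (z - y)^2, the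
    term 2 / be^2 paying for the second square. *)
Lemma oneDsqr_shift be z y : 0 < be ->
  oneDsqr y <= (1 + 2 * z ^+ 2 + 2 / be ^+ 2) * oneDsqr (be * (z - y)).
Proof.
move=> be0.
have -> : (1 + 2 * z ^+ 2 + 2 / be ^+ 2) * oneDsqr (be * (z - y)) =
    (1 + 2 * z ^+ 2) + (1 + 2 * z ^+ 2) * (be * (z - y)) ^+ 2 + 2 / be ^+ 2 + 2 * (z - y) ^+ 2.
  by rewrite /oneDsqr; field; rewrite gt_eqF.
have h1 : 0 <= (1 + 2 * z ^+ 2) * (be * (z - y)) ^+ 2.
  by rewrite mulr_ge0 ?sqr_ge0// addr_ge0// mulr_ge0// sqr_ge0.
have h2 : 0 <= 2 / be ^+ 2 by rewrite divr_ge0// sqr_ge0.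
have h3 : 0 <= (2 * z - y) ^+ 2 by exact: sqr_ge0.
rewrite /oneDsqr; move: h1 h2 h3; set P := (1 + 2 * z ^+ 2) * _; set Q := 2 / _.
by move=> h1 h2 h3; have : y ^+ 2 <= 2 * z ^+ 2 + 2 * (z - y) ^+ 2; nra.
Qed.

(** All L^p functions with p >= 1 satisfy this, and it makes integrals against kernels of quadratic
    decay converge. *)
Definition tempered u := measurable_fun [set: R] u /\
  intble (fun y => u y * (oneDsqr y)^-1).

Lemma measurable_oneDsqrV_sub be z :
  measurable_fun [set: R] (fun y => (oneDsqr (be * (z - y)))^-1).
Proof.
apply: (measurableT_comp measurable_oneDsqrV).
by apply: measurable_funM => //; exact: measurable_funB.
Qed.

Lemma tempered_norm u : tempered u -> tempered (fun y => `|u y|).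
Proof.
move=> [mu_ iu]; split; first exact: measurableT_comp.
rewrite (_ : EFin \o _ = EFin \o (fun y => `|u y * (oneDsqr y)^-1|)).
  exact: (integrable_norm iu).
apply/funext => y; rewrite /= normrM (@gtr0_norm _ (_^-1))//.
Qed.

Lemma tempered_poisson u be z : 0 < be -> tempered u ->
  intble (fun y => u y * (oneDsqr (be * (z - y)))^-1).
Proof.
move=> be0 /[dup] [[mu_ _]] /tempered_norm[_ iu].
set C := 1 + 2 * z ^+ 2 + 2 / be ^+ 2.
have C0 : 0 < C.
  rewrite /C -addrA ltr_pwDl// addr_ge0//; first by rewrite mulr_ge0// sqr_ge0.
  by rewrite divr_ge0// sqr_ge0.
apply: (@intble_le _ _ (fun y => C * (`|u y| * (oneDsqr y)^-1))); last exact: intbleZ.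
  by apply: measurable_funM => //; exact: measurable_oneDsqrV_sub.
move=> y; rewrite normrM mulrCA ler_wpM2l// gtr0_norm ?invr_gt0 ?oneDsqr_gt0//.
rewrite ler_pdivlMr ?oneDsqr_gt0// mulrC ler_pdivrMr ?oneDsqr_gt0//.
exact: oneDsqr_shift.
Qed.

Lemma kern_decay : exists2 A : R, 0 < A & forall be n t, 0 < be ->
  `|kern be n t| <= A * n.+1%:R ^+ 2 * be ^+ n.+1 * (oneDsqr (be * t))^-1.
Proof.
have [A A0 H] := @kap_decay R; exists A => // be n t be0.
rewrite /kern normrM (ger0_norm (exprn_ge0 _ (ltW be0))).
rewrite [leRHS]mulrAC [leRHS]mulrC; apply: ler_wpM2l (exprn_ge0 _ (ltW be0)) _ _ _.
exact: H.
Qed.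

Lemma tempered_kern u be n z : 0 < be -> tempered u ->
  intble (fun y => u y * kern be n (z - y)).
Proof.
move=> be0 tu; have [A A0 H] := kern_decay.
apply: (@intble_le _ _ (fun y => A * n.+1%:R ^+ 2 * be ^+ n.+1 *
    (`|u y| * (oneDsqr (be * (z - y)))^-1))).
- apply: measurable_funM; first by case: tu.
  apply: (measurableT_comp (measurable_kern be n)); exact: measurable_funB.
- by move=> y; rewrite normrM mulrCA ler_wpM2l// H.
- by apply: intbleZ; apply: tempered_poisson => //; exact: tempered_norm.
Qed.

(** The primitive of [h] truncated to [-N, N] vanishes on the open interval, and its derivative is
    [h] almost everywhere there. *)
Lemma ae_eq0_of_intervals (h : R -> R) :
  (forall s t, mu.-integrable `[s, t] (EFin \o h)) ->
  (forall s t, s < t -> \int[mu]_(x in `[s, t]) h x = 0) ->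
  {ae mu, forall x, h x = 0}.
Proof.
move=> ih h0.
suff H (N : nat) : {ae mu, forall x, - N%:R < x -> x < N%:R -> h x = 0}.
  have : {ae mu, forall x, forall N : nat, - N%:R < x -> x < N%:R -> h x = 0}.
    by apply/ae_foralln => N; exact: H.
  apply: filterS; first exact: (ae_filter_ringOfSetsType mu).
  move=> x Hx; have := archi_boundP (normr_ge0 x).
  by rewrite ltr_norml => /andP[h1 h2]; exact: Hx h1 h2.
pose D : set R := `[- N%:R, N%:R]%classic.
have mD : measurable D by exact: measurable_itv.
pose f := h \_ D.
have fi : intble f.
  rewrite (_ : EFin \o f = (EFin \o h) \_ D).
    by apply/(integrable_mkcond _ _).1 => //; exact: ih.
  by apply/funext => x; rewrite /f /= !patchE; case: ifP.
have lf : locally_integrable [set: R] f by apply: open_integrable_locally => //; exact: openT.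
have iy (y : R) : mu.-integrable `]-oo, y] (EFin \o f) by apply: integrableS fi.
have := FTC1Ny iy lf.
apply: filterS; first exact: (ae_filter_ringOfSetsType mu).
move=> x /= [dF F'] xN1 xN2.
have -> : h x = f x by rewrite /f patchE mem_set// /D /= in_itv/= !ltW.
rewrite -F' derive1E.
have F0 : is_derive x 1 (fun x => \int[mu]_(t in `]-oo, x]) f t) 0.
  apply: (@near_eq_is_derive _ _ _ (fun=> 0 : R)).
  near=> y.
  have yN1 : - N%:R < y by near: y; exact: lt_nbhsr.
  have yN2 : y < N%:R by near: y; exact: lt_nbhsl.
  rewrite -(h0 _ _ yN1) [RHS]Rintegral_mkcond [LHS]Rintegral_mkcond.
  apply: eq_Rintegral => w _; rewrite /f !patchE.
  rewrite /D !mem_setE !in_itv/=.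
  have [wy|wy] := leP w y; last by rewrite andbF.
  by rewrite andbT (le_trans wy (ltW yN2)) andbT.
exact: derive_val.
Unshelve. all: by end_near. Qed.

End Reproduction.

(** * Kernels tested on intervals, and the limit of large dilation *)

Section ReproductionFormula.
Context {R : realType}.
Notation mu := (@lebesgue_measure R).
Notation intble f := (mu.-integrable [set: R] (EFin \o f)).
Implicit Types (s t x y be : R) (u : R -> R).

Definition ind s t x : R := if s <= x <= t then 1 else 0.

Lemma ind_patch s t (f : R -> R) : (fun x => ind s t x * f x) = f \_ `[s, t].
Proof.
apply/funext => x; rewrite patchE /ind mem_setE in_itv/=.
by case: ifP; rewrite ?mul1r ?mul0r.
Qed.

Lemma measurable_ind s t : measurable_fun [set: R] (ind s t).
Proof.
have -> : ind s t = (fun=> 1 : R) \_ `[s, t].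
  by rewrite -ind_patch; apply/funext => x; rewrite mulr1.
by apply/(measurable_restrictT _ _).1.
Qed.

Lemma ind01 s t x : 0 <= ind s t x <= 1.
Proof. by rewrite /ind; case: ifP; rewrite ?lexx ?ler01. Qed.

Lemma Rintegral_ind s t (f : R -> R) :
  \int[mu]_x (ind s t x * f x) = \int[mu]_(x in `[s, t]) f x.
Proof. by rewrite [RHS]Rintegral_mkcond -ind_patch. Qed.

Lemma integrable_ind_itv s t (f : R -> R) :
  intble (fun x => ind s t x * f x) <-> mu.-integrable `[s, t] (EFin \o f).
Proof.
rewrite (_ : EFin \o (fun x => ind s t x * f x) = (EFin \o f) \_ `[s, t]).
  by apply: iff_sym; apply: integrable_mkcond.
by rewrite ind_patch; apply/funext => x; rewrite /= !patchE; case: ifP.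
Qed.

Lemma integrable_ind s t : intble (ind s t).
Proof.
have /integrable_ind_itv : mu.-integrable `[s, t] (EFin \o (fun=> 1 : R)).
  apply: continuous_compact_integrable; first exact: segment_compact.
  by apply: continuous_subspaceT => x; exact: cvg_cst.
by under [X in EFin \o X]eq_fun do rewrite mulr1.
Qed.

Lemma norm_ind s t x : `|ind s t x| = ind s t x.
Proof. by rewrite ger0_norm//; have /andP[] := ind01 s t x. Qed.

Lemma oneDsqrVK x : (oneDsqr x)^-1 * oneDsqr x = 1.
Proof. by rewrite mulVf// gt_eqF// oneDsqr_gt0. Qed.

Lemma oneDsqrV_le1 x : (oneDsqr x)^-1 <= 1.
Proof. by rewrite invf_le1 ?oneDsqr_gt0// oneDsqr_ge1. Qed.

Section Windowed.
Variables (u : R -> R) (s t : R).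
Hypotheses (tu : tempered u) (st : s < t).

Let sq_le x : s <= x <= t -> x ^+ 2 <= s ^+ 2 + t ^+ 2.
Proof.
move=> /andP[sx xt]; have [x0|x0] := leP 0 x.
  have : x ^+ 2 <= t ^+ 2 by rewrite lerXn2r ?nnegrE// (le_trans x0).
  by have := sqr_ge0 s; lra.
have : x ^+ 2 <= s ^+ 2.
  rewrite -sqrrN -(sqrrN s) lerXn2r ?nnegrE ?lerN2// oppr_ge0.
    exact: ltW.
  by rewrite (le_trans sx)// ltW.
by have := sqr_ge0 t; lra.
Qed.

Definition conv be x : R := \int[mu]_y (u y * kern be 0 (x - y)).

(** The kernel is moved from [u], which has no regularity, to the indicator of [s, t], whose
    smoothing converges at every point other than s and t. *)
Definition window be y : R := \int[mu]_x (ind s t x * kern be 0 (x - y)).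

Lemma tempered_integrable_itv : mu.-integrable `[s, t] (EFin \o u).
Proof.
apply/integrable_ind_itv.
have [mu_ iu] := tu.
apply: (@intble_le _ _ (fun y => (1 + (s ^+ 2 + t ^+ 2)) * (`|u y * (oneDsqr y)^-1|))).
- by apply: measurable_funM => //; exact: measurable_ind.
- move=> y; rewrite normrM /ind; case: ifPn => [sy|_]; last first.
    by rewrite normr0 mul0r mulr_ge0// addr_ge0// addr_ge0 ?sqr_ge0.
  rewrite normr1 mul1r normrM mulrCA ler_peMr//.
  rewrite (@gtr0_norm _ (_^-1)) ?invr_gt0 ?oneDsqr_gt0//.
  by rewrite ler_pdivlMr ?oneDsqr_gt0// mul1r lerD2l sq_le.
- by apply: intbleZ; exact: (integrable_norm iu).
Qed.

Lemma window_duality be : 0 < be ->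
  [/\ intble (fun x => ind s t x * conv be x),
      intble (fun y => u y * window be y) &
  \int[mu]_x (ind s t x * conv be x) = \int[mu]_y (u y * window be y)].
Proof.
move=> be0; have [A A0 kd] := @kern_decay R.
have [mu_ iu] := tu.
pose a y := u y * (oneDsqr y)^-1.
(* The weight taken from [u] is given back to the kernel, which stays bounded because x ranges over
   [s, t] and the decay is quadratic. *)
pose K (z : R * R) := ind s t z.2 * kern be 0 (z.2 - z.1) * oneDsqr z.1.
have msub : measurable_fun [set: R * R] (fun z : R * R => z.2 - z.1).
  exact: measurable_funB.
have mK : measurable_fun [set: R * R] K.
  apply: measurable_funM.
    apply: measurable_funM.
      exact: measurableT_comp (measurable_ind s t) measurable_snd.
    exact: measurableT_comp (measurable_kern be 0) msub.
  apply: measurableT_comp measurable_fst.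
  exact: continuous_measurable_fun (@continuous_oneDsqr R).
pose M := A * be * (1 + 2 * (s ^+ 2 + t ^+ 2) + 2 / be ^+ 2).
have KM z : `|K z| <= M.
  rewrite /K /ind; case: ifPn => [sz|_]; last first.
    rewrite !mul0r normr0 mulr_ge0 ?mulr_ge0 ?(ltW A0) ?(ltW be0)//.
    rewrite addr_ge0//; last by rewrite divr_ge0// sqr_ge0.
    by rewrite addr_ge0// mulr_ge0// addr_ge0 ?sqr_ge0.
  rewrite mul1r normrM (gtr0_norm (oneDsqr_gt0 _)).
  have := kd be 0%N (z.2 - z.1) be0; rewrite expr1n mulr1 expr1 => h.
  apply: le_trans (ler_wpM2r (ltW (oneDsqr_gt0 _)) h) _.
  rewrite /M -[leLHS]mulrA; apply: ler_wpM2l; first by rewrite mulr_ge0 ?(ltW A0) ?(ltW be0).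
  rewrite ler_pdivrMl ?oneDsqr_gt0// mulrC.
  apply: le_trans (oneDsqr_shift z.2 z.1 be0) _.
  apply: ler_wpM2r; first exact/ltW/oneDsqr_gt0.
  by rewrite lerD2r lerD2l ler_wpM2l// sq_le.
have E1 x : ind s t x * \int[mu]_y (a y * K (y, x)) = ind s t x * conv be x.
  rewrite {1 2}/ind; case: ifPn => [sx|_]; last by rewrite !mul0r.
  congr *%R; apply: eq_Rintegral => y _; rewrite /K/= /ind sx mul1r /a.
  by rewrite mulrACA oneDsqrVK mulr1.
have iw y : intble (fun x => ind s t x * kern be 0 (x - y)).
  apply: (@intble_le _ _ (fun x => A * be * ind s t x)).
  - apply: measurable_funM; first exact: measurable_ind.
    apply: (measurableT_comp (measurable_kern be 0)); exact: measurable_funB.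
  - move=> x; rewrite normrM norm_ind mulrC; apply: ler_wpM2r.
      by have /andP[] := ind01 s t x.
    have := kd be 0%N (x - y) be0; rewrite expr1n mulr1 expr1 => h.
    apply: le_trans h _; rewrite ler_piMr//; first by rewrite mulr_ge0 ?(ltW A0) ?(ltW be0).
    exact: oneDsqrV_le1.
  - by apply: intbleZ; exact: integrable_ind.
have E2 y : a y * \int[mu]_x (ind s t x * K (y, x)) = u y * window be y.
  have -> : \int[mu]_x (ind s t x * K (y, x)) = oneDsqr y * window be y.
    rewrite -RintegralZl//; apply: eq_Rintegral => x _; rewrite /K /ind/=.
    by case: ifP => _; rewrite ?mul0r ?mulr0// !mul1r mulrC.
  by rewrite /a mulrA -[u y * _ * _]mulrA oneDsqrVK mulr1.
have [H1 H2] := Fubini_kernel iu (integrable_ind s t) mK KM.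
have mK' : measurable_fun [set: R * R] (fun z : R * R => K (z.2, z.1)).
  exact: (measurableT_comp mK (measurable_fun_pair measurable_snd measurable_fst)).
have [H3 _] := Fubini_kernel (integrable_ind s t) iu mK' (fun z => KM (z.2, z.1)).
split.
- by move: H1; congr (mu.-integrable _ (_ \o _)); apply/funext => x; exact: E1.
- by move: H3; congr (mu.-integrable _ (_ \o _)); apply/funext => y; exact: E2.
transitivity (\int[mu]_x (ind s t x * \int[mu]_y (a y * K (y, x)))).
  by apply: eq_Rintegral => x _; rewrite E1.
by rewrite -H2; apply: eq_Rintegral => y _; rewrite E2.
Qed.

Lemma integrable_kap_ind be y : intble (fun v => kap 0 v * ind s t (y + v / be)).
Proof.
apply: (@intble_le _ _ (fun v => `|kap 0 v|)).
- apply: measurable_funM; first exact: measurable_kap.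
  apply: (measurableT_comp (measurable_ind s t)).
  by apply: measurable_funD => //; exact: measurable_funM.
- by move=> v; rewrite normrM ler_piMr// norm_ind; have /andP[] := ind01 s t (y + v / be).
- exact: (integrable_norm integrable_kap0).
Qed.

(** The substitution v = be (x - y) moves the scale into the indicator, so that [|kap 0|] dominates
    at every scale. *)
Lemma window_rescale be y : 0 < be ->
  window be y = \int[mu]_v (kap 0 v * ind s t (y + v / be)).
Proof.
move=> be0; have [_ H] := integral_affine (- (be * y)) be0 (integrable_kap_ind be y).
rewrite {1}/Rintegral H /window.
have E x : kap 0 (be * x - be * y) * ind s t (y + (be * x - be * y) / be) =
    be^-1 * (ind s t x * kern be 0 (x - y)).
  have -> : y + (be * x - be * y) / be = x by field; rewrite gt_eqF.
  by rewrite /kern expr1 mulrBr; field; rewrite gt_eqF.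
have iw : intble (fun x => be^-1 * (ind s t x * kern be 0 (x - y))).
  have [+ _] := integral_affine (- (be * y)) be0 (integrable_kap_ind be y).
  by congr (mu.-integrable _ _); apply/funext => x; rewrite /= -E.
transitivity (be * \int[mu]_x (be^-1 * (ind s t x * kern be 0 (x - y)))).
  rewrite -RintegralZl//; apply: eq_Rintegral => x _.
  by rewrite [RHS]mulrA mulfV ?mul1r// gt_eqF.
rewrite -[RHS]/(fine _) -[be * _]/(fine (be * _)%:E) EFinM -(intble_fin iw).
by congr (fine (_ * _)%E); apply: eq_integral => x _; rewrite /= E.
Qed.

(** Off the endpoints the indicator is constant near [y], so for each [v] the integrand is
    eventually constant in [n]. *)
Lemma window_cvg be0 y : 0 < be0 -> y != s -> y != t ->
  window (be0 * n.+1%:R) y @[n --> \oo] --> (\int[mu]_v kap 0 v) * ind s t y.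
Proof.
move=> be00 ys yt.
have ben (n : nat) : 0 < be0 * n.+1%:R by rewrite mulr_gt0.
under eq_fun do rewrite (window_rescale y (ben _)).
rewrite -(RintegralZr _ measurableT integrable_kap0).
apply: (@Rintegral_dct _ _ _ (fun v => `|kap 0 v|)).
- by move=> n; exact: intble_measurable (integrable_kap_ind _ _).
- by apply: measurable_funM => //; exact: measurable_kap.
- apply: aeW => v; apply: cvgM; first exact: cvg_cst.
  pose e := Num.min `|y - s| `|y - t|.
  have e0 : 0 < e by rewrite lt_min !normr_gt0 !subr_eq0 ys yt.
  apply: cvg_near_cst.
  have : (v / be0 * harmonic n) @[n --> \oo] --> v / be0 * 0.
    by apply: cvgM; [exact: cvg_cst|exact: cvg_harmonic].
  rewrite mulr0 => /cvgrPdist_lt/(_ e e0); apply: filterS => n.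
  rewrite sub0r normrN /harmonic /= -mulrA -invfM lt_min => /andP[h1 h2].
  move: h1 h2; set w := v / _ => h1 h2; rewrite /ind.
  congr (if _ then _ else _); congr (_ && _).
    have [ys'|ys'] := ltrP y s.
      move: h1; rewrite (ltr0_norm (_ : y - s < 0)) ?subr_lt0// ltr_norml => /andP[_ h1].
      by apply/negbTE; rewrite -ltNge; lra.
    move: h1; rewrite (ger0_norm (_ : 0 <= y - s)) ?subr_ge0// ltr_norml => /andP[h1 _].
    by lra.
  have [ty|ty] := ltrP t y.
    move: h2; rewrite (gtr0_norm (_ : 0 < y - t)) ?subr_gt0// ltr_norml => /andP[h2 _].
    by apply/negbTE; rewrite -ltNge; lra.
  move: h2; rewrite (ler0_norm (_ : y - t <= 0)) ?subr_le0// ltr_norml => /andP[_ h2].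
  by lra.
- exact: (integrable_norm integrable_kap0).
- by move=> n v; rewrite normrM ler_piMr// norm_ind; have /andP[] := ind01 s t (y + v / (be0 * n.+1%:R)).
Qed.

(** A domination uniform in [be]: near [s, t] by the L^1 norm of [kap 0], and at distance d >= 1
    because be / (1 + be^2 d^2) <= (2 / be0) / (1 + d^2). *)
Lemma window_bound be0 : 0 < be0 ->
  exists D, forall be y, be0 <= be -> `|window be y| <= D * (oneDsqr y)^-1.
Proof.
move=> be00; have [A A0 kd] := @kern_decay R.
pose k1 := \int[mu]_v `|kap 0 v|.
pose Y := `|s| + `|t| + 1.
pose C := 2 * A / be0 * (3 + 2 * (s ^+ 2 + t ^+ 2)).
have k10 : 0 <= k1 by exact: Rintegral_ge0.
have C0 : 0 <= C.
  rewrite mulr_ge0//; first by rewrite divr_ge0 ?mulr_ge0 ?(ltW A0) ?(ltW be00).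
  by rewrite addr_ge0// mulr_ge0// addr_ge0 ?sqr_ge0.
exists (k1 * (1 + Y ^+ 2) + C * (t - s)) => be y be0be.
have be_gt0 : 0 < be := lt_le_trans be00 be0be.
have V0 : 0 < (oneDsqr y)^-1 by rewrite invr_gt0 oneDsqr_gt0.
have ts0 : 0 <= t - s by rewrite subr_ge0 ltW.
have Y20 : 0 <= Y ^+ 2 by exact: sqr_ge0.
have [yin|yout] := boolP ((s - 1 <= y) && (y <= t + 1)).
  apply: (@le_trans _ _ k1).
    rewrite window_rescale//.
    apply: le_trans (le_normr_Rintegral measurableT (integrable_kap_ind be y)) _.
    apply: le_Rintegral => //.
    - exact: (integrable_norm (integrable_kap_ind be y)).
    - exact: (integrable_norm integrable_kap0).
    - by move=> v _; rewrite normrM ler_piMr// norm_ind; have /andP[] := ind01 s t (y + v / be).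
  apply: (@le_trans _ _ (k1 * (1 + Y ^+ 2) * (oneDsqr y)^-1)); last first.
    by rewrite ler_pM2r// lerDl mulr_ge0.
  rewrite ler_pdivlMr ?oneDsqr_gt0// ler_wpM2l// lerD2l.
  rewrite -(real_normK (num_real y)) lerXn2r ?nnegrE ?addr_ge0//.
  have [y1 y2] := andP yin; rewrite ler_norml /Y.
  have := ler_norm t; have := ler_norm (- s); rewrite normrN.
  have := normr_ge0 s; have := normr_ge0 t.
  by move=> *; apply/andP; split; lra.
have kb x : s <= x <= t -> `|kern be 0 (x - y)| <= C * (oneDsqr y)^-1.
  move=> sx; have := kd be 0%N (x - y) be_gt0; rewrite expr1n mulr1 expr1 => h.
  apply: le_trans h _.
  set d := x - y.
  have d1 : 1 <= d ^+ 2.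
    have [sx1 sx2] := andP sx; rewrite /d.
    by move: yout; rewrite negb_and -!ltNge => /orP[] ?; nra.
  have step1 : be * (oneDsqr (be * d))^-1 <= 2 / be0 * (oneDsqr d)^-1.
    rewrite ler_pdivrMr ?oneDsqr_gt0//.
    have -> : 2 / be0 * (oneDsqr d)^-1 * oneDsqr (be * d) =
        2 * oneDsqr (be * d) / (be0 * oneDsqr d).
      by field; rewrite !gt_eqF ?oneDsqr_gt0.
    rewrite ler_pdivlMr ?mulr_gt0 ?oneDsqr_gt0// /oneDsqr exprMn mulrA.
    have : be0 * be <= be ^+ 2 by rewrite expr2 ler_pM2r.
    have : 0 < be * be0 by rewrite mulr_gt0.
    set P := be * be0; have -> : be0 * be = P by rewrite mulrC.
    move=> P0 Pb.
    have h1 : P * d ^+ 2 <= be ^+ 2 * d ^+ 2 by rewrite ler_wpM2r// sqr_ge0.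
    have h2 : P <= P * d ^+ 2 by rewrite ler_peMr// ltW.
    by lra.
  have step2 : (oneDsqr d)^-1 <= (3 + 2 * (s ^+ 2 + t ^+ 2)) * (oneDsqr y)^-1.
    rewrite ler_pdivlMr ?oneDsqr_gt0// mulrC ler_pdivrMr ?oneDsqr_gt0//.
    have := oneDsqr_shift x y (@ltr01 R); rewrite mul1r expr1n divr1 => h.
    apply: le_trans h _; apply: ler_wpM2r; first exact/ltW/oneDsqr_gt0.
    by have := sq_le sx; lra.
  rewrite -mulrA; apply: le_trans (ler_wpM2l (ltW A0) step1) _.
  have -> : A * (2 / be0 * (oneDsqr d)^-1) = 2 * A / be0 * (oneDsqr d)^-1 by ring.
  rewrite /C -[leRHS]mulrA ler_wpM2l//.
  by rewrite divr_ge0 ?mulr_ge0 ?(ltW A0) ?(ltW be00).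
apply: (@le_trans _ _ (C * (oneDsqr y)^-1 * (t - s))); last first.
  rewrite mulrDl mulrAC lerDr; apply: mulr_ge0; last exact: ltW.
  by rewrite mulr_ge0// addr_ge0.
have muI : fine (mu `[s, t]) = t - s.
  by rewrite lebesgue_measure_itv/= lte_fin st.
have ic : intble (fun x => C * (oneDsqr y)^-1 * ind s t x).
  by apply: intbleZ; exact: integrable_ind.
have bd x : `|ind s t x * kern be 0 (x - y)| <= C * (oneDsqr y)^-1 * ind s t x.
  rewrite normrM norm_ind /ind; case: ifPn => [sx|_]; last by rewrite mul0r mulr0.
  by rewrite mul1r mulr1 kb.
have iw : intble (fun x => ind s t x * kern be 0 (x - y)).
  apply: intble_le bd ic; apply: measurable_funM; first exact: measurable_ind.
  apply: (measurableT_comp (measurable_kern be 0)); exact: measurable_funB.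
have -> : C * (oneDsqr y)^-1 * (t - s) = \int[mu]_x (C * (oneDsqr y)^-1 * ind s t x).
  rewrite RintegralZl//; last exact: integrable_ind.
  congr *%R; rewrite -muI -[fine _]mul1r.
  rewrite -[X in _ * fine X]/(lebesgue_measure `[s, t]%classic) -Rintegral_cst// -Rintegral_ind.
  by apply: eq_Rintegral => x _; rewrite mulr1.
apply: le_trans (le_normr_Rintegral measurableT iw) _.
by apply: le_Rintegral => //; exact: (integrable_norm iw).
Qed.

End Windowed.

(** The limit is taken after integration over [s, t], where dominated convergence applies to
    [window] while the sequence itself is constant by hypothesis. Intervals then determine both
    sides almost everywhere. *)
Theorem reproduction u be0 : tempered u -> 0 < be0 ->
  (forall be x, be0 <= be -> conv u be x = conv u be0 x) ->
  {ae mu, forall x, (\int[mu]_v kap 0 v) * u x = conv u be0 x}.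
Proof.
move=> tu be00 H; set c := \int[mu]_v kap 0 v.
suff : {ae mu, forall x, c * u x + - 1 * conv u be0 x = 0}.
  apply: filterS; first exact: (ae_filter_ringOfSetsType mu).
  by move=> x /eqP; rewrite mulN1r subr_eq0 => /eqP.
have [mu_ iu] := tu.
have ic s t : mu.-integrable `[s, t] (EFin \o conv u be0).
  by apply/integrable_ind_itv; have [ig _ _] := window_duality s t tu be00.
have mI s t : @measurable _ (measurableTypeR R) `[s, t] by exact: measurable_itv.
have iu' s t : mu.-integrable `[s, t] (EFin \o u) by exact: tempered_integrable_itv.
apply: ae_eq0_of_intervals => s t.
  have i1 : mu.-integrable `[s, t] (EFin \o (fun x => c * u x)).
    exact: (integrableZl (mI s t) c (iu' s t)).
  have i2 : mu.-integrable `[s, t] (EFin \o (fun x => - 1 * conv u be0 x)).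
    exact: (integrableZl (mI s t) (- 1) (ic s t)).
  exact: (integrableD (mI s t) i1 i2).
move=> st.
have i1 : mu.-integrable `[s, t] (EFin \o (fun x => c * u x)).
  exact: (integrableZl (mI s t) c (iu' s t)).
have i2 : mu.-integrable `[s, t] (EFin \o (fun x => - 1 * conv u be0 x)).
  exact: (integrableZl (mI s t) (- 1) (ic s t)).
rewrite RintegralD// RintegralZl// RintegralZl// mulN1r; apply/eqP; rewrite subr_eq0.
pose ben (n : nat) := be0 * n.+1%:R.
have ben0 n : be0 <= ben n by rewrite ler_peMr ?(ltW be00)// ler1n.
have benp n : 0 < ben n := lt_le_trans be00 (ben0 n).
have [D wD] := window_bound st be00.
have const n : \int[mu]_y (u y * window s t (ben n) y) = \int[mu]_(x in `[s, t]) conv u be0 x.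
  have [_ _ <-] := window_duality s t tu (benp n).
  by rewrite -Rintegral_ind; apply: eq_Rintegral => x _; rewrite H.
have lim : \int[mu]_y (u y * window s t (ben n) y) @[n --> \oo] -->
    \int[mu]_y (u y * (c * ind s t y)).
  apply: (@Rintegral_dct _ _ _ (fun y => D * `|u y * (oneDsqr y)^-1|)).
  - by move=> n; have [_ iw _] := window_duality s t tu (benp n); exact: intble_measurable iw.
  - apply: measurable_funM => //; apply: measurable_funM => //; exact: measurable_ind.
  - exists [set s; t]; split.
    + exact: measurableU.
    + apply: countable_lebesgue_measure0; apply: finite_set_countable.
      by rewrite finite_setU; split; exact: finite_set1.
    + move=> y /= Hy; apply: contrapT => /not_orP[/eqP ys /eqP yt]; apply: Hy.
      by apply: cvgM; [exact: cvg_cst|exact: window_cvg].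
  - by apply: intbleZ; exact: (integrable_norm iu).
  - move=> n y; rewrite !normrM mulrCA ler_wpM2l//.
    rewrite (@gtr0_norm _ (_^-1)) ?invr_gt0 ?oneDsqr_gt0//.
    exact: wD.
have : \int[mu]_(x in `[s, t]) conv u be0 x = \int[mu]_y (u y * (c * ind s t y)).
  have lim' : \int[mu]_y (u y * window s t (ben n) y) @[n --> \oo] -->
      \int[mu]_(x in `[s, t]) conv u be0 x.
    by apply: cvg_near_cst; apply: nearW => n; exact: const.
  exact: (cvg_unique _ lim' lim).
move=> ->; rewrite -RintegralZl// -Rintegral_ind.
by apply/eqP; apply: eq_Rintegral => y _; ring.
Qed.

End ReproductionFormula.

(** * Pointwise bound from a subset of positive measure *)

Section LocalBound.
Context {R : realType}.
Notation mu := (@lebesgue_measure R).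
Notation intble f := (mu.-integrable [set: R] (EFin \o f)).
Implicit Types (s t x y a be : R) (u : R -> R).

Lemma divided_differenceE (r : seq R) (g : R -> R) :
  divided_difference r g = \sum_(y <- r) (node_prod r y)^-1 * g y.
Proof. by apply: eq_bigr => y _; rewrite mulrC. Qed.

(** A divided difference is a finite combination of values, so it passes under the integral; its
    mean value form is then applied to the smooth kernel. *)
Lemma conv_sum (r : seq R) (k : R -> R) u be : 0 < be -> tempered u ->
  intble (fun w => u w * \sum_(y <- r) k y * kern be 0 (y - w)) /\
  \sum_(y <- r) k y * conv u be y =
  \int[mu]_w (u w * \sum_(y <- r) k y * kern be 0 (y - w)).
Proof.
move=> be0 tu; elim: r => [|z r [IHi IH]].
  have -> : (fun w => u w * \sum_(y <- [::]) k y * kern be 0 (y - w)) = (fun=> 0 * 0 : R).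
    by apply/funext => w; rewrite big_nil mulr0 mul0r.
  rewrite big_nil; split; first by rewrite mul0r; exact: integrable0.
  by rewrite /Rintegral mul0r integral0.
have iz : intble (fun w => k z * (u w * kern be 0 (z - w))).
  by apply: intbleZ; exact: tempered_kern.
have E w : u w * (\sum_(y <- z :: r) k y * kern be 0 (y - w)) =
    k z * (u w * kern be 0 (z - w)) + u w * \sum_(y <- r) k y * kern be 0 (y - w).
  by rewrite big_cons mulrDr mulrCA.
split; first by under [X in EFin \o X]eq_fun do rewrite E; exact: intbleD.
rewrite big_cons IH.
under [RHS]eq_Rintegral do rewrite E.
rewrite RintegralD//; congr +%R.
by rewrite RintegralZl//; exact: tempered_kern.
Qed.

Lemma oneDsqr_near be a x z y : `|x - z| <= a ->
  oneDsqr (be * (x - y)) <= 2 * (1 + (a * be) ^+ 2) * oneDsqr (be * (z - y)).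
Proof.
move=> xza.
have h1 : (x - z) ^+ 2 <= a ^+ 2.
  by rewrite -(real_normK (num_real (x - z))) lerXn2r ?nnegrE// (le_trans _ xza).
have h2 : (x - y) ^+ 2 <= 2 * (x - z) ^+ 2 + 2 * (z - y) ^+ 2.
  by have := sqr_ge0 ((x - z) - (z - y)); nra.
have h3 : (be * (x - y)) ^+ 2 <= 2 * (a * be) ^+ 2 + 2 * (be * (z - y)) ^+ 2.
  rewrite !exprMn; have := sqr_ge0 be; set B := be ^+ 2 => B0.
  have : B * (x - y) ^+ 2 <= B * (2 * a ^+ 2 + 2 * (z - y) ^+ 2).
    by apply: ler_wpM2l => //; lra.
  by lra.
have h4 : 0 <= (a * be) ^+ 2 * (be * (z - y)) ^+ 2 by rewrite mulr_ge0 ?sqr_ge0.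
have h5 := sqr_ge0 (a * be); have h6 := sqr_ge0 (be * (z - y)).
rewrite /oneDsqr; move: h3 h4 h5 h6; set p := (_ * _) ^+ 2; set q := (_ * _) ^+ 2.
set w := (_ * _) ^+ 2 => *; lra.
Qed.

(** Separated nodes of [S], m + 1 of them, together with [x] give a divided difference of order m +
    1. For the kernel it is a derivative at some z in [x, x + a], divided by (m + 1)!; moving the
    Poisson weight from z back to [x] costs 2 (1 + (a be)^2). *)
Lemma local_bound (A : R) u be a d x lam m (S : set R) :
  (forall be n t, 0 < be ->
     `|kern be n t| <= A * n.+1%:R ^+ 2 * be ^+ n.+1 * (oneDsqr (be * t))^-1) ->
  0 < be -> 0 <= a -> 0 < d -> tempered u -> measurable S ->
  (forall y, S y -> [/\ x <= y <= x + a, `|u y| <= lam &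
     (\int[mu]_v kap 0 v) * u y = conv u be y]) ->
  ((2 * d * m.+1%:R)%:E <= mu S)%E ->
  (\int[mu]_v kap 0 v) * u x = conv u be x ->
  `|u x| <= lam * ((2 * a / d) ^+ m / m`!%:R) +
    (\int[mu]_v kap 0 v)^-1 * (a ^+ m.+1 / m.+1`!%:R *
     (A * m.+2%:R ^+ 2 * be ^+ m.+2 * (2 * (1 + (a * be) ^+ 2)))) *
    \int[mu]_y (`|u y| * (oneDsqr (be * (x - y)))^-1).
Proof.
move=> kd be0 a0 d0 tu mS SP muS cux; set c := \int[mu]_v kap 0 v.
have c0 : 0 < c := Rintegral_kap_gt0.
(* The nodes have to differ from [x], and removing one point costs no measure. *)
have mS' : measurable (S `\ x) by apply: measurableD.
have muS' : ((2 * d * m.+1%:R)%:E <= mu (S `\ x))%E.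
  apply: le_trans muS _.
  have SU : S `<=` (S `\ x) `|` [set x].
    by move=> y Sy; have [->|/eqP yx] := eqVneq y x; [right|left].
  have mU : measurable ((S `\ x) `|` [set x]) by exact: measurableU.
  apply: le_trans (le_measure mu (mem_set mS) (mem_set mU) SU) _.
  apply: le_trans (measureU2 mu mS' (measurable_set1 x)) _.
  have mux : (mu [set x] <= 0)%E by rewrite lebesgue_measure_set1.
  by have := leeD2l (mu (S `\ x)) mux; rewrite adde0.
have lbS y : (S `\ x) y -> x <= y by move=> [/SP[/andP[]]].
have [y [yS gap]] := separated_points mS' d0 lbS muS'.
have := @interpolation_bound R (conv u be) m x y a d (c * lam) d0 a0.
set s := x :: map y (iota 0 m.+1) => IB.

have H1 i : (i <= m)%N -> [/\ `|x - y i| <= a, y i != x & `|conv u be (y i)| <= c * lam].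
  move=> im; have [Si yx] := yS i im; have [/andP[h1 h2] h3 h4] := SP _ Si; split.
  - by rewrite distrC ger0_norm ?subr_ge0// lerBlDl.
  - exact/eqP.
  - by rewrite -h4 normrM (gtr0_norm c0) ler_wpM2l// ltW.
have {}IB := IB H1 gap.
have us : uniq s.
  rewrite /s cons_uniq map_inj_in_uniq ?iota_uniq ?andbT.
    apply/negP => /mapP[k]; rewrite mem_iota add0n => im xyi.
    by have [_ yix _] := H1 k im; move: yix; rewrite -xyi eqxx.
  move=> i j; rewrite !mem_iota !add0n /= => im jm yij.
  have g i' j' : (i' < j')%N -> (j' < m.+1)%N -> y i' = y j' -> False.
    move=> ij jm' e; have := gap i' j' (ltnW ij) jm'; rewrite e subrr leNgt => /negP; apply.
    by rewrite mulr_gt0// ltr0n subn_gt0.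
  by case: (ltngtP i j) => // ij; [case: (g _ _ ij jm yij)|case: (g _ _ ij im (esym yij))].
have ss : size s = m.+2 by rewrite /s /= size_map size_iota.
have sb : {in s, forall w, x <= w <= x + a}.
  move=> w; rewrite inE => /orP[/eqP ->|/mapP[k]]; first by rewrite lexx lerDl.
  rewrite mem_iota add0n => im ->; have [Si _] := yS k im.
  by have [] := SP _ Si.
pose B := A * m.+2%:R ^+ 2 * be ^+ m.+2 * (2 * (1 + (a * be) ^+ 2)).
have ddb w : `|divided_difference s (fun z => kern be 0 (z - w))| <=
    B / m.+1`!%:R * (oneDsqr (be * (x - w)))^-1.
  have dk (k : nat) (z : R) : is_derive z 1 (fun z => kern be k (z - w)) (kern be k.+1 (z - w)).
    have dl : is_derive z 1 (fun z : R => z - w) 1.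
      rewrite (_ : (fun z => _) = (fun z => 1 * z + - w)); first exact: is_derive_affine.
      by apply/funext => v; rewrite mul1r.
    have /is_derive_eq := @is_derive_comp R (kern be k) _ z _ _ (is_derive_kern be k _) dl.
    by apply; rewrite mulr1.
  have [z /andP[z1 z2] ->] := divided_difference_mean dk us ss sb.
  have f0 : 0 < m.+1`!%:R :> R by rewrite ltr0n fact_gt0.
  rewrite normrM normfV (gtr0_norm f0) mulrAC; apply: ler_wpM2r.
    by rewrite invr_ge0 ltW.
  apply: le_trans (kd be m.+1 (z - w) be0) _.
  rewrite /B -[leRHS]mulrA; apply: ler_wpM2l.
    (* The sign of [A] is not among the hypotheses: nonnegativity of the constant is read off [kd]
       at the origin. *)
    have := le_trans (normr_ge0 _) (kd be m.+1 0 be0).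
    by rewrite pmulr_lge0// invr_gt0 oneDsqr_gt0.
  rewrite ler_pdivlMr ?oneDsqr_gt0// mulrC ler_pdivrMr ?oneDsqr_gt0//.
  by apply: oneDsqr_near; rewrite distrC ger0_norm ?subr_ge0// lerBlDl.
have [id dE] := conv_sum s (fun y => (node_prod s y)^-1) be0 tu.
have DDle : `|divided_difference s (conv u be)| <=
    B / m.+1`!%:R * \int[mu]_y (`|u y| * (oneDsqr (be * (x - y)))^-1).
  rewrite divided_differenceE dE.
  have ip := tempered_poisson x be0 (tempered_norm tu).
  apply: le_trans (le_normr_Rintegral measurableT id) _.
  rewrite -RintegralZl//; apply: le_Rintegral => //.
  - exact: (integrable_norm id).
  - exact: intbleZ.
  - move=> w _; rewrite normrM mulrCA ler_wpM2l//.
    by rewrite -(divided_differenceE s (fun z => kern be 0 (z - w))) ddb.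
have : c * `|u x| <= c * lam * ((2 * a / d) ^+ m / m`!%:R) + a ^+ m.+1 *
    (B / m.+1`!%:R * \int[mu]_y (`|u y| * (oneDsqr (be * (x - y)))^-1)).
  rewrite -{1}(gtr0_norm c0) -normrM cux; apply: le_trans IB _.
  by rewrite lerD2l ler_wpM2l// exprn_ge0.
rewrite -ler_pdivlMl// => /le_trans; apply.
rewrite le_eqVlt; apply/orP; left; apply/eqP; rewrite -/B.
by field; rewrite (gt_eqF c0) !gt_eqF// ltr0n fact_gt0.
Qed.

End LocalBound.

(** * Choice of the number of nodes *)

Section DegreeChoice.
Context {R : realType}.
Implicit Types (a b g A c T : R) (n m : nat).

Lemma pow_fact_le n : n.+1%:R ^+ n.+1 / n.+1`!%:R <= expR 1 ^+ n.+1 :> R.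
Proof.
have := expR_ge1Dxn n (ler0n R n.+1).
by rewrite -{2}[n.+1%:R]mulr1 expRM_natl; apply: le_trans; rewrite lerDr.
Qed.

Lemma truncn_succ_bounds (x : R) : 1 <= x ->
  exists m, [/\ x <= m.+1%:R & m.+2%:R <= x + 2].
Proof.
move=> x1; have x0 : 0 <= x := le_trans ler01 x1.
have /andP[h1 h2] := truncn_itv x0.
exists (Num.truncn x); split; first exact: ltW.
by rewrite -addn2 natrD lerD2r.
Qed.

(** With this spacing 2 a / d = 8 (m + 1) / g, and (m + 1)^(m + 1) / (m + 1)! <= e^(m + 1). One more
    factor 8 / g >= 1 evens out the exponents. *)
Lemma node_factor_le (a g : R) m : 0 < a -> 0 < g -> g <= 1 ->
  (2 * a / (g * a / (4 * m.+1%:R))) ^+ m / m`!%:R <= (8 * expR 1 / g) ^+ m.+1.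
Proof.
move=> a0 g0 g1; have n0 : 0 < m.+1%:R :> R by [].
have -> : 2 * a / (g * a / (4 * m.+1%:R)) = 8 / g * m.+1%:R.
  by field; rewrite !gt_eqF.
have f0 : 0 < m`!%:R :> R by rewrite ltr0n fact_gt0.
have -> : (8 / g * m.+1%:R) ^+ m / m`!%:R =
    (8 / g) ^+ m * (m.+1%:R ^+ m.+1 / m.+1`!%:R).
  rewrite exprMn factS natrM exprSr; field.
  by rewrite (gt_eqF f0) gt_eqF.
have -> : (8 * expR 1 / g) ^+ m.+1 = (8 / g) ^+ m.+1 * expR 1 ^+ m.+1.
  by rewrite -exprMn; congr (_ ^+ _); rewrite mulrAC.
have g8 : 1 <= 8 / g by rewrite ler_pdivlMr// mul1r (le_trans g1)// ler1n.
apply: ler_pM.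
- by rewrite exprn_ge0// (le_trans ler01).
- by rewrite divr_ge0// exprn_ge0.
- exact: ler_weXn2l.
- exact: pow_fact_le.
Qed.

(** Let T = a be, n = m + 1, w = A pi / c, q = 1 + 32 * 32 w and th = 2 e / N1. Since N1 T <= 2 n,
    T^n / n! <= (e T / n)^n <= th^n. The remaining factors are at most 32 n^4 <= 32 * 16^n, as n <=
    2^n. By the choice N1 = 32 e q one has 16 th = 1 / q <= 1, so the total is at most 32 w / q <= 1
    / 32. *)
Lemma remainder_small (A c a be : R) m N1 : 0 < A -> 0 < c -> 0 < a -> 0 < be ->
  N1 = 32 * expR 1 * (1 + 32 * (32 * (A * pi / c))) ->
  N1 * (1 + a * be / 2) <= m.+1%:R ->
  c^-1 * (a ^+ m.+1 / m.+1`!%:R *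
     (A * m.+2%:R ^+ 2 * be ^+ m.+1 * (2 * (1 + (a * be) ^+ 2)))) * pi <= 32^-1.
Proof.
move=> A0 c0 a0 be0 N1E nN.
set e := expR 1 : R in N1E *; have e1 : 1 <= e.
  by rewrite /e (le_trans _ (expR_ge1Dx 1))// lerDl.
have e0 : 0 < e := lt_le_trans ltr01 e1.
have pi0 := pi_gt0 R.
have Apc : 0 <= A * pi / c by rewrite divr_ge0 ?mulr_ge0 ?(ltW A0) ?(ltW pi0) ?(ltW c0).
set w := A * pi / c in N1E Apc *.
set q := 1 + 32 * (32 * w) in N1E.
have q1 : 1 <= q by rewrite /q; lra.
have q0 : 0 < q := lt_le_trans ltr01 q1.
have N10 : 0 < N1 by rewrite N1E mulr_gt0// mulr_gt0.
have N11 : 1 <= N1.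
  have eq1 : 1 <= e * q by rewrite mulr_ege1.
  by rewrite N1E -mulrA; move: eq1; set z := e * q => z1; lra.
set T := a * be in nN *; have T0 : 0 < T by rewrite mulr_gt0.
set n := m.+1%:R : R in nN *; have n0 : 0 < n by rewrite /n.
have n1 : 1 <= n by rewrite /n ler1n.
have nT : 1 + T / 2 <= n.
  by apply: le_trans nN; rewrite ler_peMl// addr_ge0// divr_ge0// ltW.
pose th := 2 * e / N1.
have th0 : 0 <= th by rewrite divr_ge0 ?mulr_ge0 ?(ltW e0) ?(ltW N10).
have Tth : e * T / n <= th.
  rewrite ler_pdivrMr// /th mulrAC ler_pdivlMr//.
  have : N1 * T <= 2 * n by move: nN N10; nra.
  by move=> h; have := ler_wpM2l (ltW e0) h; lra.
have th16 : 16 * th = q^-1.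
  by rewrite /th N1E; field; rewrite !gt_eqF.
have step1 : T ^+ m.+1 / m.+1`!%:R <= th ^+ m.+1.
  have nn0 : 0 < n ^+ m.+1 by rewrite exprn_gt0.
  have := ler_wpM2l (exprn_ge0 m.+1 (ltW T0)) (pow_fact_le m).
  rewrite -/n -/e => h.
  have -> : T ^+ m.+1 / m.+1`!%:R = T ^+ m.+1 * (n ^+ m.+1 / m.+1`!%:R) / n ^+ m.+1.
    by field; rewrite (gt_eqF nn0) gt_eqF// ltr0n fact_gt0.
  apply: (@le_trans _ _ ((e * T / n) ^+ m.+1)).
    have -> : (e * T / n) ^+ m.+1 = T ^+ m.+1 * e ^+ m.+1 / n ^+ m.+1.
      by rewrite -exprVn -!exprMn [e * T]mulrC.
    by rewrite ler_pM2r ?invr_gt0.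
  have h0 : 0 <= e * T / n.
    by apply: divr_ge0; [apply: mulr_ge0|]; apply: ltW.
  by apply: lerXn2r; rewrite ?nnegrE.
have step2 : m.+2%:R ^+ 2 * (2 * (1 + T ^+ 2)) <= 32 * n ^+ 4.
  have -> : m.+2%:R = n + 1 :> R by rewrite natr1.
  have h1 : (n + 1) ^+ 2 <= 4 * n ^+ 2 by nra.
  have h2 : 2 * (1 + T ^+ 2) <= 8 * n ^+ 2 by nra.
  have -> : 32 * n ^+ 4 = (4 * n ^+ 2) * (8 * n ^+ 2) by ring.
  apply: ler_pM => //; first exact: sqr_ge0.
  by rewrite mulr_ge0// addr_ge0// sqr_ge0.
have step3 : n ^+ 4 <= 16 ^+ m.+1.
  have -> : 16 ^+ m.+1 = (2 ^+ m.+1) ^+ 4 :> R by rewrite -exprM mulnC exprM; congr (_ ^+ _); ring.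
  apply: lerXn2r; rewrite ?nnegrE ?(ltW n0) ?exprn_ge0//.
  by rewrite /n -natrX ler_nat ltnW// ltn_expl.
have -> : c^-1 * (a ^+ m.+1 / m.+1`!%:R *
     (A * m.+2%:R ^+ 2 * be ^+ m.+1 * (2 * (1 + T ^+ 2)))) * pi =
   w * ((m.+2%:R ^+ 2 * (2 * (1 + T ^+ 2))) * (T ^+ m.+1 / m.+1`!%:R)).
  rewrite /w /T [(a * be) ^+ m.+1]exprMn.
  by move: (a ^+ m.+1) (be ^+ m.+1) (m.+2%:R ^+ 2) (m.+1`!%:R^-1) => *; ring.
have bound : (m.+2%:R ^+ 2 * (2 * (1 + T ^+ 2))) * (T ^+ m.+1 / m.+1`!%:R) <= 32 * q^-1.
  apply: (@le_trans _ _ (32 * 16 ^+ m.+1 * th ^+ m.+1)).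
    apply: ler_pM => //.
    - by rewrite mulr_ge0 ?sqr_ge0// mulr_ge0// addr_ge0// sqr_ge0.
    - by rewrite divr_ge0// exprn_ge0// (ltW T0).
    - by apply: le_trans step2 _; rewrite ler_wpM2l.
  rewrite -mulrA -exprMn th16 ler_wpM2l// exprS ler_piMr ?invr_ge0 ?(ltW q0)//.
  by rewrite exprn_ile1 ?invr_ge0 ?(ltW q0)// invf_le1.
apply: le_trans (ler_wpM2l Apc bound) _.
have -> : w * (32 * q^-1) = 32^-1 * ((32 * (32 * w)) / q).
  by field; rewrite !gt_eqF.
by rewrite ler_piMr// ler_pdivrMr// mul1r /q lerDr.
Qed.

End DegreeChoice.

(** * Integrated bound for real functions *)

Section PowerTools.
Context {R : realType}.
Notation mu := (@lebesgue_measure R).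
Notation intble f := (mu.-integrable [set: R] (EFin \o f)).
Implicit Types (s t x y be r : R) (u h k : R -> R).

Lemma le_powR r x y : 0 <= r -> 0 <= x -> x <= y -> x `^ r <= y `^ r.
Proof.
by move=> r0 x0 xy; apply: ge0_ler_powR => //; rewrite nnegrE// (le_trans x0).
Qed.

Lemma powRD_le r x y : 1 <= r -> 0 <= x -> 0 <= y ->
  (x + y) `^ r <= 2 `^ r * (x `^ r + y `^ r).
Proof.
move=> r1 x0 y0; have r0 : 0 <= r := le_trans ler01 r1.
wlog xy : x y x0 y0 / x <= y.
  move=> H; have [xy|/ltW yx] := leP x y; first exact: H.
  by rewrite addrC [x `^ r + _]addrC; exact: H.
apply: (@le_trans _ _ ((2 * y) `^ r)).
  by apply: le_powR; rewrite ?addr_ge0//; lra.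
by rewrite powRM// ler_wpM2l ?powR_ge0// lerDr powR_ge0.
Qed.

(** A Young inequality with lossy constants, by comparing [t] with [s]; it linearizes the power in
    [poisson_jensen]. *)
Lemma mul_powR_le r s t : 1 <= r -> 0 <= t -> 0 <= s ->
  t * s `^ (r - 1) <= s `^ r + t `^ r.
Proof.
move=> r1 t0 s0; have r0 : 0 < r := lt_le_trans ltr01 r1.
have r10 : 0 <= r - 1 by rewrite subr_ge0.
have [ts|/ltW st] := leP t s.
  apply: (@le_trans _ _ (s `^ r)); last by rewrite lerDl powR_ge0.
  by rewrite -[leRHS]mulr_powRB1// ler_wpM2r// powR_ge0.
apply: (@le_trans _ _ (t `^ r)); last by rewrite lerDr powR_ge0.
by rewrite -[leRHS]mulr_powRB1// ler_wpM2l//; exact: le_powR.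
Qed.

Lemma powR_ge1D r t : 1 <= r -> 0 <= t -> t <= 1 + t `^ r.
Proof.
move=> r1 t0; have [t1|/ltW t1] := leP t 1.
  by apply: le_trans t1 _; rewrite lerDl powR_ge0.
by apply: le_trans (le1r_powR t1 r1) _; rewrite lerDr.
Qed.

Lemma translate_integral k y : measurable_fun [set: R] k -> (forall t, 0 <= k t) ->
  (\int[mu]_x (k (x - y))%:E = \int[mu]_x (k x)%:E)%E.
Proof.
move=> mk k0; rewrite [RHS](ge0_integral_affine (- y) (@ltr01 R)).
- by rewrite mul1e; apply: eq_integral => x _; rewrite mul1r.
- exact/measurable_EFinP.
- by move=> x; rewrite lee_fin.
Qed.

Lemma tonelli_conv h k (M : R) : intble h -> (forall y, 0 <= h y) ->
  intble k -> (forall t, 0 <= k t <= M) ->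
  let g x := \int[mu]_y (h y * k (x - y)) in
  [/\ forall x, intble (fun y => h y * k (x - y)), intble g &
      \int[mu]_x g x = (\int[mu]_y h y) * (\int[mu]_t k t)].
Proof.
move=> ih h0 ik kM g.
have mh := intble_measurable ih; have mk := intble_measurable ik.
have k0 t : 0 <= k t by have /andP[] := kM t.
have ihk x : intble (fun y => h y * k (x - y)).
  apply: (@intble_le _ _ (fun y => M * h y)); last exact: intbleZ.
    by apply: measurable_funM => //; apply: (measurableT_comp mk); exact: measurable_funB.
  move=> y; rewrite normrM !ger0_norm// mulrC ler_wpM2r//.
  by have /andP[] := kM (x - y).
pose f (z : R * R) : \bar R := (h z.2 * k (z.1 - z.2))%:E.
have mf : measurable_fun [set: R * R] f.
  apply/measurable_EFinP; apply: measurable_funM; first exact: measurableT_comp.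
  by apply: (measurableT_comp mk); exact: measurable_funB.
have f0 z : (0 <= f z)%E by rewrite lee_fin mulr_ge0.
have gE x : (g x)%:E = (\int[mu]_y f (x, y))%E by rewrite -(intble_fin (ihk x)).
have kint : (\int[mu]_x (k x)%:E = (\int[mu]_x k x)%:E)%E by exact: intble_fin.
have E2 y : (\int[mu]_x f (x, y) = (h y * \int[mu]_t k t)%:E)%E.
  rewrite /f/=; under eq_integral do rewrite EFinM.
  rewrite ge0_integralZl//.
  - by rewrite translate_integral// kint EFinM.
  - apply/measurable_EFinP; apply: (measurableT_comp mk); exact: measurable_funB.
  - by move=> x _; rewrite lee_fin.
  - by rewrite lee_fin.
have intg : (\int[mu]_x (g x)%:E = ((\int[mu]_y h y) * (\int[mu]_t k t))%:E)%E.
  under eq_integral do rewrite gE.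
  rewrite (fubini_tonelli (m1 := mu) (m2 := mu) f mf f0).
  under eq_integral do rewrite E2.
  rewrite -RintegralZr// intble_fin//.
  have := intbleZ (\int[mu]_t k t) ih.
  by congr (mu.-integrable _ (_ \o _)); apply/funext => y; rewrite mulrC.
have mg : measurable_fun [set: R] g.
  apply/measurable_EFinP.
  have := measurable_fun_fubini_tonelli_F (m2 := mu) f mf f0.
  by congr measurable_fun; apply/funext => x; rewrite /= gE.
split => //; last by rewrite /Rintegral intg.
apply/integrableP; split; first exact/measurable_EFinP.
have g0 x : 0 <= g x by apply: Rintegral_ge0 => y _; rewrite mulr_ge0.
by under eq_integral do rewrite gee0_abs ?lee_fin//; rewrite intg ltry.
Qed.

(** The Poisson kernel without normalization: its mass is pi, see [pois_integral]. *)
Definition pois be t : R := be * (oneDsqr (be * t))^-1.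

Lemma pois_bound be t : 0 < be -> 0 <= pois be t <= be.
Proof.
move=> be0; rewrite /pois mulr_ge0 ?(ltW be0) ?invr_ge0 ?(ltW (oneDsqr_gt0 _))//=.
by rewrite ler_piMr ?(ltW be0)// invf_le1 ?oneDsqr_gt0// oneDsqr_ge1.
Qed.

Lemma pois_integral be : 0 < be -> intble (pois be) /\ \int[mu]_t pois be t = pi.
Proof.
move=> be0.
have [] := integral_affine 0 be0 (@integrable_oneDsqrV R).
have -> : (fun x : R => (EFin \o (fun x => (oneDsqr x)^-1)) (be * x + 0)) =
    EFin \o (fun x => (oneDsqr (be * x))^-1) by apply/funext => x; rewrite /= addr0.
move=> i1 i2; split; first exact: intbleZ.
rewrite RintegralZl// -[RHS](@Rintegral_oneDsqrV R) /Rintegral.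
transitivity (fine (be%:E * \int[mu]_x ((oneDsqr (be * x))^-1)%:E)).
  by rewrite fineM//; exact: (integrable_fin_num measurableT i1).
by rewrite [X in _ = fine X]i2; congr (fine (_ * _)); apply: eq_integral => x _; rewrite /= addr0.
Qed.

(** Jensen's inequality up to a factor 2^r: [mul_powR_le] is integrated against the kernel at the
    level s with s^r = (I + eta) / pi, which gives P <= 2 pi s. The positive [eta] keeps s nonzero
    when I vanishes. *)
Lemma poisson_jensen be u r x : 0 < be -> 1 <= r -> tempered u ->
  intble (fun y => `|u y| `^ r) ->
  (\int[mu]_y (`|u y| * pois be (x - y))) `^ r <=
  (2 * pi) `^ r / pi * \int[mu]_y (`|u y| `^ r * pois be (x - y)).
Proof.
move=> be0 r1 tu iU; have r0 : 0 < r := lt_le_trans ltr01 r1.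
have pi0 := pi_gt0 R.
have [ipo piE] := pois_integral be0.
have pp t : 0 <= pois be t by have /andP[] := pois_bound t be0.
have [iUw _ _] := tonelli_conv iU (fun y => powR_ge0 _ _) ipo (fun t => pois_bound t be0).
set P := \int[mu]_y _; set I := \int[mu]_y _.
have ipx : intble (fun y => pois be (x - y)).
  have [] := integral_affine (- x) (@ltr01 R) ipo.
  have -> : (fun y : R => (EFin \o pois be) (1 * y + - x)) = EFin \o (fun y => pois be (x - y)).
    apply/funext => y; rewrite /= mul1r /pois /oneDsqr.
    by rewrite -[x - y]opprB mulrN sqrrN.
  by [].
have pix : \int[mu]_y pois be (x - y) = pi.
  have [_] := integral_affine (- x) (@ltr01 R) ipo.
  rewrite mul1e -piE /Rintegral => ->; congr fine; apply: eq_integral => y _.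
  by rewrite /= mul1r /pois /oneDsqr -[x - y]opprB mulrN sqrrN.
have iP : intble (fun y => `|u y| * pois be (x - y)).
  have := intbleZ be (tempered_poisson x be0 (tempered_norm tu)).
  by congr (mu.-integrable _ (_ \o _)); apply/funext => y; rewrite mulrCA.
have I0 : 0 <= I by apply: Rintegral_ge0 => y _; rewrite mulr_ge0// powR_ge0.
have P0 : 0 <= P by apply: Rintegral_ge0 => y _; rewrite mulr_ge0.
have H (eta : R) : 0 < eta -> P `^ r <= (2 * pi) `^ r / pi * (I + eta).
  move=> eta0.
  have Ie : 0 < (I + eta) / pi by rewrite divr_gt0// ltr_wpDl.
  pose s := ((I + eta) / pi) `^ r^-1.
  have s0 : 0 < s by rewrite powR_gt0.
  have sr : s `^ r = (I + eta) / pi by rewrite /s -powRrM mulVf ?gt_eqF// powRr1// ltW.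
  have Ps : P * s `^ (r - 1) <= s `^ r * pi + I.
    have -> : P * s `^ (r - 1) = \int[mu]_y (s `^ (r - 1) * (`|u y| * pois be (x - y))).
      by rewrite RintegralZl// mulrC.
    have i3 := intbleZ (s `^ r) ipx.
    have -> : s `^ r * pi + I = \int[mu]_y (s `^ r * pois be (x - y) + `|u y| `^ r * pois be (x - y)).
      by rewrite RintegralD// RintegralZl// pix.
    apply: le_Rintegral => //.
    - exact: intbleZ.
    - exact: intbleD.
    - move=> y _; rewrite mulrA -mulrDl ler_wpM2r// mulrC.
      by apply: mul_powR_le => //; exact: ltW.
  have Ps2 : P * s `^ (r - 1) <= (2 * pi * s) * s `^ (r - 1).
    have -> : 2 * pi * s * s `^ (r - 1) = 2 * pi * s `^ r.
      by rewrite -mulrA mulr_powRB1// ltW.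
    apply: le_trans Ps _; rewrite sr.
    have -> : 2 * pi * ((I + eta) / pi) = 2 * (I + eta).
      by rewrite -mulrA [pi * _]mulrC divfK ?gt_eqF.
    by rewrite divfK ?gt_eqF//; lra.
  have {}Ps2 : P <= 2 * pi * s by rewrite -(ler_pM2r (powR_gt0 (r - 1) s0)).
  apply: le_trans (le_powR (ltW r0) P0 Ps2) _.
  rewrite powRM ?mulr_ge0 ?(ltW pi0) ?(ltW s0)// sr.
  by rewrite mulrA mulrAC.
apply/ler_addgt0Pr => e e0.
have C0 : 0 < (2 * pi) `^ r / pi by rewrite divr_gt0// powR_gt0// mulr_gt0.
have := H (e / ((2 * pi) `^ r / pi)) (divr_gt0 e0 C0).
by rewrite mulrDr [X in _ + X]mulrCA mulfV ?gt_eqF// mulr1.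
Qed.

Lemma tempered_power u r : 1 <= r -> measurable_fun [set: R] u ->
  intble (fun y => `|u y| `^ r) -> tempered u.
Proof.
move=> r1 msu iU; split => //.
apply: (@intble_le _ _ (fun y => (oneDsqr y)^-1 + `|u y| `^ r)).
- by apply: measurable_funM => //; exact: measurable_oneDsqrV.
- move=> y; have V0 : 0 < (oneDsqr y)^-1 by rewrite invr_gt0 oneDsqr_gt0.
  rewrite normrM (gtr0_norm V0).
  have := ler_wpM2r (ltW V0) (powR_ge1D r1 (normr_ge0 (u y))).
  move=> /le_trans; apply; rewrite mulrDl mul1r lerD2l ler_piMr ?powR_ge0//.
  exact: oneDsqrV_le1.
- by apply: intbleD => //; exact: integrable_oneDsqrV.
Qed.

Lemma tempered_bounded u (M : R) : measurable_fun [set: R] u ->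
  {ae mu, forall y, `|u y| <= M} -> tempered u.
Proof.
move=> msu uM; split => //.
apply/integrableP; split.
  by apply/measurable_EFinP; apply: measurable_funM => //; exact: measurable_oneDsqrV.
have iW := intbleZ `|M| (@integrable_oneDsqrV R).
apply: (@le_lt_trans _ _ (\int[mu]_y (`|M| * (oneDsqr y)^-1)%:E)%E).
  apply: ae_ge0_le_integral => //.
  - by apply: measurableT_comp => //; apply/measurable_EFinP; apply: measurable_funM => //;
      exact: measurable_oneDsqrV.
  - exact: (measurable_int mu iW).
  - move: uM; apply: filterS; first exact: (ae_filter_ringOfSetsType mu).
    move=> y uyM _; rewrite /= lee_fin normrM (@gtr0_norm _ (_^-1)) ?invr_gt0 ?oneDsqr_gt0//.
    apply: ler_wpM2r; first by rewrite invr_ge0 ltW// oneDsqr_gt0.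
    exact: le_trans uyM (ler_norm _).
by rewrite (intble_fin iW) ltry.
Qed.

End PowerTools.

(** * Absorption of the Poisson term *)

Section RealSampling.
Context {R : realType}.
Notation mu := (@lebesgue_measure R).
Notation intble f := (mu.-integrable [set: R] (EFin \o f)).
Implicit Types (a g A x y be r K lam M : R) (u : R -> R) (E Z : set R) (m : nat).

(* The Poisson average is an error term, small enough to be absorbed by the
   left-hand side once both sides are integrated over [x]. *)
Definition locally_controlled u be a g K E Z := forall x lam, ~ Z x -> 0 <= lam ->
  ((g * a / 2)%:E <= mu (E `&` `[x, (x + a)%R]%classic `&` [set y | (`|u y| <= lam)%R]))%E ->
  `|u x| <= K * lam + (32 * pi)^-1 * \int[mu]_y (`|u y| * pois be (x - y)).

Lemma absorb_small (s t w : R) :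
  0 <= s -> t <= 2 * s + w -> w <= 8^-1 * t -> t <= 4 * s.
Proof. lra. Qed.

Lemma measurable_sublevel u lam : measurable_fun [set: R] u ->
  measurable [set y | `|u y| <= lam].
Proof.
move=> msu.
have mn : measurable_fun [set: R] (fun y => `|u y|) by exact: measurableT_comp.
have := mn measurableT _ (@measurable_itv R `]-oo, lam]); rewrite setTI.
by congr measurable; apply/seteqP; split => y; rewrite /= in_itv.
Qed.

Lemma sampling_locally_controlled A (N1 : R) u be a g m E Z :
  0 < A -> (forall be n t, 0 < be ->
     `|kern be n t| <= A * n.+1%:R ^+ 2 * be ^+ n.+1 * (oneDsqr (be * t))^-1) ->
  N1 = 32 * expR 1 * (1 + 32 * (32 * (A * pi / (\int[mu]_v kap 0 v)))) ->
  N1 * (1 + a * be / 2) <= m.+1%:R ->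
  0 < be -> 0 < a -> 0 < g -> g <= 1 -> tempered u ->
  measurable E -> measurable Z -> mu Z = 0%E ->
  (forall y, ~ Z y -> (\int[mu]_v kap 0 v) * u y = conv u be y) ->
  locally_controlled u be a g ((8 * expR 1 / g) ^+ m.+1) E Z.
Proof.
move=> A0 kd N1E Nm be0 a0 g0 g1 tu mE mZ Z0 rep x lam Zx lam0 muS.
have c0 := @Rintegral_kap_gt0 R.
have pi0 := pi_gt0 R.
set c := \int[mu]_v kap 0 v in N1E rep c0.
set S0 := _ `&` _ in muS.
have mS0 : measurable S0.
  apply: measurableI; first exact: measurableI.
  by apply: measurable_sublevel; case: tu.
(* The m + 1 nodes then use 2 d (m + 1) = g a / 2 of measure, exactly what the hypothesis of
   [locally_controlled] grants. *)
pose d := g * a / (4 * m.+1%:R).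
have d0 : 0 < d by rewrite divr_gt0 ?mulr_gt0.
have mS : measurable (S0 `\` Z) by exact: measurableD.
have muS' : ((2 * d * m.+1%:R)%:E <= mu (S0 `\` Z))%E.
  have -> : 2 * d * m.+1%:R = g * a / 2.
    by rewrite /d; field; rewrite gt_eqF.
  apply: le_trans muS _.
  have SU : S0 `<=` (S0 `\` Z) `|` Z by move=> y Sy; have [?|?] := pselect (Z y); [right|left].
  have mU : measurable ((S0 `\` Z) `|` Z) by exact: measurableU.
  apply: le_trans (le_measure mu (mem_set mS0) (mem_set mU) SU) _.
  apply: le_trans (measureU2 mu mS mZ) _.
  have muZ : (mu Z <= 0)%E by rewrite Z0.
  by have := leeD2l (mu (S0 `\` Z)) muZ; rewrite adde0.
have SP y : (S0 `\` Z) y -> [/\ x <= y <= x + a, `|u y| <= lam & c * u y = conv u be y].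
  by move=> [[[_]]]; rewrite /= in_itv/= => xy uy Zy; split => //; exact: rep.
have := local_bound kd be0 (ltW a0) d0 tu mS SP muS' (rep x Zx).
move/le_trans; apply; apply: lerD.
  rewrite mulrC; apply: ler_wpM2r => //.
  exact: node_factor_le.
have tn := tempered_poisson x be0 (tempered_norm tu).
rewrite -/c; set Q := \int[mu]_y _; have Q0 : 0 <= Q.
  apply: Rintegral_ge0 => y _; rewrite mulr_ge0// invr_ge0 ltW//; exact: oneDsqr_gt0.
have -> : \int[mu]_y (`|u y| * pois be (x - y)) = be * Q.
  rewrite /Q -RintegralZl//; apply: eq_Rintegral => y _; exact: mulrCA.
rewrite [leRHS]mulrA; apply: ler_wpM2r => //.
have := remainder_small A0 c0 a0 be0 N1E Nm.
rewrite -ler_pdivlMr// -invfM => h.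
apply: le_trans (ler_wpM2r (ltW be0) h).
rewrite [be ^+ m.+2]exprSr !mulrA; rewrite le_eqVlt; apply/orP; left; apply/eqP.
by move: (a ^+ m.+1) (m.+1`!%:R^-1) (be ^+ m.+1) (c^-1) (m.+2%:R) => *; ring.
Qed.

(** On [E] the level [ME] is exceeded only on a null set, and a Poisson average of [|u|] is at most
    M pi, whence M / 32. The absorption waits for [Lp_sampling], where the two demodulated parts are
    combined. *)
Lemma sampling_Linfty u be a g K E Z M (ME : R) :
  0 < be -> 0 < a -> 0 < g -> 0 <= K -> measurable_fun [set: R] u ->
  measurable E -> measurable Z -> mu Z = 0%E ->
  (forall x, ((g * a)%:E <= mu (E `&` `[x, (x + a)%R]%classic))%E) ->
  locally_controlled u be a g K E Z ->
  {ae mu, forall y, `|u y| <= M} ->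
  {ae mu, forall y, E y -> `|u y| <= ME} -> 0 <= M -> 0 <= ME ->
  {ae mu, forall y, `|u y| <= K * ME + M / 32}.
Proof.
move=> be0 a0 g0 K0 msu mE mZ Z0 Ega lc uM [NE [mNE NE0 uNE]] M0 ME0.
have tu := tempered_bounded msu uM.
have pi0 := pi_gt0 R.
exists Z; split => // x /= nx; apply: contrapT => Zx; apply: nx.
apply: le_trans (lc x ME Zx ME0 _) _.
  set S := _ `&` _; have mS : measurable S.
    by apply: measurableI; [exact: measurableI|exact: measurable_sublevel].
  apply: (@le_trans _ _ (g * a)%:E).
    by rewrite lee_fin; have := mulr_gt0 g0 a0; lra.
  apply: le_trans (Ega x) _.
  have SU : E `&` `[x, (x + a)%R]%classic `<=` S `|` NE.
    move=> y [Ey xy]; have [uy|uy] := pselect (`|u y| <= ME); first by left.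
    by right; apply: uNE => /= /(_ Ey).
  have mU : measurable (S `|` NE) by exact: measurableU.
  have mD : measurable (E `&` `[x, (x + a)%R]%classic) by exact: measurableI.
  apply: le_trans (le_measure mu (mem_set mD) (mem_set mU) SU) _.
  apply: le_trans (measureU2 mu mS mNE) _.
  have muZ : (mu NE <= 0)%E by rewrite NE0.
  by have := leeD2l (mu S) muZ; rewrite adde0.
rewrite lerD2l.
have [ipo piE] := pois_integral be0.
have pp t : 0 <= pois be t by have /andP[] := pois_bound t be0.
have tn := tempered_poisson x be0 (tempered_norm tu).
have iP : intble (fun y => `|u y| * pois be (x - y)).
  have := intbleZ be tn.
  by congr (mu.-integrable _ (_ \o _)); apply/funext => y; rewrite mulrCA.
have [ipx pix] : intble (fun y => pois be (x - y)) /\ \int[mu]_y pois be (x - y) = pi.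
  have [h1 h2] := integral_affine (- x) (@ltr01 R) ipo.
  have E1 y : pois be (1 * y + - x) = pois be (x - y).
    by rewrite mul1r /pois /oneDsqr -[x - y]opprB mulrN sqrrN.
  split; first by move: h1; congr (mu.-integrable _ _); apply/funext => y; rewrite /= E1.
  rewrite mul1e in h2; rewrite -piE /Rintegral h2; congr fine.
  by apply: eq_integral => y _; rewrite /= E1.
have PM : \int[mu]_y (`|u y| * pois be (x - y)) <= M * pi.
  have iM := intbleZ M ipx.
  have EM : \int[mu]_y (M * pois be (x - y)) = M * pi by rewrite RintegralZl// pix.
  rewrite -EM -lee_fin -(intble_fin iP) -(intble_fin iM).
  apply: ae_ge0_le_integral => //.
  - by move=> y _; rewrite lee_fin mulr_ge0.
  - exact: (measurable_int mu iP).
  - by move=> y _; rewrite lee_fin mulr_ge0.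
  - exact: (measurable_int mu iM).
  - move: uM; apply: filterS; first exact: (ae_filter_ringOfSetsType mu).
    by move=> y uy _; rewrite lee_fin ler_wpM2r.
have -> : M / 32 = (32 * pi)^-1 * (M * pi).
  by move: (pi : R) pi0 => w w0; field; rewrite gt_eqF.
by rewrite ler_wpM2l// invr_ge0 mulr_ge0// ltW.
Qed.

(** With lam^r just above 2 / (g a) times the integral of |u|^r over the part of E in [x, x + a],
    Chebyshev leaves at most g a / 2 of measure above [lam]. After the power r and integration in x,
    the Poisson part is at most 1/8 of the left-hand side and can be subtracted because that side is
    finite. *)
Lemma sampling_Lr u be a g K E Z r :
  0 < be -> 0 < a -> 0 < g -> g <= 1 -> 0 <= K -> 1 <= r ->
  measurable_fun [set: R] u ->
  measurable E -> measurable Z -> mu Z = 0%E ->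
  (forall x, ((g * a)%:E <= mu (E `&` `[x, (x + a)%R]%classic))%E) ->
  locally_controlled u be a g K E Z ->
  intble (fun y => `|u y| `^ r) ->
  (\int[mu]_y (`|u y| `^ r)%:E <=
   ((8 * K / g) `^ r)%:E * \int[mu]_(y in E) (`|u y| `^ r)%:E)%E.
Proof.
move=> be0 a0 g0 g1 K0 r1 msu mE mZ Z0 Ega lc iU.
have r0 : 0 < r := lt_le_trans ltr01 r1.
have tu := tempered_power r1 msu iU.
have pi0 := pi_gt0 R.
pose U y := `|u y| `^ r; have U0 y : 0 <= U y by exact: powR_ge0.
pose V y := \1_E y * U y : R.
have V0 y : 0 <= V y by rewrite mulr_ge0.
have iV : intble V.
  apply: (@intble_le _ _ U) => //.
    by apply: measurable_funM; [exact: measurable_indic|exact: intble_measurable].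
  move=> y; rewrite ger0_norm// /V indicE; case: (y \in E); by rewrite ?mul1r ?mul0r.
have [ipo piE] := pois_integral be0.
(* [ind (- a) 0 (x - y)] selects y in [x, x + a], so the local integral is a convolution with a
   kernel of mass [a]. *)
have ibound t : 0 <= ind (- a) 0 t <= 1 by exact: ind01.
have iind : intble (ind (- a) 0) by exact: integrable_ind.
have indE : \int[mu]_t ind (- a) 0 t = a.
  have -> : \int[mu]_t ind (- a) 0 t = \int[mu]_(t in `[- a, 0]) 1.
    by rewrite -Rintegral_ind; apply: eq_Rintegral => t _; rewrite mulr1.
  have mua : mu `[- a, 0]%classic = a%:E.
    by rewrite lebesgue_measure_itv/= lte_fin oppr_lt0 a0 -EFinB sub0r opprK.
  rewrite /Rintegral integral_cst// mul1e.
  exact: (congr1 fine mua).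
have [iL1 iL EL] := tonelli_conv iV V0 iind ibound.
have [iQ1 iQ EQ] := tonelli_conv iU (fun y => powR_ge0 _ _) ipo (fun t => pois_bound t be0).
set G := fun x => \int[mu]_y (V y * ind (- a) 0 (x - y)) in iL EL.
set Q := fun x => \int[mu]_y (`|u y| `^ r * pois be (x - y)) in iQ EQ.
have G0 x : 0 <= G x by apply: Rintegral_ge0 => y _; rewrite mulr_ge0//; have /andP[] := ibound (x - y).
have Q0 x : 0 <= Q x.
  by apply: Rintegral_ge0 => y _; rewrite mulr_ge0 ?powR_ge0//; have /andP[] := pois_bound (x - y) be0.
have ga0 : 0 < g * a by rewrite mulr_gt0.
pose c1 := (2 * K) `^ r * (2 / (g * a)).
(* The base is 1/8 = 2 * (1 / (32 pi)) * (2 pi), with 2 from [powRD_le] and 2 pi from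
   [poisson_jensen]. *)
pose c2 := (8^-1) `^ r / pi.
have c10 : 0 <= c1 by rewrite mulr_ge0 ?powR_ge0// divr_ge0// ltW.
have c20 : 0 <= c2 by rewrite divr_ge0 ?powR_ge0// ltW.
have pt x : ~ Z x -> U x <= c1 * G x + c2 * Q x.
  move=> Zx.
  pose L := 2 / (g * a) * G x; have L0 : 0 <= L by rewrite mulr_ge0// divr_ge0// ltW.
  (* [eta] keeps the Chebyshev level positive when the local integral is 0. *)
  have H eta : 0 < eta -> U x <= (2 * K) `^ r * (L + eta) + c2 * Q x.
    move=> eta0; have v0 : 0 < L + eta by rewrite ltr_wpDl.
    pose lam := (L + eta) `^ r^-1.
    have lam0 : 0 <= lam by exact: powR_ge0.
    have lamr : lam `^ r = L + eta by rewrite /lam -powRrM mulVf ?gt_eqF// powRr1// ltW.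
    have muS : ((g * a / 2)%:E <= mu (E `&` `[x, (x + a)%R]%classic `&` [set y | (`|u y| <= lam)%R]))%E.
      set S := _ `&` _; have mS : measurable S.
        by apply: measurableI; [exact: measurableI|exact: measurable_sublevel].
      pose S' := [set: R] `&` [set y | ((L + eta)%:E <= `| (V y * ind (- a) 0 (x - y))%:E |)%E].
      have mG := measurable_int mu (iL1 x).
      have ch : ((L + eta)%:E * mu S' <= (G x)%:E)%E.
        have := le_integral_abse mu measurableT mG v0.
        move/le_trans; apply.
        have -> : ((G x)%:E = \int[mu]_y (V y * ind (- a) 0 (x - y))%:E)%E by rewrite intble_fin.
        rewrite le_eqVlt; apply/orP; left; apply/eqP; apply: eq_integral => y _.
        by rewrite /= ger0_norm// mulr_ge0//; have /andP[] := ibound (x - y).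
      have mS' : measurable S'.
        by apply: emeasurable_fun_c_infty => //; exact: measurableT_comp.
      have SU : E `&` `[x, (x + a)%R]%classic `<=` S `|` S'.
        move=> y [Ey xy]; have [uy|uy] := leP `|u y| lam; first by left.
        right; split => //=; rewrite lee_fin.
        have -> : ind (- a) 0 (x - y) = 1.
          move: xy; rewrite /= in_itv/= => /andP[h1 h2]; rewrite /ind ifT//.
          by rewrite subr_le0 h1 andbT lerBrDr addrC lerBlDr.
        rewrite mulr1 ger0_norm// /V indicE mem_set// mul1r -lamr.
        by apply: le_powR => //; exact: ltW.
      have mU : measurable (S `|` S') by exact: measurableU.
      have mD : measurable (E `&` `[x, (x + a)%R]%classic) by exact: measurableI.
      have h1 := le_trans (Ega x) (le_trans (le_measure mu (mem_set mD) (mem_set mU) SU)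
        (measureU2 mu mS mS')).
      have h2 : (mu S' <= (g * a / 2)%:E)%E.
        rewrite -(@lee_pmul2l _ (L + eta)%:E) ?lte_fin//.
        apply: le_trans ch _; rewrite -EFinM lee_fin.
        have -> : G x = L * (g * a / 2) by rewrite /L; field; rewrite !gt_eqF.
        apply: ler_wpM2r; first by rewrite divr_ge0// ltW.
        by rewrite lerDl ltW.
      have h3 := le_trans h1 (leeD2l (mu S) h2).
      rewrite -(@leeD2rE _ (g * a / 2)%:E)//; apply: le_trans h3.
      by rewrite -EFinD lee_fin -splitr.
    have := lc x lam Zx lam0 muS.
    set P := \int[mu]_y _.
    have P0 : 0 <= P.
      by apply: Rintegral_ge0 => y _; rewrite mulr_ge0//; have /andP[] := pois_bound (x - y) be0.
    move=> /(le_powR (ltW r0) (normr_ge0 _)); rewrite -/(U x) => /le_trans; apply.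
    have d0 : 0 <= (32 * pi)^-1 :> R by rewrite invr_ge0 mulr_ge0// ltW.
    apply: le_trans (powRD_le r1 (mulr_ge0 K0 lam0) (mulr_ge0 d0 P0)) _.
    rewrite mulrDr; apply: lerD.
      by rewrite [(K * lam) `^ r]powRM// lamr mulrA -powRM.
    rewrite powRM// mulrA -powRM//.
    apply: le_trans (ler_wpM2l (powR_ge0 _ _) (poisson_jensen x be0 r1 tu iU)) _.
    rewrite !mulrA -powRM ?mulr_ge0// ?(ltW pi0)//; rewrite le_eqVlt; apply/orP; left; apply/eqP; congr (_ `^ r / _ * _).
    by move: (pi : R) pi0 => w w0; field; rewrite gt_eqF.
  apply/ler_addgt0Pr => e e0.
  (* The added 1 avoids a division by 0 when K = 0. *)
  have K20 : 0 < (2 * K) `^ r + 1 by rewrite ltr_wpDl// powR_ge0.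
  have := H (e / ((2 * K) `^ r + 1)) (divr_gt0 e0 K20).
  move/le_trans; apply.
  rewrite mulrDr /L /c1 mulrA addrAC lerD2l mulrCA ler_piMr ?(ltW e0)//.
  by rewrite ler_pdivrMr// mul1r lerDl.
have iR : intble (fun x => c1 * G x + c2 * Q x) by apply: intbleD; exact: intbleZ.
have hint : \int[mu]_x U x <= c1 * (\int[mu]_y V y * a) + c2 * (\int[mu]_y U y * pi).
  rewrite -{1}indE -{1}piE -EL -EQ -RintegralZl// -RintegralZl// -RintegralD//; last 2 first.
  - exact: intbleZ.
  - exact: intbleZ.
  rewrite -lee_fin -(intble_fin iU) -(intble_fin iR).
  apply: ae_ge0_le_integral => //.
  - exact: (measurable_int mu iU).
  - by move=> y _; rewrite lee_fin addr_ge0// mulr_ge0.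
  - exact: (measurable_int mu iR).
  - exists Z; split => // x /= nx; apply: contrapT => Zx; apply: nx => _.
    by rewrite lee_fin; exact: pt.
have EV : (\int[mu]_(y in E) (`|u y| `^ r)%:E = (\int[mu]_y V y)%:E)%E.
  rewrite -(intble_fin iV) integral_mkcond; apply: eq_integral => y _.
  by rewrite patchE /V indicE; case: (y \in E); rewrite ?mul1r ?mul0r.
rewrite EV -/U (intble_fin iU) -EFinM lee_fin.
set IU := \int[mu]_y U y in hint *; set IV := \int[mu]_y V y in hint *.
have IU0 : 0 <= IU by apply: Rintegral_ge0.
have IV0 : 0 <= IV by apply: Rintegral_ge0.
have c2E : c2 * (IU * pi) <= 8^-1 * IU.
  have -> : c2 * (IU * pi) = 8^-1 `^ r * IU by rewrite /c2; move: (_ `^ _) (pi : R) pi0 => z w w0; field; rewrite gt_eqF.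
  by apply: ler_wpM2r => //; rewrite ge1r_powR// invr_gt0 invf_le1 ?ler1n ?ltr0n.
have c1E : c1 * (IV * a) = 2 / g * (2 * K) `^ r * IV.
  by rewrite /c1; field; rewrite !gt_eqF.
have h4 : IU <= 4 / g * ((2 * K) `^ r * IV).
  have X0 : 0 <= (2 * K) `^ r * IV / g by rewrite divr_ge0 ?mulr_ge0 ?powR_ge0// ltW.
  have c1E' : c1 * (IV * a) = 2 * ((2 * K) `^ r * IV / g) by rewrite c1E; field; rewrite gt_eqF.
  have -> : 4 / g * ((2 * K) `^ r * IV) = 4 * ((2 * K) `^ r * IV / g) by field; rewrite gt_eqF.
  by apply: absorb_small X0 _ c2E; rewrite -c1E'.
apply: le_trans h4 _.
(* Being at least 1, the factor 4 / g may be raised to the power r, so that a later r-th root leaves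
   a constant free of r. *)
have g4 : 1 <= 4 / g by rewrite ler_pdivlMr// mul1r (le_trans g1)// ler1n.
have -> : 8 * K / g = (4 / g) * (2 * K) by field; rewrite gt_eqF.
rewrite [(4 / g * _) `^ r]powRM ?mulr_ge0 ?invr_ge0 ?(ltW g0)// -[leRHS]mulrA ler_wpM2r ?mulr_ge0 ?powR_ge0//.
exact: le1r_powR.
Qed.
End RealSampling.

(** * Spectral gap and distributions *)

Section FourierPairing.
Context {R : realType}.
Notation mu := (@lebesgue_measure R).
Notation intble f := (mu.-integrable [set: R] (EFin \o f)).
Implicit Types (p q u v phi : R -> R) (s t x y z al b be L : R).

Lemma cosint_decay p al L : 0 <= L -> smoothR p -> supp_in L p ->
  exists C, forall t, `|cosint p al t| <= C * (oneDsqr t)^-1.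
Proof.
move=> L0 sp zp; pose p1 := derive1 p; pose p2 := derive1 p1.
have sp1 : smoothR p1 := smoothR_derive sp.
have d0 x : is_derive x 1 p (p1 x) := smoothR_is_derive x sp.
have d1 x : is_derive x 1 p1 (p2 x) := smoothR_is_derive x sp1.
have k0 := smoothR_continuous sp.
have k1 : continuous p1 := smoothR_continuous sp1.
have k2 : continuous p2 := smoothR_continuous (smoothR_derive sp1).
have z1 : supp_in L p1 := supp_in_derive zp d0.
have z2 : supp_in L p2 := supp_in_derive z1 d1.
have [M0 M00 B0] := continuous_supp_bounded L0 k0 zp.
have [M2 M20 B2] := continuous_supp_bounded L0 k2 z2.
exists (2 * L * M0 + 2 * L * M2) => t.
rewrite ler_pdivlMr ?oneDsqr_gt0//.
have h0 := norm_cosint_le al t L0 k0 zp B0.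
have := norm_cosint_le (al + pi / 2 + pi / 2) t L0 k2 z2 B2.
rewrite -(cosint_by_parts (al + pi / 2) t L0 d1 k2 z1) -(cosint_by_parts al t L0 d0 k1 zp).
rewrite mulrA normrM -expr2 (ger0_norm (sqr_ge0 t)) => h2.
by rewrite /oneDsqr mulrDr mulr1 [_ * t ^+ 2]mulrC; exact: lerD.
Qed.

Lemma cosintD L p q al t : continuous p -> continuous q -> supp_in L p -> supp_in L q ->
  cosint (fun x => p x + q x) al t = cosint p al t + cosint q al t.
Proof.
move=> cp cq zp zq; rewrite /cosint -RintegralD//; last 2 first.
- exact: cosint_integrable cp zp.
- exact: cosint_integrable cq zq.
by apply: eq_Rintegral => x _; rewrite mulrDl.
Qed.

(* Real and imaginary parts of the Fourier transform of [p + i q]; the phase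
   [- pi / 2] turns cosines into sines. *)
Definition fourier_re p q y : R := cosint p 0 y + cosint q (- (pi / 2)) y.
Definition fourier_im p q y : R := cosint q 0 y - cosint p (- (pi / 2)) y.

(* Real part of the pairing of [(u + i v)^] with [p + i q]. *)
Definition pairing u v p q : R :=
  \int[mu]_y (u y * fourier_re p q y - v y * fourier_im p q y).

Definition supported s t p q := [/\ smoothR p, smoothR q &
  forall x, ~~ (s <= x <= t) -> p x = 0 /\ q x = 0].

Lemma supported_sub s t s' t' p q : s' <= s -> t <= t' ->
  supported s t p q -> supported s' t' p q.
Proof.
move=> ss tt [sp sq z]; split => // x nx; apply: z; apply: contra nx => /andP[h1 h2].
by rewrite (le_trans ss h1) (le_trans h2 tt).
Qed.

Lemma supportedP s t p q : supported s t p q ->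
  [/\ smoothR p, smoothR q, supp_in (`|s| + `|t|) p & supp_in (`|s| + `|t|) q].
Proof.
move=> [sp sq z]; have z' x : `|s| + `|t| < `|x| -> p x = 0 /\ q x = 0.
  move=> xL; apply: z; apply/negP => /andP[h1 h2]; move: xL; apply/negP; rewrite -leNgt.
  rewrite ler_norml opprD; apply/andP; split.
    rewrite (le_trans _ h1)// -lerBrDr opprK addrC.
    have := ler_norm (- s); rewrite normrN; have := normr_ge0 t; lra.
  by rewrite (le_trans h2)// (le_trans (ler_norm t))// lerDr.
by split => // x /z'[].
Qed.

Lemma supportedM s t s' t' p q (chi : R -> R) : smoothR chi -> supported s t p q ->
  (forall x, s <= x <= t -> ~~ (s' <= x <= t') -> chi x = 0) ->
  supported s' t' (fun x => p x * chi x) (fun x => q x * chi x).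
Proof.
move=> sc [sp sq z] zc; split; [exact: smoothRM|exact: smoothRM|move=> x nx].
have [xst|xst] := boolP (s <= x <= t); first by rewrite zc// !mulr0.
by have [-> ->] := z x xst; rewrite !mul0r.
Qed.

(** A supremum argument in place of a finite cover. Let z be the supremum of the right ends up to
    which [G] vanishes. A smooth step splits a function on [s, min t (z + r)] into a piece supported
    in [s, e], with e close to z, and a piece near z. So the right end passes z, unless t is already
    reached. *)
Lemma local_vanishing (G : (R -> R) -> (R -> R) -> R) s t :
  (forall s t p1 q1 p2 q2, supported s t p1 q1 -> supported s t p2 q2 ->
     G (fun x => p1 x + p2 x) (fun x => q1 x + q2 x) = G p1 q1 + G p2 q2) ->
  (forall z, s <= z <= t -> exists2 r, 0 < r &
     forall p q, supported (z - r) (z + r) p q -> G p q = 0) ->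
  s <= t -> forall p q, supported s t p q -> G p q = 0.
Proof.
move=> GD loc st.
pose S := [set z | s <= z <= t /\ forall p q, supported s z p q -> G p q = 0].
have Ss : S s.
  split; first by rewrite lexx.
  have [r r0 H] := loc s (introT andP (conj (lexx s) st)).
  by move=> p q spq; apply: H; apply: supported_sub spq; [rewrite gerBl ltW|rewrite lerDl ltW].
have Sub : has_ubound S by exists t => z [/andP[]].
have hS : has_sup S by split => //; exists s.
pose z := sup S.
have sz : s <= z by exact: ub_le_sup.
have zt : z <= t by apply: ge_sup; [exists s|move=> w [/andP[]]].
have [r r0 H] := loc z (introT andP (conj sz zt)).
have [e [/andP[se et] He] ze] := sup_adherent r0 hS; rewrite -/z in ze.
have ez : e <= z by apply: ub_le_sup => //; split => //; rewrite se.
pose t' := Num.min t (z + r).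
have St' : S t'.
  split.
    by rewrite /t' le_min st ge_min lexx/= andbT (le_trans sz)// lerDl ltW.
  move=> p q spq.
  have k0 : 0 < e - (z - r) by rewrite subr_gt0.
  (* [chi] climbs from 0 at z - r to 1 at e. *)
  pose chi x := smooth_step ((e - (z - r))^-1 * x + (- (z - r) * (e - (z - r))^-1)) : R.
  have chiE x : chi x = smooth_step ((x - (z - r)) / (e - (z - r))).
    by rewrite /chi [_^-1 * x]mulrC -mulrDl.
  have schi : smoothR chi by exact: smoothR_affine smooth_step_smooth.
  have schi' : smoothR (fun x => 1 + (- 1) * chi x).
    have s1 := smoothRM (@smoothR_cst R (- 1)) schi.
    exact: (smoothRD (@smoothR_cst R 1) s1).
  have S1 : supported s e (fun x => p x * (1 + (- 1) * chi x)) (fun x => q x * (1 + (- 1) * chi x)).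
    apply: supportedM schi' spq _ => x /andP[sx xt']; rewrite sx/= -ltNge => ex.
    rewrite chiE smooth_step_ge1 ?mulr1 ?subrr//.
    by rewrite ler_pdivlMr// mul1r lerD2r ltW.
  have S2 : supported (z - r) (z + r) (fun x => p x * chi x) (fun x => q x * chi x).
    apply: supportedM schi spq _ => x /andP[sx]; rewrite le_min => /andP[_ xz].
    rewrite xz andbT -ltNge => xr; rewrite chiE smooth_step_le0//.
    by rewrite pmulr_lle0 ?invr_gt0// subr_le0 ltW.
  have eqf f : f = (fun x => f x * (1 + (- 1) * chi x) + f x * chi x).
    by apply/funext => x; rewrite -mulrDr mulN1r subrK mulr1.
  rewrite (eqf p) (eqf q) (GD (Num.min s (z - r)) (z + r)).
  - by rewrite He// H// addr0.
  - by apply: supported_sub S1; rewrite ?ge_min ?lexx// (le_trans ez)// lerDl ltW.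
  - by apply: supported_sub S2; rewrite ?ge_min ?lexx ?orbT.
have t'z : t' <= z by exact: ub_le_sup.
have tt' : t' = t.
  move: t'z; rewrite /t'; case: (leP t (z + r)) => // _.
  by rewrite gerDl leNgt r0.
by move: St'; rewrite tt' => -[].
Qed.

Section Tempered.
Context u v (tu : tempered u) (tv : tempered v).

Let bounded_pairing (h : R -> R) C w : tempered w -> continuous h ->
  (forall t, `|h t| <= C * (oneDsqr t)^-1) -> intble (fun y => w y * h y).
Proof.
move=> tw ch hC; have [mw _] := tw.
apply: (@intble_le _ _ (fun y => C * (`|w y| * (oneDsqr y)^-1))).
- by apply: measurable_funM => //; exact: continuous_measurable_fun.
- by move=> y; rewrite normrM mulrCA ler_wpM2l.
- by apply: intbleZ; exact: (tempered_norm tw).2.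
Qed.

Let cosint_pairing w p al L : tempered w -> 0 <= L -> smoothR p -> supp_in L p ->
  intble (fun y => w y * cosint p al y).
Proof.
move=> tw L0 sp zp; have [C HC] := cosint_decay al L0 sp zp.
apply: bounded_pairing tw _ HC.
exact: continuous_cosint (smoothR_continuous sp) zp.
Qed.

Lemma pairing_integrable s t p q : supported s t p q ->
  intble (fun y => u y * fourier_re p q y - v y * fourier_im p q y).
Proof.
move=> /supportedP[sp sq zp zq]; have L0 : 0 <= `|s| + `|t| by rewrite addr_ge0.
have i1 := intbleD (cosint_pairing 0 tu L0 sp zp) (cosint_pairing (- (pi / 2)) tu L0 sq zq).
have i2 := intbleD (cosint_pairing 0 tv L0 sq zq)
  (intbleZ (- 1) (cosint_pairing (- (pi / 2)) tv L0 sp zp)).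
have := intbleD i1 (intbleZ (- 1) i2).
congr (mu.-integrable _ (_ \o _)); apply/funext => y.
by rewrite /fourier_re /fourier_im; ring.
Qed.

Lemma pairingD s t p1 q1 p2 q2 : supported s t p1 q1 -> supported s t p2 q2 ->
  pairing u v (fun x => p1 x + p2 x) (fun x => q1 x + q2 x) =
  pairing u v p1 q1 + pairing u v p2 q2.
Proof.
move=> S1 S2; rewrite /pairing -RintegralD//; last 2 first.
- exact: pairing_integrable S1.
- exact: pairing_integrable S2.
have [/smoothR_continuous cp1 /smoothR_continuous cq1 zp1 zq1] := supportedP S1.
have [/smoothR_continuous cp2 /smoothR_continuous cq2 zp2 zq2] := supportedP S2.
apply: eq_Rintegral => y _; rewrite /fourier_re /fourier_im.
rewrite (cosintD 0 y cp1 cp2 zp1 zp2) (cosintD _ y cp1 cp2 zp1 zp2).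
rewrite (cosintD 0 y cq1 cq2 zq1 zq2) (cosintD _ y cq1 cq2 zq1 zq2).
by ring.
Qed.

End Tempered.

(** Averaging the integral with its image under x -> - x cancels the sine part, and the phase
    factors out. *)
Lemma cosint_even L p al t : continuous p -> supp_in L p -> (forall x, p (- x) = p x) ->
  cosint p al t = cos al * cosint p 0 t.
Proof.
move=> cp zp ep.
have i1 := cosint_integrable al t cp zp; have i2 := cosint_integrable al (- t) cp zp.
have E : cosint p al t = cosint p al (- t).
  rewrite /cosint /Rintegral integral_reflect; last exact: (measurable_int mu i1).
  by congr fine; apply: eq_integral => x _; rewrite ep mulrN mulNr.
apply: (mulfI (_ : (2 : R) != 0)); first by [].
have -> : 2 * cosint p al t = cosint p al t + cosint p al (- t) by rewrite -E; ring.
rewrite /cosint -RintegralD// -RintegralZl//; last exact: cosint_integrable cp zp.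
rewrite -RintegralZl//; last by apply: intbleZ; exact: cosint_integrable cp zp.
by apply: eq_Rintegral => x _; rewrite addr0 mulNr !cosD cosN sinN; ring.
Qed.

Lemma cosint_cutoff be t : 0 < be ->
  cosint (fun x => cutoff (be^-1 * x)) 0 t = kern be 0 t.
Proof.
move=> be0; rewrite /kern expr1 /kap /cosint.
have sc : smoothR (fun x => cutoff (be^-1 * x)).
  have := @smoothR_affine R be^-1 0 _ cutoff_smooth.
  by congr smoothR; apply/funext => x; rewrite addr0.
have zc : supp_in be (fun x => cutoff (be^-1 * x)).
  move=> x xb; apply: cutoff0; rewrite normrM gtr0_norm ?invr_gt0//.
  by rewrite ler_pdivlMl// mulr1 ltW.
have i1 := cosint_integrable 0 t (smoothR_continuous sc) zc.
have [i2 E] := integral_affine 0 be0 i1.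
rewrite /Rintegral E fineM//; last exact: (integrable_fin_num measurableT i2).
congr (_ * fine _); apply: eq_integral => x _ /=.
by rewrite !addr0 mul0r addr0 expr0 mulr1 mulKf ?gt_eqF// mulrCA mulrA.
Qed.

End FourierPairing.

(** * Test functions in the spectral gap *)

Section SpectralGap.
Context {R : realType}.
Notation mu := (@lebesgue_measure R).
Notation intble f := (mu.-integrable [set: R] (EFin \o f)).
Implicit Types (p q u v : R -> R) (s t x y z al b be L : R).

(* [Re ((u + i v)(y) e ^ (- i (x0 y - al)))]; [al = 0] and [al = pi / 2] give
   the real part and minus the imaginary part of the demodulated function. *)
Definition demodulate u v x0 al y : R :=
  u y * cos (x0 * y - al) + v y * sin (x0 * y - al).

(** For be >= 4 b it vanishes on [-2 b, 2 b], as the cutoff is 1 up to half of its radius, while the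
    demodulated spectrum lies in [-b, b]. Its transform is the difference of two kernels. *)
Definition bump_gap b be t : R := cutoff (be^-1 * t) - cutoff ((4 * b)^-1 * t).

Let bump_gap_smooth b be : smoothR (bump_gap b be).
Proof.
have s1 := @smoothR_affine R be^-1 0 _ cutoff_smooth.
have s2 := @smoothR_affine R (4 * b)^-1 0 _ cutoff_smooth.
have := smoothRD s1 (smoothRM (@smoothR_cst R (- 1)) s2).
by congr smoothR; apply/funext => x; rewrite !addr0 mulN1r.
Qed.

Let bump_gapN b be t : bump_gap b be (- t) = bump_gap b be t.
Proof. by rewrite /bump_gap !mulrN !cutoffN. Qed.

Let bump_gap0 b be t : 0 < b -> 4 * b <= be -> `|t| <= 2 * b -> bump_gap b be t = 0.
Proof.
move=> b0 bbe tb; have b40 : 0 < 4 * b by rewrite mulr_gt0.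
have be0 : 0 < be := lt_le_trans b40 bbe.
rewrite /bump_gap !cutoff1 ?subrr// normrM gtr0_norm ?invr_gt0//.
  by rewrite ler_pdivrMl//; move: tb; lra.
by rewrite ler_pdivrMl//; move: tb bbe; lra.
Qed.

Let bump_gap_supp b be : 0 < b -> 4 * b <= be -> supp_in be (bump_gap b be).
Proof.
move=> b0 bbe t tb; have b40 : 0 < 4 * b by rewrite mulr_gt0.
have be0 : 0 < be := lt_le_trans b40 bbe.
rewrite /bump_gap !cutoff0 ?subrr// normrM gtr0_norm ?invr_gt0// ler_pdivlMl// mulr1 ltW//.
exact: le_lt_trans tb.
Qed.

Lemma cosint_bump_gap b be al t : 0 < b -> 4 * b <= be ->
  cosint (bump_gap b be) al t = cos al * (kern be 0 t - kern (4 * b) 0 t).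
Proof.
move=> b0 bbe; have b40 : 0 < 4 * b by rewrite mulr_gt0.
have be0 : 0 < be := lt_le_trans b40 bbe.
rewrite (cosint_even al t (smoothR_continuous (@bump_gap_smooth b be)) (bump_gap_supp b0 bbe))//.
congr (_ * _); rewrite -(cosint_cutoff t be0) -(cosint_cutoff t b40).
have sc r : smoothR (fun x => cutoff (r^-1 * x)).
  have := @smoothR_affine R r^-1 0 _ cutoff_smooth.
  by congr smoothR; apply/funext => x; rewrite addr0.
have zc (r : R) : 0 < r -> supp_in r (fun x => cutoff (r^-1 * x)).
  move=> r0 x xb; apply: cutoff0; rewrite normrM gtr0_norm ?invr_gt0//.
  by rewrite ler_pdivlMl// mulr1 ltW.
rewrite /cosint -RintegralB//; last 2 first.
- exact: cosint_integrable (smoothR_continuous (sc be)) (zc be be0).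
- exact: cosint_integrable (smoothR_continuous (sc (4 * b))) (zc _ b40).
by apply: eq_Rintegral => x _; rewrite mulrBl.
Qed.

(** For [h] the cosine and the sine these are the two parts of exp (i (x s + al - x x0)) times the
    gap function centred at x0. The Fourier transform at y is exp (- i (x0 y - al)) times the
    difference of kernels at x - y, so that pairing with it demodulates. *)
Definition modulated b be x x0 al (h : R -> R) s : R :=
  h (x * s + (al - x * x0)) * bump_gap b be (s - x0).

Let cosint_translate (phi psi : R -> R) L x0 al t : continuous phi -> supp_in L phi ->
  (forall s, psi s = phi (s - x0) * cos (t * s + al)) ->
  intble psi /\ \int[mu]_s psi s = cosint phi (al + t * x0) t.
Proof.
move=> cphi zphi E.
have i1 := cosint_integrable (al + t * x0) t cphi zphi.
have [i2 h] := integral_affine (- x0) (@ltr01 R) i1.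
have E2 s : psi s = phi (1 * s + - x0) * cos (t * (1 * s + - x0) + (al + t * x0)).
  by rewrite E mul1r; congr (_ * cos _); ring.
split; first by move: i2; congr (mu.-integrable _ _); apply/funext => s; rewrite /= E2.
by rewrite /cosint /Rintegral h mul1e; congr fine; apply: eq_integral => s _; rewrite /= E2.
Qed.

Lemma fourier_modulated b be x x0 al y : 0 < b -> 4 * b <= be ->
  let p := modulated b be x x0 al cos in let q := modulated b be x x0 al sin in
  let D := kern be 0 (x - y) - kern (4 * b) 0 (x - y) in
  fourier_re p q y = cos (x0 * y - al) * D /\
  fourier_im p q y = - sin (x0 * y - al) * D.
Proof.
move=> b0 bbe p q D; have cg := smoothR_continuous (@bump_gap_smooth b be).
have zg := bump_gap_supp b0 bbe.
have b40 : 0 < 4 * b by rewrite mulr_gt0.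
have be0 : 0 < be := lt_le_trans b40 bbe.
have cpi s : cos (s - pi / 2) = sin s by rewrite cosB cos_pihalf sin_pihalf mulr0 mulr1 add0r.
have smod (h : R -> R) : smoothR h -> smoothR (modulated b be x x0 al h).
  move=> sh; apply: smoothRM; first exact: smoothR_affine.
  have := @smoothR_affine R 1 (- x0) _ (@bump_gap_smooth b be).
  by congr smoothR; apply/funext => s; rewrite mul1r.
have zmod (h : R -> R) : supp_in (be + `|x0|) (modulated b be x x0 al h).
  move=> s sL; rewrite /modulated zg ?mulr0//.
  rewrite -(ltrD2r `|x0|) (lt_le_trans sL)// -{1}[s](subrK x0); exact: ler_normD.
have int0 (h : R -> R) c : smoothR h -> intble (fun s => modulated b be x x0 al h s * cos (y * s + c)).
  by move=> sh; exact: cosint_integrable (smoothR_continuous (smod h sh)) (zmod h).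
have ip c := int0 cos c smoothR_cos; have iq c := int0 sin c smoothR_sin.
split.
- rewrite /fourier_re /cosint -RintegralD//.
  pose psi s := p s * cos (y * s + 0) + q s * cos (y * s + - (pi / 2)).
  have Eh s : psi s = bump_gap b be (s - x0) * cos ((x - y) * s + (al - x * x0)).
    rewrite /psi cpi addr0 /p /q /modulated.
    have -> : (x - y) * s + (al - x * x0) = (x * s + (al - x * x0)) - y * s by ring.
    by rewrite [in RHS]cosB; ring.
  have [_ E] := cosint_translate cg zg Eh.
  rewrite [LHS]E cosint_bump_gap// -/D; congr (_ * _).
  by rewrite -cosN; congr cos; ring.
- rewrite /fourier_im /cosint -RintegralB//.
  pose psi s := q s * cos (y * s + 0) - p s * cos (y * s + - (pi / 2)).
  have Eh s : psi s = bump_gap b be (s - x0) * cos ((x - y) * s + (al - x * x0 - pi / 2)).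
    rewrite /psi cpi addr0 /p /q /modulated.
    have -> : (x - y) * s + (al - x * x0 - pi / 2) =
      ((x * s + (al - x * x0)) - y * s) - pi / 2 by ring.
    by rewrite cpi [in RHS]sinB; ring.
  have [_ E] := cosint_translate cg zg Eh.
  rewrite [LHS]E cosint_bump_gap// -/D; congr (_ * _).
  have -> : al - x * x0 - pi / 2 + (x - y) * x0 = - (x0 * y - al) - pi / 2 by ring.
  by rewrite cpi sinN.
Qed.

Lemma pairing_modulated u v b be x x0 al : 0 < b -> 4 * b <= be ->
  pairing u v (modulated b be x x0 al cos) (modulated b be x x0 al sin) =
  \int[mu]_y (demodulate u v x0 al y * (kern be 0 (x - y) - kern (4 * b) 0 (x - y))).
Proof.
move=> b0 bbe; apply: eq_Rintegral => y _.
have [-> ->] := fourier_modulated x x0 al y b0 bbe.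
by rewrite /demodulate; ring.
Qed.

Lemma tempered_demodulate u v x0 al : tempered u -> tempered v ->
  tempered (demodulate u v x0 al).
Proof.
move=> [mu1 iu] [mv iv].
have ml : measurable_fun [set: R] (fun y : R => x0 * y - al).
  by apply: measurable_funB => //; exact: measurable_funM.
have mc : measurable_fun [set: R] (fun y : R => cos (x0 * y - al)).
  apply: measurableT_comp ml; apply: continuous_measurable_fun; exact: continuous_cos.
have ms : measurable_fun [set: R] (fun y : R => sin (x0 * y - al)).
  apply: measurableT_comp ml; apply: continuous_measurable_fun; exact: continuous_sin.
have key (w h : R -> R) : measurable_fun [set: R] w -> measurable_fun [set: R] h ->
    (forall y, `|h y| <= 1) -> intble (fun y => w y * (oneDsqr y)^-1) ->
    intble (fun y => w y * h y * (oneDsqr y)^-1).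
  move=> mw mh h1 iw; apply: (@intble_le _ _ (fun y => `|w y * (oneDsqr y)^-1|)).
  - apply: measurable_funM; [exact: measurable_funM|exact: measurable_oneDsqrV].
  - by move=> y; rewrite mulrAC normrM ler_piMr.
  - exact: (integrable_norm iw).
split.
  by apply: measurable_funD; exact: measurable_funM.
have := intbleD (key u _ mu1 mc (fun y => cos_max _) iu) (key v _ mv ms (fun y => sin_max _) iv).
by congr (mu.-integrable _ (_ \o _)); apply/funext => y; rewrite -mulrDl.
Qed.

(** The difference of the two sides is a pairing with a modulated test function. This lives on two
    intervals, one on each side of x0, and [local_vanishing] treats each of them. *)
Lemma conv_demodulate u v b x0 : 0 < b -> tempered u -> tempered v ->
  (forall z, b < `|z - x0| -> exists2 r, 0 < r &
     forall p q, supported (z - r) (z + r) p q -> pairing u v p q = 0) ->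
  forall al be x, 4 * b <= be ->
  conv (demodulate u v x0 al) be x = conv (demodulate u v x0 al) (4 * b) x.
Proof.
move=> b0 tu tv gap al be x bbe.
have b40 : 0 < 4 * b by rewrite mulr_gt0.
have be0 : 0 < be := lt_le_trans b40 bbe.
have tw := tempered_demodulate x0 al tu tv.
pose p := modulated b be x x0 al cos; pose q := modulated b be x x0 al sin.
suff pq0 : pairing u v p q = 0.
  have i1 := tempered_kern 0 x be0 tw; have i2 := tempered_kern 0 x b40 tw.
  apply/eqP; rewrite -subr_eq0; apply/eqP.
  rewrite /conv -RintegralB//; move: pq0; rewrite /p /q pairing_modulated// => <-.
  by apply: eq_Rintegral => y _; rewrite mulrBr.
have smod (h : R -> R) : smoothR h -> smoothR (modulated b be x x0 al h).
  move=> sh; apply: smoothRM; first exact: smoothR_affine.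
  have := @smoothR_affine R 1 (- x0) _ (@bump_gap_smooth b be).
  by congr smoothR; apply/funext => s; rewrite mul1r.
have spq : supported (x0 - be) (x0 + be) p q.
  split; [exact: smod smoothR_cos|exact: smod smoothR_sin|move=> s ns].
  rewrite /p /q /modulated (bump_gap_supp b0 bbe) ?mulr0// ltNge.
  by apply: contra ns; rewrite ler_norml lerBrDr lerBlDl addrC.
(* [chi] climbs between x0 - 2 b and x0 + 2 b, exactly where [p] and [q] vanish, and so separates
   the two sides. *)
pose chi s := smooth_step ((4 * b)^-1 * s + (2 * b - x0) * (4 * b)^-1) : R.
have chiE s : chi s = smooth_step ((s - x0 + 2 * b) / (4 * b)).
  by rewrite /chi [_^-1 * s]mulrC -mulrDl; congr (smooth_step (_ / _)); ring.
have schi : smoothR chi by exact: smoothR_affine smooth_step_smooth.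
have schi' : smoothR (fun s => 1 + (- 1) * chi s).
  have s1 := smoothRM (@smoothR_cst R (- 1)) schi.
  exact: (smoothRD (@smoothR_cst R 1) s1).
have small s (h : R -> R) : `|s - x0| <= 2 * b -> modulated b be x x0 al h s = 0.
  by move=> sb; rewrite /modulated bump_gap0// mulr0.
have S1 : supported (x0 - be) (x0 - 2 * b) (fun s => p s * (1 + (- 1) * chi s))
    (fun s => q s * (1 + (- 1) * chi s)).
  split; [exact: smoothRM (smod _ smoothR_cos) schi'|
          exact: smoothRM (smod _ smoothR_sin) schi'|move=> s ns].
  have [_ _ z] := spq.
  have [sin1|/z[-> ->]] := boolP (x0 - be <= s <= x0 + be); last by rewrite !mul0r.
  have sb : x0 - 2 * b < s by move: ns; case/andP: sin1 => -> _ /=; rewrite -ltNge.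
  have [sb2|sb2] := leP s (x0 + 2 * b).
    by rewrite /p /q !small ?mul0r// ler_distl (ltW sb) sb2.
  rewrite chiE smooth_step_ge1 ?mulr1 ?subrr ?mulr0//.
  by rewrite ler_pdivlMr// mul1r; move: sb2; lra.
have S2 : supported (x0 + 2 * b) (x0 + be) (fun s => p s * chi s) (fun s => q s * chi s).
  split; [exact: smoothRM (smod _ smoothR_cos) schi|
          exact: smoothRM (smod _ smoothR_sin) schi|move=> s ns].
  have [_ _ z] := spq.
  have [sin1|/z[-> ->]] := boolP (x0 - be <= s <= x0 + be); last by rewrite !mul0r.
  have sb : s < x0 + 2 * b by move: ns; case/andP: sin1 => _ ->; rewrite andbT -ltNge.
  have [sb2|sb2] := leP (x0 - 2 * b) s.
    by rewrite /p /q !small ?mul0r// ler_distl (ltW sb) sb2.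
  rewrite chiE smooth_step_le0 ?mulr0//.
  by rewrite pmulr_lle0 ?invr_gt0//; move: sb2; lra.
have GD := pairingD tu tv.
have eqf f : f = (fun s => f s * (1 + (- 1) * chi s) + f s * chi s).
  by apply/funext => s; rewrite -mulrDr mulN1r subrK mulr1.
rewrite (eqf p) (eqf q) (GD (x0 - be) (x0 + be)); last 2 first.
- by apply: supported_sub S1 => //; move: b0 be0; lra.
- by apply: supported_sub S2 => //; move: b0 be0; lra.
rewrite (local_vanishing GD _ _ S1); last 2 first.
- move=> z /andP[_ zb]; apply: gap; rewrite distrC (lt_le_trans _ (ler_norm _))//.
  by move: zb b0; lra.
- by move: b0 bbe; lra.
rewrite (local_vanishing GD _ _ S2) ?addr0//.
- move=> z /andP[zb _]; apply: gap; rewrite (lt_le_trans _ (ler_norm _))//.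
  by move: zb b0; lra.
- by move: b0 bbe; lra.
Qed.

End SpectralGap.

(** * From the stated hypotheses to Borel representatives *)

Section Transfer.
Context {R : realType}.
Notation mu := (@lebesgue_measure R).
Notation intble f := (mu.-integrable [set: R] (EFin \o f)).
Implicit Types (p q u v : R -> R) (x y z a b g r : R) (B E J N : set R) (f : R -> R[i]).

(** Any point of [J] serves as centre, at the price of the radius b in place of b / 2. *)
Lemma interval_within J b : is_interval J -> leb R J = b%:E -> 0 < b ->
  exists x0, forall z, J z -> `|z - x0| <= b.
Proof.
move=> iJ Jb b0; have [J0|/set0P[x0 Jx0]] := eqVneq J set0.
  by move: b0 Jb; rewrite J0 measure0 => + [b0]; rewrite -b0 ltxx.
exists x0 => z Jz.
have key x y : J x -> J y -> x <= y -> y - x <= b.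
  move=> Jx Jy xy.
  have sub : `[x, y]%classic `<=` J by move=> w; rewrite /= in_itv/=; exact: iJ.
  have : (mu `[x, y]%classic <= leb R J)%E by apply: le_outer_measure.
  rewrite Jb lebesgue_measure_itv/= lte_fin.
  case: ltP => [_|yx _]; first by rewrite -EFinB lee_fin.
  by have := ltW b0; move: yx; lra.
have [xz|/ltW xz] := leP x0 z.
  by rewrite ger0_norm ?subr_ge0//; exact: key.
by rewrite distrC ger0_norm ?subr_ge0//; exact: key.
Qed.

(** A Borel set inside [E] that misses only a null part of it keeps the density; closed intervals
    [x, x + a] are enough from here on. *)
Lemma borel_core E a g : lebesgue_measurable E -> 0 < a ->
  (forall I : set R, is_interval I -> leb R I = a%:E ->
    ((g * a)%:E <= leb R (E `&` I))%E) ->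
  exists B N, [/\ measurable B, measurable N, mu N = 0%E,
    (forall x, ~ N x -> (E x <-> B x)) &
    forall x, ((g * a)%:E <= mu (B `&` `[x, (x + a)%R]%classic))%E].
Proof.
move=> mE a0 Eg; have [B [N [mB BE mN N0 EBN]]] := lebesgue_measurableP mE.
exists B, N; split => //.
  by move=> x nx; split => [Ex|/BE//]; apply: contrapT => nBx; apply: nx; exact: EBN.
move=> x; set I := `[x, (x + a)%R]%classic.
have Ia : leb R I = a%:E.
  have : mu I = a%:E by rewrite lebesgue_measure_itv/= lte_fin ltrDl a0 -EFinB addrAC subrr add0r.
  by [].
apply: le_trans (Eg I (@interval_is_interval R _) Ia) _.
have mI : measurable (I : set R) by exact: measurable_itv.
have mBI : measurable (B `&` I) by exact: measurableI.
have muN : (mu N <= 0)%E by rewrite N0.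
have h1 : (leb R (E `&` I) <= mu ((B `&` I) `|` N))%E.
  apply: le_outer_measure => y [Ey Iy].
  by have [By|By] := pselect (B y); [left|right; exact: EBN].
apply: le_trans h1 _; apply: le_trans (measureU2 mu mBI mN) _.
by have := leeD2l (mu (B `&` I)) muN; rewrite adde0.
Qed.

Lemma density_le1 B a g : measurable B -> 0 < a ->
  (forall x, ((g * a)%:E <= mu (B `&` `[x, (x + a)%R]%classic))%E) -> g <= 1.
Proof.
move=> mB a0 /(_ 0); rewrite add0r => Bg.
have mI : measurable (`[0, a]%classic : set R) by [].
have : (mu (B `&` `[0%R, a]%classic) <= mu `[0%R, a]%classic)%E.
  by apply: le_measure; rewrite ?inE//; exact: measurableI.
rewrite lebesgue_measure_itv/= lte_fin a0 sube0 => /(le_trans Bg).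
by rewrite lee_fin ger_pMl.
Qed.

Lemma ae_borel_measurable d (T : measurableType d) (F G : R -> T) N :
  measurable_fun [set: R] G -> measurable N -> mu N = 0%E ->
  (forall x, ~ N x -> F x = G x) ->
  measurable_fun [set: lebesgueType R] (F : lebesgueType R -> T).
Proof.
move=> mG mN N0 FG _ Y mY; rewrite setTI.
have -> : F @^-1` Y = (G @^-1` Y `\` N) `|` (F @^-1` Y `&` N).
  apply/seteqP; split => [x Yx|x [[Yx nx]|[]//]]; last by rewrite /= FG.
  by have [Nx|Nx] := pselect (N x); [right|left; split => //; rewrite /= -FG].
have m1 : @measurable _ (lebesgueType R) (G @^-1` Y `\` N).
  apply: borel_lebesgue_measurable; apply: measurableD => //.
  by rewrite -[X in measurable X]setTI; exact: mG.
apply: (@measurableU _ (lebesgueType R)) => //.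
apply: completed_lebesgue_measure_is_complete.
exists N; split => //; first exact: borel_lebesgue_measurable.
Qed.

Lemma completed_integral_ae (F G : R -> \bar R) N :
  measurable_fun [set: R] G -> measurable N -> mu N = 0%E ->
  (forall x, ~ N x -> F x = G x) ->
  (\int[leb R]_x F x = \int[mu]_x G x)%E.
Proof.
move=> mG mN N0 FG; rewrite -completed_integral//.
apply: ae_eq_integral; first exact: measurableT.
- exact: ae_borel_measurable FG.
- exact: measurable_fun_borel_lebesgue.
- exists N; split => //; first exact: borel_lebesgue_measurable.
  by move=> x /= nx; apply: contrapT => Nx; apply: nx => _; exact: FG.
Qed.

Lemma fourier_pair s t p q y : supported s t p q ->
  fourier (fun z => Complex (p z) (q z)) y = Complex (fourier_re p q y) (fourier_im p q y).
Proof.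
move=> /supportedP[/smoothR_continuous cp /smoothR_continuous cq zp zq].
have ip c := cosint_integrable c y cp zp; have iq c := cosint_integrable c y cq zq.
have cpi z : cos (z - pi / 2) = sin z by rewrite cosB cos_pihalf sin_pihalf mulr0 mulr1 add0r.
rewrite /fourier /cintegral; congr Complex.
- rewrite /fourier_re /cosint -RintegralD// /Rintegral; congr fine.
  rewrite -completed_integral; last first.
    exact: (measurable_int mu (intbleD (ip 0) (iq (- (pi / 2))))).
  apply: eq_integral => z _ /=.
  by rewrite addr0 cpi [y * z]mulrC; congr (EFin _); ring.
- rewrite /fourier_im /cosint -RintegralB// /Rintegral; congr fine.
  rewrite -completed_integral; last first.
    have := measurable_int mu (intbleD (iq 0) (intbleZ (- 1) (ip (- (pi / 2))))).
    by congr measurable_fun; apply/funext => z /=; rewrite mulN1r.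
  apply: eq_integral => z _ /=.
  by rewrite addr0 cpi [y * z]mulrC; congr (EFin _); ring.
Qed.

(** The real part suffices, since the phase [al] of the test functions reaches the imaginary part as
    well. *)
Lemma Re_fourier_distribution f u v N s t p q : tempered u -> tempered v ->
  measurable N -> mu N = 0%E ->
  (forall x, ~ N x -> complex.Re (f x) = u x /\ complex.Im (f x) = v x) ->
  supported s t p q ->
  complex.Re (fourier_distribution (distribution_of f) (fun z => Complex (p z) (q z))) =
  pairing u v p q.
Proof.
move=> tu tv mN N0 fuv spq; rewrite /fourier_distribution /distribution_of/=.
have iP := pairing_integrable tu tv spq.
rewrite /pairing /Rintegral; congr fine.
apply: (completed_integral_ae _ mN N0); first exact: (measurable_int mu iP).
move=> x /fuv[h1 h2]; congr EFin; rewrite (fourier_pair x spq).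
by case: (f x) h1 h2 => c d /= -> ->.
Qed.

Lemma supported_test_function s t p q (U : set R) : supported s t p q ->
  `[s, t]%classic `<=` U -> test_function U (fun z => Complex (p z) (q z)).
Proof.
move=> [sp sq z] stU.
have sub : function_support (fun z => Complex (p z) (q z)) `<=` `[s, t]%classic.
  have cl : closed (`[s, t]%classic : set R) by exact: itv_closed.
  rewrite /function_support closureE => x; apply; split => // w /= nz.
  rewrite in_itv/=; apply: contrapT => /negP /z[pw qw]; move: nz.
  by rewrite pw qw eqxx.
split.
- by move=> n x; split; [exact: sp|exact: sq].
- apply: subclosed_compact sub; first exact: closed_closure.
  exact: segment_compact.
- exact: subset_trans stU.
Qed.

Lemma pairing_gap f u v N J b x0 : tempered u -> tempered v ->
  measurable N -> mu N = 0%E ->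
  (forall x, ~ N x -> complex.Re (f x) = u x /\ complex.Im (f x) = v x) ->
  (forall z, J z -> `|z - x0| <= b) ->
  distribution_support (fourier_distribution (distribution_of f)) `<=` J ->
  forall z, b < `|z - x0| -> exists2 r, 0 < r &
    forall p q, supported (z - r) (z + r) p q -> pairing u v p q = 0.
Proof.
move=> tu tv mN N0 fuv Jb supp z bz.
have : ~ distribution_support (fourier_distribution (distribution_of f)) z.
  by move=> /supp /Jb; rewrite leNgt bz.
move=> /contrapT[U [oU vU] Uz].
have [e e0 eU] := (nbhs_ballP z U).1 (open_nbhs_nbhs (conj oU Uz)).
exists (e / 2); first by rewrite divr_gt0.
move=> p q spq; rewrite -(Re_fourier_distribution tu tv mN N0 fuv spq).
rewrite vU//; apply: supported_test_function spq _ => w; rewrite /= in_itv/= => /andP[h1 h2].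
apply: eU; rewrite /ball/= ltr_norml; move: e0 h1 h2 => /= e0 h1 h2.
by apply/andP; split; lra.
Qed.

End Transfer.

(** * Norms of complex functions *)

Section LpNorms.
Context {R : realType}.
Notation mu := (@lebesgue_measure R).
Notation intble f := (mu.-integrable [set: R] (EFin \o f)).
Implicit Types (u v w h : R -> R) (x y z a b g r K : R) (B E J N S : set R) (f : R -> R[i]).

Definition modulus u v x : R := Num.sqrt (u x ^+ 2 + v x ^+ 2).

Lemma modulus_ge0 u v x : 0 <= modulus u v x.
Proof. exact: sqrtr_ge0. Qed.

Lemma measurable_modulus u v : measurable_fun [set: R] u -> measurable_fun [set: R] v ->
  measurable_fun [set: R] (modulus u v).
Proof.
move=> msu msv; apply: (measurableT_comp (continuous_measurable_fun (@sqrt_continuous R))).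
by apply: measurable_funD; exact: measurable_funX.
Qed.

Lemma le_modulus u v x : `|u x| <= modulus u v x /\ `|v x| <= modulus u v x.
Proof.
by rewrite -!sqrtr_sqr; split; apply: ler_wsqrtr; rewrite ?lerDl ?lerDr sqr_ge0.
Qed.

Lemma modulus_le u v x : modulus u v x <= `|u x| + `|v x|.
Proof.
rewrite -[leRHS]ger0_norm ?addr_ge0// -sqrtr_sqr ler_wsqrtr// sqrrD !real_normK ?num_real//.
by rewrite -addrA lerD2l lerDr mulrn_wge0// mulr_ge0.
Qed.

(** At each point the two demodulated parts are the image of (u, v) under an orthogonal map of the
    plane. *)
Lemma modulus_demodulate u v x0 x :
  modulus (demodulate u v x0 0) (demodulate u v x0 (pi / 2)) x = modulus u v x.
Proof.
rewrite /modulus /demodulate subr0; congr Num.sqrt.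
rewrite cosB sinB cos_pihalf sin_pihalf !mulr0 !mulr1 add0r sub0r.
by have := cos2Dsin2 (x0 * x); set c := cos _; set s := sin _ => h;
  rewrite -[RHS]mulr1 -h; ring.
Qed.

Section Representatives.
Context f u v N (msu : measurable_fun [set: R] u) (msv : measurable_fun [set: R] v).
Hypotheses (mN : measurable N) (N0 : mu N = 0%E).
Hypothesis fuv : forall x, ~ N x -> complex.Re (f x) = u x /\ complex.Im (f x) = v x.

Let h := modulus u v.
Let mh : measurable_fun [set: R] h := measurable_modulus msu msv.
Let h0 x : 0 <= h x := modulus_ge0 u v x.

Let mhr r : measurable_fun [set: R] (fun x => (h x `^ r)%:E).
Proof. by apply/measurable_EFinP; exact: measurableT_comp (measurable_powR r) mh. Qed.

Let normc_modulus x : ~ N x -> Normc.normc (f x) = h x.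
Proof. by rewrite /h /modulus => /fuv[<- <-]; case: (f x). Qed.

Lemma Lp_norm_finite S B r : 1 <= r -> measurable B ->
  (forall x, ~ N x -> (S x <-> B x)) ->
  Lp_norm r%:E S f = ((\int[mu]_(x in B) (h x `^ r)%:E) `^ r^-1)%E.
Proof.
move=> r1 mB SB; have r0 : r != 0 by rewrite gt_eqF// (lt_le_trans ltr01).
rewrite /Lp_norm unlock; congr poweR.
rewrite [RHS]integral_mkcond; apply: (completed_integral_ae _ mN N0).
  apply: (measurable_restrictT (fun x => (h x `^ r)%:E) mB).1.
  by apply: measurable_funTS; exact: mhr.
move=> x Nx; rewrite /= !patchE; have [Bx|Bx] := pselect (B x).
  have Sx : S x by apply/(SB x Nx).
  by rewrite !mem_set//= normc_modulus// ger0_norm.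
have Sx : ~ S x by move/(SB x Nx).
by rewrite !memNset//= normr0 powR0.
Qed.

Lemma ae_completed (P : R -> Prop) : (\forall x \ae leb R, P x) <-> {ae mu, forall x, P x}.
Proof. exact: completed_negligible. Qed.

Lemma ae_notin : {ae mu, forall x, ~ N x}.
Proof. by exists N; split => // x /= /contrapT. Qed.

(** At exponent +oo the norm is an essential supremum guarded by a test that the total measure is
    positive. *)
Lemma leb_setT_gt0 : (0 < leb R [set: R])%E.
Proof.
have h1 : (mu `[0%R, 1%R]%classic <= leb R [set: R])%E by apply: le_outer_measure.
by apply: lt_le_trans h1; rewrite lebesgue_measure_itv/= lte_fin ltr01 sube0 lte_fin.
Qed.

Lemma Lp_norm_infty_le S B (M : R) : (forall x, ~ N x -> (S x <-> B x)) -> 0 <= M ->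
  (Lp_norm +oo%E S f <= M%:E)%E <-> {ae mu, forall x, B x -> h x <= M}.
Proof.
move=> SB M0; rewrite /Lp_norm unlock leb_setT_gt0.
have key : (\forall x \ae leb R, ((abse \o (EFin \o (fun x => Normc.normc (f x)) \_ S)) x <= M%:E)%E) <->
    {ae mu, forall x, B x -> h x <= M}.
  rewrite ae_completed; split => H.
  - move: H ae_notin; apply: filterS2; first exact: (ae_filter_ringOfSetsType mu).
    move=> x H Nx Bx; have Sx : S x by apply/(SB x Nx).
    by move: H; rewrite /= patchE mem_set// lee_fin normc_modulus// ger0_norm.
  - move: H ae_notin; apply: filterS2; first exact: (ae_filter_ringOfSetsType mu).
    move=> x H Nx; rewrite /= patchE lee_fin.
    case: ifPn => [/set_mem Sx|_]; last by rewrite normr0.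
    by rewrite normc_modulus// ger0_norm//; apply: H; apply/(SB x Nx).
by rewrite -key; split => /ess_supP.
Qed.

Lemma powR_modulus_integrable r : 1 <= r -> (Lp_norm r%:E [set: R] f < +oo)%E ->
  intble (fun x => h x `^ r).
Proof.
move=> r1 fin; have r0 : r != 0 by rewrite gt_eqF// (lt_le_trans ltr01).
have := Lp_norm_finite r1 measurableT (fun x _ => iff_refl _).
move=> E; move: fin; rewrite E => /(lty_poweRy (invr_neq0 r0)) fin.
apply/integrableP; split.
  exact: mhr.
by under eq_integral do rewrite gee0_abs ?lee_fin ?powR_ge0//.
Qed.

Lemma powR_integrable w r : 1 <= r -> measurable_fun [set: R] w ->
  (forall x, `|w x| <= h x) -> intble (fun x => h x `^ r) -> intble (fun x => `|w x| `^ r).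
Proof.
move=> r1 mw wh; apply: intble_le.
  by apply: measurableT_comp (measurable_powR r) _; exact: measurableT_comp.
move=> x; rewrite ger0_norm ?powR_ge0//.
by apply: le_powR => //; exact: le_trans r1.
Qed.

Lemma Linfty_bound : (Lp_norm +oo%E [set: R] f < +oo)%E ->
  exists M : R, [/\ 0 <= M, Lp_norm +oo%E [set: R] f = M%:E & {ae mu, forall x, h x <= M}].
Proof.
have := @Lnorm_ge0 _ _ _ (leb R) +oo%E (EFin \o (fun x => Normc.normc (f x)) \_ [set: R]).
rewrite -/(Lp_norm +oo [set: R] f) => ge0 fin.
have fn : Lp_norm +oo%E [set: R] f \is a fin_num by rewrite ge0_fin_numE.
have [M EM] : exists M, Lp_norm +oo%E [set: R] f = M%:E by exists (fine (Lp_norm +oo%E [set: R] f)); rewrite fineK.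
exists M; have M0 : 0 <= M by rewrite -lee_fin -EM.
split => //.
have := (@Lp_norm_infty_le [set: R] [set: R] M (fun x _ => iff_refl _) M0).1.
rewrite EM lexx => /(_ isT); apply: filterS; first exact: (ae_filter_ringOfSetsType mu).
by move=> x; apply.
Qed.

Lemma tempered_of_Lp p : (1 <= p)%E -> (Lp_norm p [set: R] f < +oo)%E ->
  tempered u /\ tempered v.
Proof.
case: p => [r|_|//]; rewrite ?lee_fin.
- move=> r1 /(powR_modulus_integrable r1) ih.
  split; apply: (tempered_power r1) => //; apply: powR_integrable ih => // x;
    by have [] := le_modulus u v x.
- move=> /Linfty_bound[M [M0 _ hM]].
  split; apply: (@tempered_bounded _ _ M) => //; move: hM; apply: filterS;
    try exact: (ae_filter_ringOfSetsType mu); move=> x /(le_trans _); apply;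
    by have [] := le_modulus u v x.
Qed.

(** The modulus is at most |w0| + |w1| and dominates each part, so the two real bounds can be added.
    For finite r the constant 8 K / g is multiplied by the r-th root of 2^r * 2 <= 4^r. At +oo, M <=
    2 (K ME + M / 32) is solved for M. *)
Lemma Lp_sampling p a b g K E B x0 : 0 < a -> 0 < b -> 0 < g -> g <= 1 -> 0 <= K ->
  measurable B -> (forall x, ~ N x -> (E x <-> B x)) ->
  (forall x, ((g * a)%:E <= mu (B `&` `[x, (x + a)%R]%classic))%E) ->
  (forall al, exists Z, [/\ measurable Z, mu Z = 0%E &
     locally_controlled (demodulate u v x0 al) b a g K B Z]) ->
  (1 <= p)%E -> (Lp_norm p [set: R] f < +oo)%E ->
  (Lp_norm p [set: R] f <= (32 * K / g)%:E * Lp_norm p E f)%E.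
Proof.
move=> a0 b0 g0 g1 K0 mB EB dens ctrl p1 fin.
have [tu tv] := tempered_of_Lp p1 fin.
set w0 := demodulate u v x0 0; set w1 := demodulate u v x0 (pi / 2).
have mw0 : measurable_fun [set: R] w0 by have [] := tempered_demodulate x0 0 tu tv.
have mw1 : measurable_fun [set: R] w1 by have [] := tempered_demodulate x0 (pi / 2) tu tv.
have w0h x : `|w0 x| <= h x by rewrite /h -(modulus_demodulate u v x0); have [] := le_modulus w0 w1 x.
have w1h x : `|w1 x| <= h x by rewrite /h -(modulus_demodulate u v x0); have [] := le_modulus w0 w1 x.
have hw x : h x <= `|w0 x| + `|w1 x| by rewrite /h -(modulus_demodulate u v x0); exact: modulus_le.
have [Z0 [mZ0 Z00 lc0]] := ctrl 0; have [Z1 [mZ1 Z10 lc1]] := ctrl (pi / 2).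
have Kg0 : 0 <= K / g by rewrite divr_ge0// ltW.
case: p p1 fin => [r|_|//]; rewrite ?lee_fin.
- move=> r1 fin; have r0 : 0 < r := lt_le_trans ltr01 r1.
  have ih := powR_modulus_integrable r1 fin.
  rewrite (Lp_norm_finite r1 measurableT (fun x _ => iff_refl _)) (Lp_norm_finite r1 mB EB).
  have mwr w : measurable_fun [set: R] w -> measurable_fun [set: R] (fun x => (`|w x| `^ r)%:E).
    move=> mw; apply/measurable_EFinP; apply: measurableT_comp (measurable_powR r) _.
    exact: measurableT_comp.
  set I := (\int[mu]_x _)%E; set IB := (\int[mu]_(x in B) _)%E.
  have IB0 : (0 <= IB)%E by apply: integral_ge0 => x _; rewrite lee_fin powR_ge0.
  pose kap0 := 8 * K / g; have kap00 : 0 <= kap0 by rewrite /kap0 -mulrA mulr_ge0.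
  have part w Z : measurable_fun [set: R] w -> (forall x, `|w x| <= h x) ->
      measurable Z -> mu Z = 0%E -> locally_controlled w b a g K B Z ->
      (\int[mu]_x (`|w x| `^ r)%:E <= (kap0 `^ r)%:E * IB)%E.
    move=> mw wh mZ Z00' lc.
    have iw := powR_integrable r1 mw wh ih.
    apply: le_trans (sampling_Lr b0 a0 g0 g1 K0 r1 mw mB mZ Z00' dens lc iw) _.
    apply: lee_wpmul2l; first by rewrite lee_fin powR_ge0.
    apply: ge0_le_integral => //.
    + by apply: measurable_funTS; exact: mwr.
    + by apply: measurable_funTS; exact: mhr.
    + by move=> x _; rewrite lee_fin le_powR// ltW.
  have bound : (I <= ((4 * kap0) `^ r)%:E * IB)%E.
    apply: (@le_trans _ _ (\int[mu]_x ((2 `^ r)%:E * ((`|w0 x| `^ r)%:E + (`|w1 x| `^ r)%:E)))%E).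
      apply: ge0_le_integral => //.
      + by move=> x _; rewrite lee_fin powR_ge0.
      + exact: mhr.
      + apply: emeasurable_funM => //; apply: emeasurable_funD; exact: mwr.
      + move=> x _; rewrite -EFinD -EFinM lee_fin.
        apply: le_trans (powRD_le r1 (normr_ge0 _) (normr_ge0 _)).
        by apply: le_powR => //; exact: ltW.
    rewrite ge0_integralZl//; last 2 first.
    + by apply: emeasurable_funD; exact: mwr.
    + by move=> x _; rewrite -EFinD lee_fin addr_ge0 ?powR_ge0.
    rewrite ge0_integralD//; [|exact: mwr|exact: mwr].
    have := leeD (part w0 Z0 mw0 w0h mZ0 Z00 lc0) (part w1 Z1 mw1 w1h mZ1 Z10 lc1).
    have p2 : (0 <= (2 `^ r)%:E :> \bar R)%E by rewrite lee_fin powR_ge0.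
    move=> /(lee_wpmul2l p2) /le_trans; apply.
    have -> : ((kap0 `^ r)%:E * IB + (kap0 `^ r)%:E * IB = (2 * kap0 `^ r)%:E * IB)%E.
      by rewrite -ge0_muleDl ?lee_fin ?powR_ge0// -EFinD -mulr2n mulr_natl.
    rewrite muleA -EFinM; apply: lee_wpmul2r => //; rewrite lee_fin mulrA.
    have -> : 4 * kap0 = 2 * 2 * kap0 by ring.
    rewrite [(_ * kap0) `^ r]powRM// [(2 * 2) `^ r]powRM// ler_wpM2r ?powR_ge0//.
    by rewrite ler_wpM2l ?powR_ge0// le1r_powR// ler1n.
  have ri0 : 0 <= r^-1 by rewrite invr_ge0 ltW.
  have I0 : (0 <= I)%E by apply: integral_ge0 => x _; rewrite lee_fin powR_ge0.
  have c0 : (0 <= ((4 * kap0) `^ r)%:E * IB)%E by rewrite mule_ge0// lee_fin powR_ge0.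
  have := gt0_ler_poweR ri0 _ _ bound.
  rewrite !in_itv/= !leey I0 c0 => /(_ isT isT) /le_trans; apply.
  rewrite poweRM ?lee_fin ?powR_ge0// poweR_EFin -powRrM mulfV ?gt_eqF//.
  by rewrite powRr1 ?(mulr_ge0 _ kap00)// (_ : 4 * kap0 = 32 * K / g)// /kap0; ring.
- move=> fin; have [M [M0 EM hM]] := Linfty_bound fin.
  have K1 : 0 <= 32 * K / g by rewrite -mulrA mulr_ge0.
  have ge0 := @Lnorm_ge0 _ _ _ (leb R) +oo%E (EFin \o (fun x => Normc.normc (f x)) \_ E).
  rewrite -/(Lp_norm +oo E f) in ge0.
  have ME_le : (Lp_norm +oo%E E f <= M%:E)%E.
    apply/(Lp_norm_infty_le EB M0); move: hM; apply: filterS; first exact: (ae_filter_ringOfSetsType mu).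
    by [].
  have fnE : Lp_norm +oo%E E f \is a fin_num.
    by rewrite ge0_fin_numE// (le_lt_trans ME_le)// ltry.
  rewrite EM; move: ge0 ME_le; rewrite -(fineK fnE); set ME := fine _ => ME0 _.
  rewrite lee_fin in ME0.
  have hE : {ae mu, forall x, B x -> h x <= ME}.
    by apply/(Lp_norm_infty_le EB ME0); rewrite /ME fineK.
  have part w Z : measurable_fun [set: R] w -> (forall x, `|w x| <= h x) ->
      measurable Z -> mu Z = 0%E -> locally_controlled w b a g K B Z ->
      {ae mu, forall x, `|w x| <= K * ME + M / 32}.
    move=> mw wh mZ Z00' lc.
    apply: (sampling_Linfty b0 a0 g0 K0 mw mB mZ Z00' dens lc) => //.
    + move: hM; apply: filterS; first exact: (ae_filter_ringOfSetsType mu).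
      by move=> x; exact: le_trans.
    + move: hE; apply: filterS; first exact: (ae_filter_ringOfSetsType mu).
      by move=> x hx /hx; exact: le_trans.
  have q0 : 0 <= 2 * (K * ME + M / 32) by rewrite mulr_ge0// addr_ge0// ?mulr_ge0.
  have hq : {ae mu, forall x, [set: R] x -> h x <= 2 * (K * ME + M / 32)}.
    move: (part w0 Z0 mw0 w0h mZ0 Z00 lc0) (part w1 Z1 mw1 w1h mZ1 Z10 lc1).
    apply: filterS2; first exact: (ae_filter_ringOfSetsType mu).
    by move=> x h1 h2 _; apply: le_trans (hw x) _; rewrite mulr_natl mulr2n lerD.
  have := (@Lp_norm_infty_le [set: R] [set: R] _ (fun x _ => iff_refl _) q0).2 hq.
  rewrite EM -EFinM !lee_fin => MM.
  have X0 : 0 <= K * ME by rewrite mulr_ge0.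
  have X1 : K * ME <= K * ME / g by rewrite ler_pdivlMr// ler_piMr.
  have -> : 32 * K / g * ME = 32 * (K * ME / g) by ring.
  by move: X0 X1 MM; move: (K * ME) (K * ME / g) => *; lra.
Qed.

End Representatives.
End LpNorms.

(** [C] has two tasks: the part 2 N + 2 makes the exponent C (t + 1) at least n + 1, and the part 32
    e makes [C] exceed both 32 and 8 e, so that (C / g)^(n + 1) dominates the sampling constant. *)
Lemma sampling_constant (R : realType) (g e N C t : R) n : 0 < g -> g <= 1 -> 1 <= e ->
  1 <= N -> C = 32 * e + 2 * N + 2 -> 0 < t -> n%:R <= N * (1 + 2 * t) + 1 ->
  (g / C) `^ (C * (t + 1)) * (32 * (8 * e / g) ^+ n / g) <= 1.
Proof.
move=> g0 g1 e1 N1 CE t0 nN.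
have C1 : 1 <= C by rewrite CE; lra.
have C0 : 0 < C := lt_le_trans ltr01 C1.
have gC0 : 0 < g / C by rewrite divr_gt0.
have e0 : 0 < e := lt_le_trans ltr01 e1.
have n1 : n.+1%:R <= C * (t + 1).
  by rewrite -natr1 CE; move: nN t0 N1 e1; nra.
have h1 : (g / C) `^ (C * (t + 1)) <= (g / C) ^+ n.+1.
  rewrite -(powR_mulrn _ (ltW gC0)); apply: ger_powR => //.
  by rewrite gC0 ler_pdivrMr// mul1r (le_trans g1).
have h2 : 32 * (8 * e / g) ^+ n / g <= (C / g) ^+ n.+1.
  have -> : 32 * (8 * e / g) ^+ n / g = (32 / g) * (8 * e / g) ^+ n.
    by rewrite mulrAC.
  rewrite exprS; apply: ler_pM.
  - by rewrite divr_ge0// ltW.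
  - by rewrite exprn_ge0// divr_ge0 ?mulr_ge0// ltW.
  - by rewrite ler_pM2r ?invr_gt0// CE; lra.
  - apply: lerXn2r; rewrite ?nnegrE ?divr_ge0 ?mulr_ge0 ?(ltW g0) ?(ltW e0) ?(ltW C0)//.
    by rewrite ler_pM2r ?invr_gt0// CE; lra.
apply: (@le_trans _ _ ((g / C) ^+ n.+1 * (C / g) ^+ n.+1)).
  apply: ler_pM => //; first exact: powR_ge0.
  by rewrite divr_ge0 ?mulr_ge0 ?exprn_ge0 ?divr_ge0 ?mulr_ge0 ?(ltW g0) ?(ltW e0).
rewrite -exprMn mulrA divfK ?gt_eqF// divff ?gt_eqF//.
Qed.

Theorem theorem1 (R : realType) :
  exists C : R, 0 < C /\
    forall (a gamma b : R) (J : set R) (p : \bar R) (E : set R)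
           (f : R -> R[i]),
      0 < a -> 0 < gamma -> 0 < b ->
      is_interval J -> leb R J = b%:E ->
      (1 <= p)%E ->
      lebesgue_measurable E ->
      (forall I : set R, is_interval I -> leb R I = a%:E ->
        ((gamma * a)%:E <= leb R (E `&` I))%E) ->
      in_Lp p f ->
      distribution_support (fourier_distribution (distribution_of f)) `<=` J ->
      ((((gamma / C) `^ (C * (a * b + 1)))%:E * Lp_norm p setT f)
         <= Lp_norm p E f)%E.
Proof.
have [A A0 kd] := @kern_decay R.
have c0 := @Rintegral_kap_gt0 R.
pose w := A * pi / (\int[lebesgue_measure]_v kap 0 v) : R.
have w0 : 0 <= w by rewrite divr_ge0 ?mulr_ge0 ?(ltW A0) ?(ltW c0) ?(ltW (pi_gt0 R)).
pose N1 := 32 * expR 1 * (1 + 32 * (32 * w)) : R.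
have e1 : 1 <= expR 1 :> R by rewrite (le_trans _ (expR_ge1Dx 1))// lerDl.
have N11 : 1 <= N1.
  have q1 : 1 <= 1 + 32 * (32 * w) by lra.
  have : 1 <= expR 1 * (1 + 32 * (32 * w)) by rewrite mulr_ege1.
  by rewrite /N1 -mulrA; move: (expR 1 * _) => z z1; lra.
pose C := 32 * expR 1 + 2 * N1 + 2; exists C.
have C0 : 0 < C by rewrite /C; lra.
split => // a g b J p E f a0 g0 b0 iJ Jb p1 mE Eg [[mfr mfi] fin] supp.
have [B [NE [mB mNE NE0 EB dens]]] := borel_core mE a0 Eg.
have g1 := density_le1 mB a0 dens.
have [u [Nu [msu mNu Nu0 fu]]] := borel_representative mfr.
have [v [Nv [msv mNv Nv0 fv]]] := borel_representative mfi.
(* One null set outside which [E] coincides with [B] and both parts of [f] with Borel functions. *)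
pose N := NE `|` (Nu `|` Nv).
have mN : measurable N by apply: measurableU => //; exact: measurableU.
have N0 : lebesgue_measure N = 0%E.
  apply/eqP; rewrite -measure_le0.
  have mU : measurable (Nu `|` Nv) by exact: measurableU.
  apply: le_trans (measureU2 lebesgue_measure mNE mU) _.
  have hU : (lebesgue_measure (Nu `|` Nv) <= 0)%E.
    apply: le_trans (measureU2 lebesgue_measure mNu mNv) _.
    have hu : (lebesgue_measure Nu <= 0)%E by rewrite Nu0.
    have hv : (lebesgue_measure Nv <= 0)%E by rewrite Nv0.
    by have := leeD hu hv; rewrite adde0.
  have hE : (lebesgue_measure NE <= 0)%E by rewrite NE0.
  by have := leeD hE hU; rewrite adde0.
have fuv x : ~ N x -> complex.Re (f x) = u x /\ complex.Im (f x) = v x.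
  by move=> nx; split; [apply: fu|apply: fv] => ?; apply: nx; right; [left|right].
have EB' x : ~ N x -> (E x <-> B x) by move=> nx; apply: EB => ?; apply: nx; left.
have [tu tv] := tempered_of_Lp msu msv mN N0 fuv p1 fin.
have [x0 Jx0] := interval_within iJ Jb b0.
have gap := pairing_gap tu tv mN N0 fuv Jx0 supp.
have b40 : 0 < 4 * b by rewrite mulr_gt0.
have ab0 : 0 < a * b by rewrite mulr_gt0.
have x1 : 1 <= N1 * (1 + 2 * (a * b)) by rewrite mulr_ege1// lerDl mulr_ge0// ltW.
(* At the scale be = 4 b the condition of [remainder_small] reads N1 (1 + 2 a b) <= m + 1. The upper
   bound on m is what [sampling_constant] turns into the exponent C (a b + 1). *)
have [m [m1 m2]] := truncn_succ_bounds x1.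
pose K := (8 * expR 1 / g) ^+ m.+1.
have K0 : 0 <= K by rewrite exprn_ge0// divr_ge0 ?mulr_ge0 ?(ltW g0)// ltW// expR_gt0.
have ctrl al : exists Z, [/\ measurable Z, lebesgue_measure Z = 0%E &
    locally_controlled (demodulate u v x0 al) (4 * b) a g K B Z].
  have tw := tempered_demodulate x0 al tu tv.
  have [Z [mZ Z0 Zrep]] := reproduction tw b40 (fun be x => conv_demodulate b0 tu tv gap al x).
  exists Z; split => //.
  apply: (@sampling_locally_controlled R A N1) => //.
  - suff -> : 1 + a * (4 * b) / 2 = 1 + 2 * (a * b) by [].
    by field.
  - by move=> y nZ; apply: contrapT => h; apply: nZ; exact: Zrep.
have := Lp_sampling msu msv mN N0 fuv a0 b40 g0 g1 K0 mB EB' dens ctrl p1 fin.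
have c10 : (0 <= ((g / C) `^ (C * (a * b + 1)))%:E :> \bar R)%E by rewrite lee_fin powR_ge0.
move=> /(lee_wpmul2l c10) /le_trans; apply.
rewrite muleA -EFinM.
have L0 : (0 <= Lp_norm p E f)%E by exact: Lnorm_ge0.
rewrite -[leRHS]mul1e; apply: lee_wpmul2r => //; rewrite lee_fin.
apply: (@sampling_constant _ _ _ N1) => //.
by move: m2; rewrite -[m.+2]addn1 natrD; lra.
Qed.
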